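(* Let $k\in\mathbb{N}$ and $i_1,\ldots,i_k\in\{0,1,\ldots,m\}$. Suppose that every $\psi_l(\tau)$ $(l=1,\ldots,k)$ is a continuous nonrandom function on $[t,T]$ and that $\{\phi_j(x)\}_{j=0}^{\infty}$ is a complete orthonormal system of continuous functions in the space $L_2([t,T])$. Then $$ J[\psi^{(k)}]_{T,t}=\mathop{\rm l.i.m.}_{p_1,\ldots,p_k\to\infty}\sum_{j_1=0}^{p_1}\ldots\sum_{j_k=0}^{p_k}C_{j_k\ldots j_1}\Biggl(\prod_{l=1}^k\zeta_{j_l}^{(i_l)}-\mathop{\rm l.i.m.}_{N\to\infty}\sum_{(l_1,\ldots,l_k)\in {\rm G}_k}\phi_{j_1}(\tau_{l_1})\Delta{\bf w}_{\tau_{l_1}}^{(i_1)}\ldots\phi_{j_k}(\tau_{l_k})\Delta{\bf w}_{\tau_{l_k}}^{(i_k)}\Biggr), $$ where $J[\psi^{(k)}]_{T,t}$ is the iterated Ito stochastic integral $$ J[\psi^{(k)}]_{T,t}=\int\limits_t^T\psi_k(t_k)\ldots\int\limits_t^{t_2}\psi_1(t_1)\,d{\bf w}_{t_1}^{(i_1)}\ldots d{\bf w}_{t_k}^{(i_k)}, $$ $\zeta_j^{(i)}=\int_t^T\phi_j(s)\,d{\bf w}_s^{(i)}$ are independent standard Gaussian random variables for various $i$ or $j$ (if $i\ne 0$), and $C_{j_k\ldots j_1}$, ${\rm G}_k$, $\tau_l$, $\Delta{\bf w}_{\tau_l}^{(i)}$ are as defined in the context.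
   Context: Setting: $(\Omega,{\rm F},{\sf P})$ is a complete probability space, $\{{\rm F}_\tau,\tau\in[0,T]\}$ is a nondecreasing right-continuous family of $\sigma$-algebras of ${\rm F}$, ${\bf f}_\tau$ is a standard $m$-dimensional Wiener process that is ${\rm F}_\tau$-measurable for every $\tau\in[0,T]$, with independent components ${\bf f}_\tau^{(i)}$, $i=1,\ldots,m$; $0\le t<T$. Put ${\bf w}_\tau^{(i)}={\bf f}_\tau^{(i)}$ for $i=1,\ldots,m$ and ${\bf w}_\tau^{(0)}=\tau$. l.i.m. denotes the limit in the mean-square sense; $p_1,\ldots,p_k\to\infty$ is a joint (multiple) limit. Kernel and Fourier coefficients: for $t_1,\ldots,t_k\in[t,T]$ put $K(t_1,\ldots,t_k)=\psi_1(t_1)\ldots\psi_k(t_k)$ if $t_1<\ldots<t_k$ and $K(t_1,\ldots,t_k)=0$ otherwise ($k\ge 2$), and $K(t_1)\equiv\psi_1(t_1)$ for $k=1$; $$C_{j_k\ldots j_1}=\int\limits_{[t,T]^k}K(t_1,\ldots,t_k)\prod_{l=1}^k\phi_{j_l}(t_l)\,dt_1\ldots dt_k .$$ Partition: for each $N$, $\{\tau_j\}_{j=0}^N$ is a partition $t=\tau_0<\ldots<\tau_N=T$ with $\max_{0\le j\le N-1}(\tau_{j+1}-\tau_j)\to 0$ as $N\to\infty$; $\Delta{\bf w}_{\tau_j}^{(i)}={\bf w}_{\tau_{j+1}}^{(i)}-{\bf w}_{\tau_j}^{(i)}$, $i=0,1,\ldots,m$. Index sets: ${\rm H}_k=\{(l_1,\ldots,l_k):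 l_1,\ldots,l_k=0,1,\ldots,N-1\}$, ${\rm L}_k=\{(l_1,\ldots,l_k)\in{\rm H}_k: l_g\ne l_r\ (g\ne r);\ g,r=1,\ldots,k\}$, ${\rm G}_k={\rm H}_k\setminus{\rm L}_k$. *)

(* Defs.v *)
From HB Require Import structures.
From mathcomp Require Import all_boot all_order all_algebra.
From mathcomp Require Import all_classical all_reals all_analysis.

Set Implicit Arguments.
Unset Strict Implicit.
Unset Printing Implicit Defensive.

Import Order.TTheory GRing.Theory Num.Theory.
Import numFieldNormedType.Exports.

Local Open Scope classical_set_scope.
Local Open Scope ring_scope.

Section LebesgueTuple.
Context (R : realType).

Definition tuple_cons n (p : measurableTypeR R * n.-tuple R) : n.+1.-tuple R :=
  [the n.+1.-tuple R of p.1 :: p.2].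

Lemma measurable_tuple_cons n : measurable_fun setT (@tuple_cons n).
Proof. exact: measurable_cons. Qed.

Section ConsMeasure.
Context (n : nat) (mu : {sigma_finite_measure set (n.-tuple R) -> \bar R}).

Definition cons_measure : set (n.+1.-tuple R) -> \bar R :=
  pushforward (@lebesgue_measure R \x mu)%E (@tuple_cons n).

Let cons_measure0 : cons_measure set0 = 0%E.
Proof. by rewrite /cons_measure /pushforward preimage_set0 measure0. Qed.

Let cons_measure_ge0 A : (0 <= cons_measure A)%E.
Proof. by rewrite /cons_measure /pushforward measure_ge0. Qed.

Let cons_measure_sigma_additive : semi_sigma_additive cons_measure.
Proof.
move=> A mA tA mUA; rewrite /cons_measure /pushforward preimage_bigcup.
have mpre B : measurable B -> measurable (@tuple_cons n @^-1` B).
  by move=> mB; rewrite -[X in measurable X]setTI; exact: measurable_tuple_cons.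
apply: measure_semi_sigma_additive; first by move=> i; exact: mpre.
- apply/trivIsetP => /= i j _ _ ij; rewrite -preimage_setI.
  by move/trivIsetP : tA => /(_ _ _ _ _ ij) ->//; rewrite preimage_set0.
- by rewrite -preimage_bigcup; exact: mpre.
Qed.

HB.instance Definition _ := isMeasure.Build _ _ _ cons_measure
  cons_measure0 cons_measure_ge0 cons_measure_sigma_additive.

Let cons_measure_sigma_finite : sigma_finite setT cons_measure.
Proof.
have /sigma_finiteP[F [FT ndF Foo]] := sigma_finiteT (@lebesgue_measure R).
have /sigma_finiteP[G [GT ndG Goo]] := sigma_finiteT mu.
pose uncons (x : n.+1.-tuple R) : measurableTypeR R * n.-tuple R :=
  (tnth x ord0, [tuple of behead x]).
have munc : measurable_fun setT uncons.
  apply/measurable_fun_pair => /=; first exact: measurable_tnth.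
  exact: measurable_behead.
have unconsK p : uncons (tuple_cons p) = p.
  by case: p => a s; rewrite /uncons /=; congr pair; exact/val_inj.
exists (fun i => uncons @^-1` (F i `*` G i)).
  rewrite -preimage_bigcup predeqE => x; split=> // _.
  have [i _ Fi] : (\bigcup_i F i) (uncons x).1 by rewrite -FT.
  have [j _ Gj] : (\bigcup_i G i) (uncons x).2 by rewrite -GT.
  exists (maxn i j) => //; split.
  - by move: Fi; exact/subsetPset/ndF/leq_maxl.
  - by move: Gj; exact/subsetPset/ndG/leq_maxr.
move=> i; have [mFi Fioo] := Foo i; have [mGi Gioo] := Goo i; split.
  by rewrite -[X in measurable X]setTI; apply: munc => //; exact: measurableX.
rewrite /cons_measure /pushforward -comp_preimage.
rewrite (_ : uncons \o _ = id); last by apply/funext => p; exact: unconsK.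
by rewrite preimage_id product_measure1E// lte_mul_pinfty// ge0_fin_numE.
Qed.

HB.instance Definition _ := Measure_isSigmaFinite.Build _ _ _ cons_measure
  cons_measure_sigma_finite.

End ConsMeasure.

(* Lebesgue measure on R^n, the n-fold product of [lebesgue_measure]: it gives
   the box of sides [B l] the measure [\prod_l lebesgue_measure (B l)]. *)
Fixpoint lebesgue_tuple n : {sigma_finite_measure set (n.-tuple R) -> \bar R} :=
  match n with
  | 0 => \d_[tuple]
  | n'.+1 => cons_measure (lebesgue_tuple n')
  end.

End LebesgueTuple.

Section Probability.
Context (R : realType) (d : measure_display) (Omega : measurableType d)
  (P : probability Omega R).

(* Sub-sigma-algebras are plain set systems on [Omega]: the sigma-algebra of
   the [measurableType] is the fixed ambient one. *)
Definition adapted_to (G : set_system Omega) (X : Omega -> R) :=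
  preimage_set_system setT X measurable `<=` G.

Definition mutually_independent (I : eqType) (G : I -> set_system Omega) :=
  forall (s : seq I) (E : I -> set Omega), uniq s ->
    (forall i, i \in s -> G i (E i)) ->
    (P (\big[setI/setT]_(i <- s) E i) = \big[*%E/1]_(i <- s) P (E i))%E.

Definition mean_square (X : Omega -> R) : \bar R :=
  'E_P[(fun omega => X omega ^+ 2)%R]%E.

Definition square_integrable (X : Omega -> R) :=
  measurable_fun setT X /\ (mean_square X < +oo)%E.

Definition lim_mean_square (T : Type) (Z : T -> Omega -> R)
    (Phi : set_system T) (X : Omega -> R) :=
  square_integrable X /\
  mean_square (fun omega => Z n omega - X omega) @[n --> Phi] --> 0%E.

Record filtration (T : R) (F : R -> set_system Omega) : Prop := {
  filtration_sigma_algebra : forall s, 0 <= s <= T -> sigma_algebra setT (F s);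
  filtration_measurable : forall s, 0 <= s <= T -> F s `<=` measurable;
  filtration_nondecreasing : forall s u, 0 <= s -> s <= u -> u <= T ->
    F s `<=` F u;
  filtration_right_continuous : forall s, 0 <= s < T ->
    F s = \bigcap_(u in `]s, T]) F u }.

Definition process_sigma_algebra (T : R) (X : R -> Omega -> R) :
    set_system Omega :=
  <<s \bigcup_(s in `[0, T]) preimage_set_system setT (X s) measurable >>.

(* [wiener_increments] says that the vector increment after [s] is independent
   of [F s]; it suffices to test this on measurable boxes. *)
Record wiener_process (T : R) (F : R -> set_system Omega) (m : nat)
    (f : 'I_m -> R -> Omega -> R) : Prop := {
  wiener_adapted : forall i s, 0 <= s <= T -> adapted_to (F s) (f i s);
  wiener_start : forall i, {ae P, forall omega, f i 0 omega = 0};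
  wiener_paths : forall i, {ae P, forall omega,
    {within `[0, T], continuous (fun s => f i s omega)}};
  wiener_gaussian : forall i s u B, 0 <= s -> s < u -> u <= T ->
    measurable B ->
    P ((fun omega => f i u omega - f i s omega) @^-1` B)
      = normal_prob 0 (Num.sqrt (u - s)) B;
  wiener_increments : forall s u A (B : 'I_m -> set R),
    0 <= s -> s <= u -> u <= T -> F s A -> (forall i, measurable (B i)) ->
    let E := \bigcap_i (fun omega => f i u omega - f i s omega) @^-1` B i in
    P (A `&` E) = (P A * P E)%E;
  wiener_components : mutually_independent
    (fun i => process_sigma_algebra T (f i)) }.

(* [w^(0)] is the time, [w^(i)] for i = 1, ..., m is the i-th component of [f]. *)
Definition integrator (m : nat) (f : 'I_m -> R -> Omega -> R) (i : 'I_m.+1)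
    (s : R) (omega : Omega) : R :=
  if unlift ord0 i is Some r then f r s omega else s.

Definition is_partition (a b : R) (n : nat) (s : nat -> R) :=
  [/\ s 0 = a, s n = b & forall j, (j < n)%N -> s j < s j.+1].

(* The class of admissible integrands on [a, b]. *)
Record M2 (F : R -> set_system Omega) (a b : R) (xi : R -> Omega -> R) :
    Prop := {
  M2_measurable :
    measurable_fun (`[a, b] `*` setT) (fun p : R * Omega => xi p.1 p.2);
  M2_adapted : forall s, a <= s <= b -> adapted_to (F s) (xi s);
  M2_square_integrable : forall s, a <= s <= b -> square_integrable (xi s);
  M2_integral : (\int[lebesgue_measure]_(s in `[a, b])
    mean_square (xi s) < +oo)%E }.

Definition step_process (n : nat) (s : nat -> R) (eta : nat -> Omega -> R)
    (u : R) (omega : Omega) : R :=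
  \sum_(j < n) eta j omega * \1_(`[s j, s j.+1[) u.

Definition step_integral (w : R -> Omega -> R) (n : nat) (s : nat -> R)
    (eta : nat -> Omega -> R) (omega : Omega) : R :=
  \sum_(j < n) eta j omega * (w (s j.+1) omega - w (s j) omega).

(* [X] is a version of the integral of [xi] with respect to [w] over [a, b].
   Stochastic integrals are only defined up to a null set, whence a relation.
   The same definition is used when [w] is the time [fun s _ => s]. *)
Definition is_ito_integral (F : R -> set_system Omega) (w : R -> Omega -> R)
    (a b : R) (xi : R -> Omega -> R) (X : Omega -> R) :=
  M2 F a b xi /\
  exists (n : nat -> nat) (s : nat -> nat -> R) (eta : nat -> nat -> Omega -> R),
  [/\ forall N, is_partition a b (n N) (s N),
      forall N j, (j < n N)%N ->
        adapted_to (F (s N j)) (eta N j) /\ square_integrable (eta N j),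
      (\int[lebesgue_measure]_(u in `[a, b])
         mean_square (fun omega =>
           step_process (n N) (s N) (eta N) u omega - xi u omega)%R)%E
        @[N --> \oo] --> 0%E
    & lim_mean_square (fun N => step_integral w (n N) (s N) (eta N)) \oo X].

(* The outermost integral is the one with the last index; the process [xi]
   chooses a version of the inner integral for each upper limit [u]. *)
Fixpoint is_iterated_ito (F : R -> set_system Omega) (m : nat)
    (f : 'I_m -> R -> Omega -> R) (a : R) (k : nat) :
    ('I_k -> 'I_m.+1) -> ('I_k -> R -> R) -> R -> (Omega -> R) -> Prop :=
  match k with
  | 0 => fun _ _ _ X => X = cst 1
  | k'.+1 => fun i psi b X => exists xi : R -> Omega -> R,
      (forall u, a <= u <= b ->
         is_iterated_ito F f a (i \o widen_ord (leqnSn k'))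
           (psi \o widen_ord (leqnSn k')) u (xi u)) /\
      is_ito_integral F (integrator f (i ord_max)) a b
        (fun u omega => psi ord_max u * xi u omega) X
  end.

End Probability.

Section Expansion.
Context (R : realType).

(* Completeness: finite linear combinations are dense in L_2([a, b]). *)
Record complete_orthonormal (a b : R) (phi : nat -> R -> R) : Prop := {
  phi_orthonormal : forall i j,
    \int[lebesgue_measure]_(x in `[a, b]) (phi i x * phi j x) = (i == j)%:R;
  phi_complete : forall g : R -> R, measurable_fun `[a, b] g ->
    (\int[lebesgue_measure]_(x in `[a, b]) (g x ^+ 2)%:E < +oo)%E ->
    forall e : R, 0 < e -> exists (n : nat) (c : nat -> R),
      (\int[lebesgue_measure]_(x in `[a, b])
        ((g x - \sum_(j < n) c j * phi j x) ^+ 2)%:E < e%:E)%E }.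

(* For [k = 1] the test on the order of the arguments is void, so that
   [kernel_K psi x = psi_1 x_1]. *)
Definition kernel_K (k : nat) (psi : 'I_k -> R -> R) (x : k.-tuple R) : R :=
  if [forall r : 'I_k, forall s : 'I_k, (r < s)%N ==> (tnth x r < tnth x s)]
  then \prod_(l < k) psi l (tnth x l) else 0.

Definition fourier_coef (a b : R) (k : nat) (psi : 'I_k -> R -> R)
    (phi : nat -> R -> R) (j : 'I_k -> nat) : R :=
  \int[lebesgue_tuple R k]_(x in [set x | forall l, tnth x l \in `[a, b]])
    (kernel_K psi x * \prod_(l < k) phi (j l) (tnth x l)).

Definition partition_sequence (a b : R) (tau : nat -> nat -> R) :=
  (forall N, (0 < N)%N -> is_partition a b N (tau N)) /\
  \big[Num.max/0]_(j < N) (tau N j.+1 - tau N j) @[N --> \oo] --> (0 : R).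

End Expansion.

Definition H_set (k N : nat) : {set {ffun 'I_k -> 'I_N}} := [set: _].

Definition L_set (k N : nat) : {set {ffun 'I_k -> 'I_N}} :=
  [set l in H_set k N |
    [forall g : 'I_k, forall r : 'I_k, (g != r) ==> (l g != l r)]].

Definition G_set (k N : nat) : {set {ffun 'I_k -> 'I_N}} :=
  H_set k N :\: L_set k N.

(* the filter of p_1, ..., p_k -> oo jointly *)
Definition joint_infty (k : nat) : set_system ('I_k -> nat) :=
  [set A | exists n, forall p : 'I_k -> nat, (forall l, (n <= p l)%N) -> A p].

(* Main.v *)
Require Import Defs.
From HB Require Import structures.
From mathcomp Require Import all_boot all_order all_algebra.
From mathcomp Require Import fingroup perm.
From mathcomp Require Import all_classical all_reals all_analysis.
From mathcomp Require Import measurable_realfun ring lra.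

(** Fix the indices [j] of a product of basis functions. Expanding the product
    of the Riemann sums of the [zeta (i l) (j l)] gives a sum over all tuples of
    cells. Those with a repeated cell form the subtracted sum over [G_set], so
    the bracket of the expansion is the mean-square limit of the sum over tuples
    of distinct cells of the weight [\prod_l phi (j l)]. The theorem therefore
    says that these distinct sums turn the Fourier expansion of the kernel into
    an expansion of the iterated integral.

    Two facts carry this. First, a sum over distinct cells splits, according to
    the permutation that sorts the tuple, into [k!] sums over increasing tuples
    ([sum_L_set]). Each of them is an iterated sum in which the last increment
    multiplies a variable that is measurable with respect to the past, so Itô's
    isometry applied [k] times bounds the second moment of a distinct sum by
    [k! * (1 + T) ^ k] times the sum of the squared weights multiplied by the
    volumes of the cells ([distinct_sum_le]). The constant [1 + T] takes care of
    integration with respect to time, where Cauchy-Schwarz replaces the isometry.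
    Second, when the weight is a bounded continuous function minus the kernel,
    those sums of squares are asymptotically at most an integral over the cube
    ([riemann_distinct_le]). The kernel jumps where two coordinates agree, but
    tuples of distinct cells avoid this set.

    Apply both to the kernel minus the partial sum [Q_p] of its Fourier series.
    The distinct sums with the kernel as weight are the iterated sums of
    [psi_1, ..., psi_k], which tend to [J] ([iterated_sum_cvg]), and the distinct
    sums of [Q_p] tend to the truncated expansion. Hence the latter differs from
    [J] in mean square by at most a constant times the squared distance from
    [Q_p] to the kernel in the space of square-integrable functions on the cube
    ([partial_sum_ito_le]). That distance tends to zero: the kernel is a limit of
    finite sums of products of functions of one variable, namely those that
    compare the cells of the coordinates instead of the coordinates; such
    products are approximated factor by factor because the basis is complete;
    and a partial sum of a Fourier series is the best approximation in its span,
    for every truncation that is large in all directions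
    ([partial_sum_cvg]).

    Mean-square convergence of the product of Riemann sums to the product of the
    [zeta] needs bounds on higher moments ([prod_mean_square_cvg]). They hold
    because the Riemann sums of a Wiener integral are Gaussian.

    The law and the independence of the [zeta] come from cosine transforms.
    Conditioning on the past one cell at a time computes the mean of the cosine
    of a linear combination of Riemann sums; in the limit the variance becomes
    the quadratic form of the inner products of the basis, which is the identity
    ([cos_zetas]). A bounded weight [Z] being allowed, the means of
    [Z * cos (l * X + th)] determine those of [Z * \1_B X] ([charfun_unique]), so
    in a mean of a product of cosines the cosines can be replaced by indicators
    one variable at a time ([indic_cos_zetas]). *)

Set Implicit Arguments.
Unset Strict Implicit.
Unset Printing Implicit Defensive.

Import Order.TTheory GRing.Theory Num.Theory.
Import numFieldNormedType.Exports.

Local Open Scope classical_set_scope.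
Local Open Scope ring_scope.

(** * Square-integrable functions *)

Lemma sqr_sum_le (R : realType) (I : finType) (x : I -> R) :
  (\sum_i x i) ^+ 2 <= #|I|%:R * \sum_i x i ^+ 2.
Proof.
have -> : #|I|%:R * \sum_i x i ^+ 2 =
    \sum_i \sum_j (x i ^+ 2 + x j ^+ 2) / 2.
  transitivity (\sum_i (#|I|%:R * (x i ^+ 2) / 2 + (\sum_j x j ^+ 2) / 2)).
    rewrite big_split /= sumr_const -mulr_suml -mulr_sumr.
    by rewrite -[#|_|]/(#|I|) -mulr_natl; lra.
  apply: eq_bigr => i _; rewrite -mulr_suml big_split /= sumr_const mulrDl.
  by rewrite -[#|_|]/(#|I|) mulr_natl.
rewrite expr2 mulr_suml ler_sum// => i _; rewrite mulr_sumr ler_sum// => j _.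
by have := sqr_ge0 (x i - x j); nra.
Qed.

Lemma le_of_eq (disp : Order.disp_t) (T : porderType disp) (x y : T) :
  x = y -> (x <= y)%O.
Proof. by move=> ->. Qed.

Lemma indic_norm_le1 (R : realType) (T : Type) (A : set T) x : `|\1_A x : R| <= 1.
Proof. by rewrite indicE; case: (_ \in _); rewrite ?normr1 ?normr0. Qed.

Lemma Rint_sum_in (R : realType) d (T : measurableType d) (nu : {measure set T -> \bar R})
    (D : set T) I (s : seq I) (F : I -> T -> R) : measurable D ->
  (forall i, nu.-integrable D (EFin \o F i)) ->
  nu.-integrable D (EFin \o (fun x => \sum_(i <- s) F i x)) /\
  \int[nu]_(x in D) (\sum_(i <- s) F i x) = \sum_(i <- s) \int[nu]_(x in D) F i x.
Proof.
move=> mD iF; elim: s => [|i s [is_ ih]].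
  have E : (fun x => \sum_(i <- [::]) F i x) = cst 0.
    by apply/funext => x; rewrite big_nil.
  rewrite E big_nil; split; first exact: integrable0.
  by rewrite Rintegral_cst// mul0r.
have E : (fun x => \sum_(j <- i :: s) F j x) = (fun x => F i x + \sum_(j <- s) F j x).
  by apply/funext => x; rewrite big_cons.
rewrite E big_cons -ih RintegralD//; split=> //.
by have := integrableD mD (iF i) is_; exact: eq_integrable.
Qed.

Section L2.
Context d (T : measurableType d) (R : realType).
Variable mu : {measure set T -> \bar R}.
Implicit Types f g h : T -> R.

Definition L2 f := measurable_fun setT f /\
  mu.-integrable setT (EFin \o (fun x => f x ^+ 2)).

Definition ip f g : R := \int[mu]_x (f x * g x).

Lemma L2_measurable f : L2 f -> measurable_fun setT f. Proof. by case. Qed.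

Lemma L2M_integrable f g : L2 f -> L2 g ->
  mu.-integrable setT (EFin \o (fun x => f x * g x)).
Proof.
move=> [mf f2] [mg g2].
have := integrableD measurableT f2 g2; apply: le_integrable => //.
  by apply/measurable_EFinP; exact: measurable_funM.
move=> x _ /=; rewrite lee_fin [leRHS]ger0_norm ?addr_ge0 ?sqr_ge0//.
have h0 := sqr_ge0 (`|f x| - `|g x|).
by rewrite normrM -(real_normK (num_real (f x))) -(real_normK (num_real (g x)));
  nra.
Qed.

Lemma L2_ext f g : f =1 g -> L2 f -> L2 g.
Proof. by move=> /funext ->. Qed.

Lemma L2D f g : L2 f -> L2 g -> L2 (fun x => f x + g x).
Proof.
move=> Lf Lg; have [mf f2] := Lf; have [mg g2] := Lg; split.
  exact: measurable_funD.
have := integrableZl measurableT 2 (integrableD measurableT f2 g2).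
apply: le_integrable => //.
  by apply/measurable_EFinP/measurable_funX; exact: measurable_funD.
move=> x _ /=; rewrite lee_fin ger0_norm ?sqr_ge0//; apply: le_trans (ler_norm _).
by have := sqr_ge0 (f x - g x); nra.
Qed.

Lemma L2Z c f : L2 f -> L2 (fun x => c * f x).
Proof.
move=> [mf f2]; split; first exact: measurable_funM.
apply: eq_integrable (integrableZl measurableT (c ^+ 2) f2) => // x _ /=.
by rewrite -EFinM exprMn.
Qed.

Lemma L2N f : L2 f -> L2 (fun x => - f x).
Proof. by move=> /(L2Z (-1)); apply: L2_ext => x; rewrite mulN1r. Qed.

Lemma L2B f g : L2 f -> L2 g -> L2 (fun x => f x - g x).
Proof. by move=> Lf Lg; apply: L2D => //; exact: L2N. Qed.

Lemma L2_0 : L2 (fun=> 0).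
Proof.
split => //; rewrite (_ : _ \o _ = cst 0%E); first exact: integrable0.
by apply/funext => x /=; rewrite expr0n.
Qed.

Lemma L2_sum I (s : seq I) (Q : pred I) (F : I -> T -> R) :
  (forall i, Q i -> L2 (F i)) -> L2 (fun x => \sum_(i <- s | Q i) F i x).
Proof.
move=> LF; elim: s => [|i s ih].
  by apply: (L2_ext _ L2_0) => x; rewrite big_nil.
case: (boolP (Q i)) => Qi.
  by apply: (L2_ext _ (L2D (LF _ Qi) ih)) => x; rewrite big_cons Qi.
by apply: (L2_ext _ ih) => x; rewrite big_cons (negbTE Qi).
Qed.

Lemma Rint_sum I (s : seq I) (F : I -> T -> R) :
  (forall i, mu.-integrable setT (EFin \o F i)) ->
  \int[mu]_x (\sum_(i <- s) F i x) = \sum_(i <- s) \int[mu]_x F i x.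
Proof. by move=> iF; exact: (Rint_sum_in s measurableT iF).2. Qed.

Lemma eq_ip f f' g g' : f =1 f' -> g =1 g' -> ip f g = ip f' g'.
Proof. by move=> /funext -> /funext ->. Qed.

Lemma ipC f g : ip f g = ip g f.
Proof. by apply: eq_Rintegral => x _; rewrite mulrC. Qed.

Lemma ipZl c f g : L2 f -> L2 g -> ip (fun x => c * f x) g = c * ip f g.
Proof.
move=> Lf Lg; rewrite /ip -RintegralZl//; last exact: L2M_integrable.
by apply: eq_Rintegral => x _; rewrite mulrA.
Qed.

Lemma ipDl f g h : L2 f -> L2 g -> L2 h ->
  ip (fun x => f x + g x) h = ip f h + ip g h.
Proof.
move=> Lf Lg Lh; rewrite /ip -RintegralD//; last 2 [exact: L2M_integrable].
  by apply: eq_Rintegral => x _; rewrite mulrDl.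
exact: L2M_integrable.
Qed.

Lemma ip_suml I (s : seq I) (F : I -> T -> R) g : (forall i, L2 (F i)) -> L2 g ->
  ip (fun x => \sum_(i <- s) F i x) g = \sum_(i <- s) ip (F i) g.
Proof.
move=> LF Lg; rewrite /ip -Rint_sum.
  by apply: eq_Rintegral => x _; rewrite mulr_suml.
by move=> i; exact: L2M_integrable.
Qed.

Lemma ip_sum2 I J (r : seq I) (s : seq J) (F : I -> T -> R) (G : J -> T -> R) :
  (forall i, L2 (F i)) -> (forall i, L2 (G i)) ->
  ip (fun x => \sum_(i <- r) F i x) (fun x => \sum_(j <- s) G j x) =
  \sum_(i <- r) \sum_(j <- s) ip (F i) (G j).
Proof.
move=> LF LG; rewrite ip_suml//; last exact: L2_sum.
apply: eq_bigr => i _; rewrite ipC ip_suml//.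
by apply: eq_bigr => j _; rewrite ipC.
Qed.

Lemma ip_ge0 f : 0 <= ip f f.
Proof. by apply: Rintegral_ge0 => x _; rewrite -expr2 sqr_ge0. Qed.

Lemma ip_sum_le (I : finType) (F : I -> T -> R) : (forall i, L2 (F i)) ->
  ip (fun x => \sum_i F i x) (fun x => \sum_i F i x) <=
  #|I|%:R * \sum_i ip (F i) (F i).
Proof.
move=> LF; have [iF <-] := Rint_sum_in (index_enum I) measurableT
  (fun i => L2M_integrable (LF i) (LF i)).
rewrite -RintegralZl//; apply: le_Rintegral => //.
- by apply: L2M_integrable; exact: L2_sum.
- by have := integrableZl measurableT #|I|%:R iF; exact: eq_integrable.
- by move=> x _; have := sqr_sum_le (fun i => F i x); rewrite expr2.
Qed.

Lemma ipD_le f g : L2 f -> L2 g ->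
  ip (fun x => f x + g x) (fun x => f x + g x) <= 2 * (ip f f + ip g g).
Proof.
move=> Lf Lg.
have LF b : L2 (if b then f else g) by case: b.
have := ip_sum_le LF; rewrite card_bool big_bool.
by apply: le_trans; apply: le_of_eq;
  apply: eq_ip => x; rewrite big_bool.
Qed.

Lemma ipD3_le f g h : L2 f -> L2 g -> L2 h ->
  ip (fun x => f x + g x + h x) (fun x => f x + g x + h x) <=
  3 * (ip f f + ip g g + ip h h).
Proof.
move=> Lf Lg Lh.
have LF (i : 'I_3) : L2 (nth f [:: f; g; h] i) by case: i => -[|[|[|]]].
have := ip_sum_le LF; rewrite card_ord !big_ord_recr !big_ord0 /= !add0r.
by apply: le_trans; apply: le_of_eq;
  apply: eq_ip => x; rewrite !big_ord_recr !big_ord0 /= !add0r.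
Qed.

Lemma ipN f : ip (fun x => - f x) (fun x => - f x) = ip f f.
Proof. by apply: eq_Rintegral => x _; rewrite mulrNN. Qed.

Lemma ipBC f g :
  ip (fun x => f x - g x) (fun x => f x - g x) =
  ip (fun x => g x - f x) (fun x => g x - f x).
Proof. by rewrite -ipN; apply: eq_ip => x; rewrite opprB. Qed.

Lemma ip_sqrZ c f : L2 f -> ip (fun x => c * f x) (fun x => c * f x) = c ^+ 2 * ip f f.
Proof.
by move=> Lf; rewrite ipZl ?(ipC f) ?ipZl// ?expr2 ?mulrA//; exact: L2Z.
Qed.

Lemma ip_sqrD f g : L2 f -> L2 g ->
  ip (fun x => f x + g x) (fun x => f x + g x) = ip f f + 2 * ip f g + ip g g.
Proof.
move=> Lf Lg; rewrite ipDl//; last exact: L2D.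
by rewrite (ipC f) (ipC g) !ipDl// (ipC g f); ring.
Qed.

End L2.

Notation sqnorm mu f := (ip mu f f).

(** * Completeness in mean square *)

Section riesz_fischer.
Context d (T : measurableType d) (R : realType) (P : probability T R).
Implicit Types f g h : T -> R.

Lemma Rint_cst (c : R) : \int[P]_x c = c.
Proof. by rewrite /Rintegral integral_cst//= probability_setT mule1. Qed.

Lemma ip_cst (c c' : R) : ip P (cst c) (cst c') = c * c'.
Proof. exact: (Rint_cst (c * c')). Qed.

Lemma L2_cst (c : R) : L2 P (cst c).
Proof.
split => //; have := finite_measure_integrable_cst P (c ^+ 2) measurableT.
exact: eq_integrable.
Qed.

Lemma L2_integrable f : L2 P f -> P.-integrable setT (EFin \o f).
Proof.
move=> Lf; have := L2M_integrable Lf (L2_cst 1).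
by apply: eq_integrable => // x _ /=; rewrite mulr1.
Qed.

Lemma L2_bounded f (M : R) : measurable_fun setT f -> (forall x, `|f x| <= M) ->
  L2 P f.
Proof.
move=> mf fM; split => //.
apply: (le_integrable measurableT _ _ (finite_measure_integrable_cst P (M ^+ 2) measurableT)).
  by apply/measurable_EFinP; exact: measurable_funX.
move=> x _; rewrite /= lee_fin !ger0_norm ?sqr_ge0//.
by rewrite -(real_normK (num_real (f x))) lerXn2r// ?nnegrE//; exact: le_trans (fM x).
Qed.

(** The inequality 2|y| <= y^2 / e + e turns a bound on the second moment into
    one on the first moment. *)
Lemma Rint_norm_le f (e : R) : 0 < e -> L2 P f ->
  \int[P]_x `|f x| <= (sqnorm P f / e + e) / 2.
Proof.
move=> e0 Lf.
have i1 := integrable_norm (L2_integrable Lf).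
have i2 := integrableZl measurableT (2 * e)^-1 (L2M_integrable Lf Lf).
have i3 := finite_measure_integrable_cst P (e / 2) measurableT.
have -> : (sqnorm P f / e + e) / 2 = \int[P]_x ((2 * e)^-1 * (f x * f x) + e / 2).
  rewrite (@RintegralD _ _ _ _ _ (fun x => (2 * e)^-1 * (f x * f x)) (cst (e / 2)))//.
  rewrite RintegralZl//; last exact: L2M_integrable.
  rewrite (Rint_cst (e / 2)) -/(sqnorm P f).
  by field; rewrite gt_eqF.
apply: le_Rintegral => //.
  by have := integrableD measurableT i2 i3; apply: eq_integrable.
move=> x _; rewrite -subr_ge0.
have -> : (2 * e)^-1 * (f x * f x) + e / 2 - `|f x| = (2 * e)^-1 * (`|f x| - e) ^+ 2.
  rewrite -[f x * f x]expr2 -(real_normK (num_real (f x))).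
  by field; rewrite gt_eqF.
by rewrite mulr_ge0 ?sqr_ge0// invr_ge0 mulr_ge0// ltW.
Qed.

(** The first moments of the increments are summable, so the sum of their
    absolute values is integrable, hence finite on a set of full measure. *)
Lemma fast_L2_cauchy_cvg (X : nat -> T -> R) :
  (forall n, L2 P (X n)) ->
  (forall n, sqnorm P (fun x => X n.+1 x - X n x)
     <= (2 ^- n.+1) ^+ 2) ->
  exists2 A, measurable A /\ P (~` A) = 0%E &
    forall x, A x -> cvgn (X ^~ x).
Proof.
move=> LX dX.
pose Y k x := `|X k.+1 x - X k x|.
have LY k : L2 P (fun x => X k.+1 x - X k x) by exact: L2B.
have mY k : measurable_fun setT (fun x => (Y k x)%:E).
  by apply/measurable_EFinP; apply: measurableT_comp => //; have [] := LY k.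
pose S x := (\sum_(k <oo) (Y k x)%:E)%E.
have mS : measurable_fun setT S.
  by apply: ge0_emeasurable_sum => // k x _ _; rewrite lee_fin normr_ge0.
have e0 k : 0 < 2 ^- k.+1 :> R by rewrite invr_gt0 exprn_gt0.
have intY k : (\int[P]_x (Y k x)%:E <= (2 ^- k.+1)%:E)%E.
  have /fineK <- : (\int[P]_x (Y k x)%:E)%E \is a fin_num.
    apply: integrable_fin_num => //.
    exact: (integrable_norm (L2_integrable (LY k))).
  rewrite lee_fin; apply: le_trans (Rint_norm_le (e0 k) (LY k)) _.
  have : sqnorm P (fun x => X k.+1 x - X k x) / 2 ^- k.+1
      <= (2 ^- k.+1) ^+ 2 / 2 ^- k.+1.
    by rewrite ler_wpM2r ?dX// invr_ge0 ltW.
  rewrite [X in _ <= X / _]expr2 mulfK ?gt_eqF// => ?.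
  by move: (e0 k) => ?; lra.
have iS : P.-integrable setT S.
  apply/integrableP; split => //.
  rewrite (eq_integral S); last first.
    by move=> x _; rewrite gee0_abs// nneseries_ge0// => n _ _; rewrite lee_fin normr_ge0.
  rewrite integral_nneseries//; last by move=> n x _; rewrite lee_fin normr_ge0.
  apply: (@le_lt_trans _ _ (\sum_(k <oo) (1 / (2 ^ k.+1)%:R)%:E)%E); last first.
    by apply: le_lt_trans (@epsilon_trick0 R 1 xpredT ler01) _; rewrite ltry.
  apply: lee_nneseries => [k _ _|k _].
    by apply: integral_ge0 => x _; rewrite lee_fin normr_ge0.
  by rewrite div1r natrX; exact: intY.
exists (S @^-1` [set r | r < +oo]%E); first split.
- rewrite -[X in measurable X]setTI.
  exact: (emeasurable_fun_infty_o measurableT mS).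
- have [N [mN N0 sN]] := integrable_ae measurableT iS.
  apply: subset_measure0 N0 => //.
    rewrite -[X in measurable X]setTI; apply: measurableI => //.
    apply: measurableC; rewrite -[X in measurable X]setTI.
    exact: (emeasurable_fun_infty_o measurableT mS).
  by move=> x /= Sx; apply: sN => /= /(_ Logic.I); rewrite fin_numE -ltey => /andP[].
- move=> x Sx.
  suff : cvgn (series (telescope (X ^~ x))).
    move=> cS; rewrite (_ : X ^~ x = (fun n => X 0 x + series (telescope (X ^~ x)) n)).
      by apply: is_cvgD => //; exact: is_cvg_cst.
    by apply/funext => n; rewrite -eq_sum_telescope.
  apply: normed_cvg; apply: nondecreasing_is_cvgn.
    by apply: nondecreasing_series => n _ _; exact: normr_ge0.
  exists (fine (S x)) => _ [n _ <-].
  have Sfin : S x \is a fin_num.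
    rewrite fin_numE andbC -ltey Sx/= gt_eqF// (lt_le_trans (ltNyr 0))//.
    by rewrite nneseries_ge0// => k _ _; rewrite lee_fin normr_ge0.
  rewrite -lee_fin fineK// /series/= -sumEFin /S.
  rewrite -[leLHS](@eq_big_nat _ _ _ _ _ (fun k => (Y k x)%:E))//.
  by apply: nneseries_lim_ge => k _; rewrite lee_fin normr_ge0.
Qed.

(** A subsequence with geometrically decreasing increments converges on a set
    of full measure; Fatou's lemma then bounds the mean-square distance to its
    limit by the distances along the sequence. *)
Lemma riesz_fischer (X : nat -> T -> R) :
  (forall n, L2 P (X n)) ->
  (forall e, 0 < e -> exists N, forall m n, (N <= m)%N -> (N <= n)%N ->
     sqnorm P (fun x => X m x - X n x) <= e) ->
  exists2 Y, L2 P Y &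
    sqnorm P (fun x => X n x - Y x) @[n --> \oo] --> (0 : R).
Proof.
move=> LX cX.
have e0 k : 0 < (2 ^- k.+1) ^+ 2 :> R by rewrite exprn_gt0// invr_gt0 exprn_gt0.
have [N HN] : exists N : nat -> nat, forall k m n, (N k <= m)%N -> (N k <= n)%N ->
    sqnorm P (fun x => X m x - X n x) <= (2 ^- k.+1) ^+ 2.
  exists (fun k => sval (cid (cX _ (e0 k)))) => k m n.
  by case: cid => /= N; apply.
pose g k := (\sum_(i < k.+1) N i + k)%N.
have gN k : (N k <= g k)%N by rewrite /g big_ord_recr /= -addnA addnCA leq_addr.
have gS k : (g k <= g k.+1)%N by rewrite /g [in leqRHS]big_ord_recr /= leq_add// leq_addr.
have gk k : (k <= g k)%N by rewrite leq_addl.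
have [A [mA A0] cA] := fast_L2_cauchy_cvg (fun n => LX (g n))
  (fun n => HN n (g n.+1) (g n) (leq_trans (gN n) (gS n)) (gN n)).
have mX n : measurable_fun setT (X n) by have [] := LX n.
(* Cutting off at 0 outside A gives a sequence that converges everywhere,
   whose limit is measurable. *)
pose X' k x := X (g k) x * \1_A x.
have cX' x : cvgn (X' ^~ x).
  have [Ax|Ax] := pselect (A x).
    rewrite (_ : X' ^~ x = (fun k => X (g k) x)); first exact: cA.
    by apply/funext => k; rewrite /X' indicE mem_set// mulr1.
  rewrite (_ : X' ^~ x = (fun=> 0)); first exact: is_cvg_cst.
  by apply/funext => k; rewrite /X' indicE memNset// mulr0.
pose Y x := limn (X' ^~ x).
have mX' k : measurable_fun setT (X' k).
  by apply: measurable_funM => //; exact: measurable_indic.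
have mY : measurable_fun setT Y.
  by apply: (measurable_fun_cvg mX') => x _; exact: cX'.
have fatou_le n e : (forall k, (n <= k)%N ->
    sqnorm P (fun x => X n x - X (g k) x) <= e) ->
    (\int[P]_x ((X n x - Y x) ^+ 2)%:E <= e%:E)%E.
  move=> He; pose h k x := ((X n x - X' k x) ^+ 2)%:E.
  have mh k : measurable_fun setT (h k).
    by apply/measurable_EFinP/measurable_funX; exact: measurable_funB.
  have h0 k x : setT x -> (0 <= h k x)%E by move=> _; rewrite lee_fin sqr_ge0.
  have -> : (\int[P]_x ((X n x - Y x) ^+ 2)%:E)%E =
      (\int[P]_x limn_einf (h^~ x))%E.
    apply: eq_integral => x _; rewrite is_cvg_limn_einfE.
      apply/esym/cvg_lim => //; apply: cvg_EFin; first exact: nearW.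
      apply: (@cvgM _ _ _ _ (fun k => X n x - X' k x) (fun k => X n x - X' k x));
        by apply: cvgB; [exact: cvg_cst|exact: cX'].
    apply/cvg_ex; exists ((X n x - Y x) ^+ 2)%:E.
    apply: cvg_EFin; first exact: nearW.
    apply: (@cvgM _ _ _ _ (fun k => X n x - X' k x) (fun k => X n x - X' k x));
      by apply: cvgB; [exact: cvg_cst|exact: cX'].
  apply: le_trans (fatou _ _ _ _) _ => //.
  rewrite limn_einf_lim; apply: lime_le; first exact: is_cvg_einfs.
  apply: nearW => j; apply: (@le_trans _ _ (\int[P]_x h (maxn j n) x)%E).
    by apply: ereal_inf_lbound; exists (maxn j n) => //=; exact: leq_maxl.
  have LX' : L2 P (X' (maxn j n)).
    split => //; apply: le_integrable (proj2 (LX (g (maxn j n)))) => //.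
      by apply/measurable_EFinP; exact: measurable_funX.
    move=> x _; rewrite /= lee_fin !ger0_norm ?sqr_ge0// /X' exprMn.
    by rewrite ler_piMr ?sqr_ge0// indicE; case: (_ \in _); rewrite ?expr1n ?expr0n.
  have LXX' : L2 P (fun x => X n x - X' (maxn j n) x) by exact: L2B.
  rewrite -[leLHS]fineK; last first.
    by apply: integrable_fin_num => //; case: LXX'.
  rewrite lee_fin; apply: le_trans (He (maxn j n) (leq_maxr _ _)).
  apply: le_of_eq; congr fine.
  apply: ae_eq_integral => //.
    apply/measurable_EFinP; apply: measurable_funM; apply: measurable_funB => //.
  exists (~` A); split => //; first exact: measurableC.
  move=> x /= hx Ax; apply: hx => _; rewrite /h /X' indicE mem_set// mulr1.
  by rewrite expr2.
have L2Y : forall n e, (forall k, (n <= k)%N ->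
    sqnorm P (fun x => X n x - X (g k) x) <= e) ->
    L2 P (fun x => X n x - Y x).
  move=> n e /fatou_le H; split; first exact: measurable_funB.
  apply/integrableP; split.
    by apply/measurable_EFinP/measurable_funX; exact: measurable_funB.
  rewrite (eq_integral (fun x => ((X n x - Y x) ^+ 2)%:E)).
    by apply: le_lt_trans H _; rewrite ltry.
  by move=> x _; rewrite /= ger0_norm ?sqr_ge0.
have LY : L2 P Y.
  have [n Hn] := cX 1 ltr01.
  have : L2 P (fun x => X n x - Y x).
    by apply: (L2Y n 1) => k nk; apply: Hn => //; exact: leq_trans nk (gk k).
  move=> /(L2B (LX n)); apply: L2_ext => x; by rewrite opprB addrCA subrr addr0.
exists Y => //.
apply/cvgrPdist_le => e e_gt0.
have [n Hn] := cX e e_gt0; exists n => //= k /= nk.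
rewrite sub0r normrN ger0_norm ?ip_ge0//.
have := @fatou_le k e _; rewrite -lee_fin.
have LkY := L2B (LX k) LY.
rewrite -[leLHS]fineK; last by apply: integrable_fin_num => //; case: LkY.
move=> H; rewrite lee_fin -lee_fin; apply: H => j kj.
by apply: Hn => //; apply: leq_trans (gk j); exact: leq_trans kj.
Qed.
End riesz_fischer.

(** * Mean-square limits of products *)

Section cvg0.
Context (R : realType) (I : Type) (F : set_system I) {FF : Filter F}.

Lemma cvg0_le (a b : I -> R) : (\forall n \near F, 0 <= a n <= b n) ->
  b n @[n --> F] --> (0 : R) -> a n @[n --> F] --> (0 : R).
Proof.
by move=> ab b0; apply: (@squeeze_cvgr _ _ _ _ (cst 0) b) => //; exact: cvg_cst.
Qed.

Lemma cvg0_2D (a b : I -> R) :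
  a n @[n --> F] --> (0 : R) -> b n @[n --> F] --> (0 : R) ->
  2 * (a n + b n) @[n --> F] --> (0 : R).
Proof.
move=> a0 b0; have := cvgM (@cvg_cst _ (2 : R) _ F _) (cvgD a0 b0).
by rewrite addr0 mulr0; apply.
Qed.
End cvg0.

Section mean_square_convergence.
Context d (T : measurableType d) (R : realType) (P : probability T R).
Implicit Types f g h : T -> R.

Lemma mean_squareE f : mean_square P f = (\int[P]_x ((f x) ^+ 2)%:E)%E.
Proof. by rewrite /mean_square unlock. Qed.

Lemma L2_mean_square f : L2 P f -> mean_square P f = (sqnorm P f)%:E.
Proof.
by move=> [mf f2]; rewrite mean_squareE /ip fineK//; exact: integrable_fin_num.
Qed.

Lemma square_integrableP f : square_integrable P f <-> L2 P f.
Proof.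
rewrite /square_integrable mean_squareE; split => -[mf f2]; split => //.
  apply/integrableP; split; first by apply/measurable_EFinP/measurable_funX.
  rewrite (eq_integral (fun x => ((f x) ^+ 2)%:E))// => x _.
  by rewrite /= ger0_norm ?sqr_ge0.
by have /integrable_lty := f2; apply.
Qed.

Lemma lim_mean_squareP (X : nat -> T -> R) Y : (forall n, L2 P (X n)) -> L2 P Y ->
  lim_mean_square P X \oo Y <->
  (sqnorm P (fun x => X n x - Y x) @[n --> \oo] --> (0 : R)).
Proof.
move=> LX LY; rewrite /lim_mean_square.
have -> : (fun n => mean_square P (fun w => X n w - Y w)) =
    (fun n => (sqnorm P (fun x => X n x - Y x))%:E).
  by apply/funext => n; rewrite L2_mean_square//; exact: L2B.
split => [[_]|H]; first by move/fine_cvg.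
by split; [exact/square_integrableP|apply: cvg_EFin => //; exact: nearW].
Qed.

Lemma L2_dom f g h (c : R) : measurable_fun setT f -> L2 P g -> L2 P h ->
  (forall x, f x ^+ 2 <= c * (g x ^+ 2 + h x ^+ 2)) ->
  L2 P f /\ sqnorm P f <= c * (sqnorm P g + sqnorm P h).
Proof.
move=> mf Lg Lh fgh.
have i1 : P.-integrable setT (EFin \o (fun x => c * (g x * g x + h x * h x))).
  have := integrableZl measurableT c
    (integrableD measurableT (L2M_integrable Lg Lg) (L2M_integrable Lh Lh)).
  exact: eq_integrable.
have Lf : L2 P f.
  split => //; apply: le_integrable i1 => //.
    by apply/measurable_EFinP; exact: measurable_funX.
  move=> x _; rewrite /= lee_fin ger0_norm ?sqr_ge0//.
  by apply: le_trans (ler_norm _); rewrite -!expr2.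
split=> //; rewrite -RintegralD//; [|exact: L2M_integrable..].
rewrite -RintegralZl//; last first.
  have := integrableD measurableT (L2M_integrable Lg Lg) (L2M_integrable Lh Lh).
  exact: eq_integrable.
apply: le_Rintegral => //; first exact: L2M_integrable.
by move=> x _; rewrite -!expr2.
Qed.

(** Only the large indices matter: nothing is known of a partition sequence at
    index 0, where a partition has no cell. *)
Definition bounded_moments (X : nat -> T -> R) := forall n, exists C : R,
  \forall N \near \oo, L2 P (fun x => X N x ^+ n) /\
    sqnorm P (fun x => X N x ^+ n) <= C.

Lemma bounded_moments_L2 X : bounded_moments X ->
  \forall N \near \oo, L2 P (X N).
Proof.
by move=> /(_ 1%N) [C]; apply: filterS => N [+ _]; apply: L2_ext => x; rewrite expr1.
Qed.

Lemma bounded_momentsM X Y : bounded_moments X -> bounded_moments Y ->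
  bounded_moments (fun N x => X N x * Y N x).
Proof.
move=> bX bY n.
have [C1 H1] := bX (n + n)%N; have [C2 H2] := bY (n + n)%N.
exists (2^-1 * (C1 + C2)).
have mX := bounded_moments_L2 bX; have mY := bounded_moments_L2 bY.
near=> N.
have [LX CX] : L2 P (fun x => X N x ^+ (n + n)) /\ sqnorm P (fun x => X N x ^+ (n + n)) <= C1 by near: N.
have [LY CY] : L2 P (fun x => Y N x ^+ (n + n)) /\ sqnorm P (fun x => Y N x ^+ (n + n)) <= C2 by near: N.
have [m1 _] : L2 P (X N) by near: N.
have [m2 _] : L2 P (Y N) by near: N.
have [||L1 L2] := @L2_dom (fun x => (X N x * Y N x) ^+ n) _ _ 2^-1 _ LX LY.
- by apply: measurable_funX; exact: measurable_funM.
- move=> x; rewrite exprMn !exprD.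
  by have := sqr_ge0 (X N x ^+ n * X N x ^+ n - Y N x ^+ n * Y N x ^+ n); nra.
- by split => //; apply: le_trans L2 _; rewrite ler_wpM2l// lerD.
Unshelve. all: by end_near. Qed.

(** The larger of |x| and |y| alone controls the left-hand side: |x - y| is at
    most twice as large. *)
Lemma exprB_sqr_le (x y : R) n :
  ((x - y) ^+ n) ^+ 2 <= 4 ^+ n * ((x ^+ n) ^+ 2 + (y ^+ n) ^+ 2).
Proof.
rewrite -!exprM ![(n * 2)%N]mulnC !exprM.
have [xy|xy] := leP (x ^+ 2) (y ^+ 2).
- apply: (@le_trans _ _ (4 ^+ n * (y ^+ 2) ^+ n)).
    rewrite -exprMn lerXn2r ?nnegrE ?sqr_ge0 ?(mulr_ge0 _ (sqr_ge0 _))//.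
    by move: xy; have := sqr_ge0 (x + y); rewrite !expr2; nra.
  by rewrite ler_wpM2l ?exprn_ge0// lerDr exprn_ge0// sqr_ge0.
- apply: (@le_trans _ _ (4 ^+ n * (x ^+ 2) ^+ n)).
    rewrite -exprMn lerXn2r ?nnegrE ?sqr_ge0 ?(mulr_ge0 _ (sqr_ge0 _))//.
    by move: (ltW xy); have := sqr_ge0 (x + y); rewrite !expr2; nra.
  by rewrite ler_wpM2l ?exprn_ge0// lerDl exprn_ge0// sqr_ge0.
Qed.

Lemma bounded_momentsB X Y : bounded_moments X -> bounded_moments Y ->
  bounded_moments (fun N x => X N x - Y N x).
Proof.
move=> bX bY n; have [C1 H1] := bX n; have [C2 H2] := bY n.
exists (4 ^+ n * (C1 + C2)).
have mX := bounded_moments_L2 bX; have mY := bounded_moments_L2 bY.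
near=> N.
have [LX CX] : L2 P (fun x => X N x ^+ n) /\ sqnorm P (fun x => X N x ^+ n) <= C1 by near: N.
have [LY CY] : L2 P (fun x => Y N x ^+ n) /\ sqnorm P (fun x => Y N x ^+ n) <= C2 by near: N.
have [m1 _] : L2 P (X N) by near: N.
have [m2 _] : L2 P (Y N) by near: N.
have [||L1 L2] := @L2_dom (fun x => (X N x - Y N x) ^+ n) _ _ (4 ^+ n) _ LX LY.
- by apply: measurable_funX; exact: measurable_funB.
- by move=> x; exact: exprB_sqr_le.
- by split => //; apply: le_trans L2 _; rewrite ler_wpM2l ?exprn_ge0// lerD.
Unshelve. all: by end_near. Qed.

(** Mean-square convergence is not stable under products, but (X D)^2 <= (D^2
    / c + c (X^2 D)^2) / 2 trades the vanishing second moment of D against the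
    bounded one of X^2 D. *)
Lemma bounded_moments_mul_cvg0 X D : bounded_moments X -> bounded_moments D ->
  sqnorm P (D N) @[N --> \oo] --> (0 : R) ->
  sqnorm P (fun x => X N x * D N x) @[N --> \oo] --> (0 : R).
Proof.
move=> bX bD D0.
have bXXD := bounded_momentsM (bounded_momentsM bX bX) bD.
have [C HC] := bXXD 1%N.
have mX := bounded_moments_L2 bX; have mD := bounded_moments_L2 bD.
apply/cvgrPdist_le => e e0.
pose c := e / (`|C| + 1).
have C1 : 0 < `|C| + 1 by rewrite ltr_wpDl.
have c0 : 0 < c by rewrite divr_gt0.
move/cvgrPdist_le : D0 => /(_ (c * e)); rewrite mulr_gt0// => /(_ isT) D0.
near=> N.
have LD : L2 P (D N) by near: N.
have [mXN _] : L2 P (X N) by near: N.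
have [] : L2 P (fun x => (X N x * X N x * D N x) ^+ 1) /\
    sqnorm P (fun x => (X N x * X N x * D N x) ^+ 1) <= C by near: N.
rewrite (_ : (fun x => _) = (fun x => X N x * X N x * D N x)); last first.
  by apply/funext => x; rewrite expr1.
move=> LXXD CX.
have dN : sqnorm P (D N) <= c * e.
  have : `|0 - sqnorm P (D N)| <= c * e by near: N.
  by rewrite sub0r normrN ger0_norm ?ip_ge0.
rewrite sub0r normrN ger0_norm ?ip_ge0//.
have LcD : L2 P (fun x => c^-1 * D N x) by exact: L2Z.
have LcX : L2 P (fun x => c * (X N x * X N x * D N x)) by exact: L2Z.
have i1 := L2M_integrable LD LcD; have i2 := L2M_integrable LXXD LcX.
have i3 := integrableZl measurableT 2^-1 (integrableD measurableT i1 i2).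
have mXD : measurable_fun setT (fun x => X N x * D N x).
  by apply: measurable_funM => //; case: LD.
have le_x x : (X N x * D N x) * (X N x * D N x) <=
    2^-1 * (D N x * (c^-1 * D N x) +
     (X N x * X N x * D N x) * (c * (X N x * X N x * D N x))).
  rewrite -subr_ge0.
  have -> : 2^-1 * (D N x * (c^-1 * D N x) +
     (X N x * X N x * D N x) * (c * (X N x * X N x * D N x))) -
     (X N x * D N x) * (X N x * D N x) =
     (2 * c)^-1 * (D N x - c * (X N x * X N x * D N x)) ^+ 2.
    by field; rewrite gt_eqF.
  by rewrite mulr_ge0 ?sqr_ge0// invr_ge0 mulr_ge0// ltW.
have iXD : P.-integrable setT (EFin \o (fun x => (X N x * D N x) * (X N x * D N x))).
  apply: le_integrable i3 => //.
    by apply/measurable_EFinP; exact: measurable_funM.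
  move=> x _; rewrite /= -?EFinD -?EFinM /= lee_fin ger0_norm -?expr2 ?sqr_ge0//.
  by apply: le_trans (ler_norm _); rewrite expr2; exact: le_x.
apply: (@le_trans _ _ (2^-1 * (c^-1 * sqnorm P (D N) +
    c * sqnorm P (fun x => X N x * X N x * D N x)))).
  rewrite -ipZl// -ipZl// (ipC _ _ (D N)) (ipC _ (fun x => c * _)).
  rewrite -RintegralD// -RintegralZl//; last first.
    by have := integrableD measurableT i1 i2; exact: eq_integrable.
  by apply: le_Rintegral => //; move: i3; exact: eq_integrable.
have : c^-1 * sqnorm P (D N) <= e by rewrite mulrC ler_pdivrMr// mulrC.
have : c * sqnorm P (fun x => X N x * X N x * D N x) <= e.
  apply: (@le_trans _ _ (c * `|C|)).
    by rewrite ler_pM2l//; exact: le_trans (ler_norm _).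
  by rewrite /c mulrAC ler_pdivrMr// ler_pM2l// lerDl.
lra.
Unshelve. all: by end_near. Qed.

(** Replacing the factors one by one writes the difference of the products as
    a sum of terms with one vanishing factor and otherwise bounded moments. *)
Lemma prod_mean_square_cvg (I : Type) (s : seq I) (X : I -> nat -> T -> R)
    (Y : I -> T -> R) :
  (forall i, bounded_moments (X i)) -> (forall i, bounded_moments (fun=> Y i)) ->
  (forall i, sqnorm P (fun x => X i N x - Y i x)
     @[N --> \oo] --> (0 : R)) ->
  [/\ bounded_moments (fun N x => \prod_(i <- s) X i N x),
      bounded_moments (fun N x => \prod_(i <- s) Y i x) &
      sqnorm P (fun x => \prod_(i <- s) X i N x - \prod_(i <- s) Y i x)
        @[N --> \oo] --> (0 : R)].
Proof.
move=> bX bY XY; elim: s => [|i s [ihX ihY ihXY]].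
  have b1 : bounded_moments (fun=> cst 1).
    move=> n; exists 1; near=> N; rewrite (_ : (fun x => _) = cst 1); last first.
      by apply/funext => x; rewrite expr1n.
    by split; [exact: L2_cst|rewrite ip_cst mulr1].
  have E (Z : I -> T -> R) : (fun x : T => \prod_(i <- [::]) Z i x) = cst (1 : R).
    by apply/funext => x; rewrite big_nil.
  split; [by rewrite (_ : (fun N x => _) = (fun=> cst 1))//; apply/funext => N; exact: E
    |by rewrite E|].
  rewrite (_ : (fun N => _) = cst 0); first exact: cvg_cst.
  apply/funext => N; rewrite (@eq_ip _ _ _ _ _ (cst 0) _ (cst 0)) ?ip_cst ?mulr0//;
    by move=> x; rewrite !big_nil subrr.
have EX : (fun N x => \prod_(j <- i :: s) X j N x) =
    (fun N x => X i N x * \prod_(j <- s) X j N x).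
  by apply/funext => N; apply/funext => x; rewrite big_cons.
have EY : (fun x => \prod_(j <- i :: s) Y j x) =
    (fun x => Y i x * \prod_(j <- s) Y j x).
  by apply/funext => x; rewrite big_cons.
rewrite EX EY; split; [exact: bounded_momentsM|exact: bounded_momentsM|].
have bD := bounded_momentsB ihX ihY; have bDi := bounded_momentsB (bX i) (bY i).
have c1 := bounded_moments_mul_cvg0 (bX i) bD ihXY.
have c2 := bounded_moments_mul_cvg0 ihY bDi (XY i).
have b1 := bounded_moments_L2 (bounded_momentsM (bX i) bD).
have b2 := bounded_moments_L2 (bounded_momentsM ihY bDi).
apply: (cvg0_le (b := fun N => 2 * (_ N + _ N))) (cvg0_2D c1 c2).
near=> N; rewrite ip_ge0 /=.
have L1 : L2 P (fun x => X i N x * (\prod_(j <- s) X j N x - \prod_(j <- s) Y j x)).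
  by near: N.
have L2' : L2 P (fun x => \prod_(j <- s) Y j x * (X i N x - Y i x)) by near: N.
apply: le_trans (ipD_le L1 L2').
apply: le_of_eq; apply: eq_ip => x;
  by rewrite !big_cons; ring.
Unshelve. all: by end_near. Qed.

End mean_square_convergence.

(** * The cosine transform and the moments of the normal density *)

Section density.
Context d (T : measurableType d) (R : realType).
Variables (mu : {sigma_finite_measure set T -> \bar R})
  (nu : {finite_measure set T -> \bar R}) (rho : T -> R).
Hypothesis mrho : measurable_fun setT rho.
Hypothesis rho0 : forall x, 0 <= rho x.
Hypothesis nuE : forall A, measurable A -> nu A = (\int[mu]_(x in A) (rho x)%:E)%E.

(** The function rho is almost everywhere the Radon-Nikodym derivative of nu
    with respect to mu. *)
Lemma ge0_integral_density (f : T -> \bar R) :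
  measurable_fun setT f -> (forall x, 0 <= f x)%E ->
  (\int[nu]_x f x = \int[mu]_x (f x * (rho x)%:E))%E.
Proof.
move=> mf f0; have mErho : measurable_fun setT (EFin \o rho) by exact/measurable_EFinP.
have numu : nu `<< mu.
  apply/null_content_dominatesP => A mA A0; rewrite nuE//.
  by apply: null_set_integral => //; exact: measurable_funTS.
have irho : mu.-integrable setT (EFin \o rho).
  apply/integrableP; split => //; under eq_integral do rewrite gee0_abs ?lee_fin//.
  by rewrite -nuE// fin_num_fun_lty//; exact: fin_num_measure.
rewrite -(Radon_Nikodym_SigmaFinite.change_of_variables numu f0 measurableT mf).
have iRN := Radon_Nikodym_SigmaFinite.f_integrable numu.
have mRN := measurable_int _ iRN.
apply: ae_eq_integral => //; [exact: emeasurable_funM|exact: emeasurable_funM|].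
have : ae_eq mu setT (Radon_Nikodym_SigmaFinite.f nu mu) (EFin \o rho).
  apply: integral_ae_eq => // A _ mA.
  by rewrite -Radon_Nikodym_SigmaFinite.f_integral// -nuE.
by apply: filterS => x + Dx => ->.
Qed.

Lemma integrable_density (f : T -> R) : measurable_fun setT f ->
  mu.-integrable setT (EFin \o (fun x => f x * rho x)) ->
  nu.-integrable setT (EFin \o f) /\ \int[nu]_x f x = \int[mu]_x (f x * rho x).
Proof.
move=> mf if_.
have H (g : T -> R) : measurable_fun setT g -> (forall x, 0 <= g x) ->
    (\int[nu]_x (g x)%:E = \int[mu]_x (g x * rho x)%:E)%E.
  move=> mg g0; rewrite ge0_integral_density//.
  exact/measurable_EFinP.
split.
  apply/integrableP; split; first exact/measurable_EFinP.
  rewrite (H (fun x => `|f x|))//; last exact: measurableT_comp.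
  move/integrableP : if_ => [_]; apply: le_lt_trans.
  by apply: le_of_eq; apply: eq_integral => x _;
    rewrite /= normrM (ger0_norm (rho0 x)).
congr fine; rewrite integralE [RHS]integralE.
have Hp : (EFin \o f)^\+%E = (fun x => (Num.max (f x) 0)%:E).
  by apply/funext => x; rewrite funeposE/= EFin_max.
have Hn : (EFin \o f)^\-%E = (fun x => (Num.max (- f x) 0)%:E).
  by apply/funext => x; rewrite funenegE/= EFin_max.
rewrite Hp Hn !H//.
- congr (_ - _)%E; apply: eq_integral => x _.
  + by rewrite funeposE /= -EFin_max maxr_pMl// mul0r.
  + by rewrite funenegE /= -EFin_max maxr_pMl// mul0r mulNr.
- by apply: measurable_maxr => //; exact: measurable_funN.
- by move=> x; rewrite le_max lexx orbT.
- by apply: measurable_maxr.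
- by move=> x; rewrite le_max lexx orbT.
Qed.

End density.

Section line.
Context (R : realType).
Notation mu := (@lebesgue_measure R).

(** The fundamental theorem of calculus on the whole line, for a primitive
    that vanishes at both ends. It performs all integrations by parts against
    the normal density. *)
Lemma integral_derivative0 (F f : R -> R) :
  (forall x : R, is_derive x (1 : R) F (f x)) -> continuous f ->
  mu.-integrable setT (EFin \o f) ->
  F n%:R @[n --> \oo] --> (0 : R) -> F (- n%:R) @[n --> \oo] --> (0 : R) ->
  \int[mu]_x f x = 0.
Proof.
move=> dF cf if_ Fp Fn.
pose g n : R -> R := f \_ `[- n%:R, n%:R].
have mf : measurable_fun setT f by exact: continuous_measurable_fun.
have cF : continuous F.
  by move=> x; apply: differentiable_continuous; apply/derivable1_diffP;
    exact: (@ex_derive _ _ _ _ _ _ _ (dF x)).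
have E n : (0 < n)%N -> (\int[mu]_x (g n x)%:E = (F n%:R - F (- n%:R))%:E)%E.
  move=> n0; transitivity (\int[mu]_(x in `[(- n%:R)%R, n%:R]) (f x)%:E)%E.
    rewrite [RHS]integral_mkcond; apply: eq_integral => x _.
    by rewrite /g !patchE; case: ifP.
  rewrite (@continuous_FTC2 _ f F) ?EFinB//.
  - by rewrite -subr_gt0 opprK addr_gt0// ltr0n.
  - exact: continuous_subspaceT.
  - split; [by move=> x _; exact: (@ex_derive _ _ _ _ _ _ _ (dF x))|
      by apply: cvg_at_right_filter; exact: cF|
      by apply: cvg_at_left_filter; exact: cF].
  - by move=> x _; rewrite derive1E; exact: (@derive_val _ _ _ _ _ _ _ (dF x)).
have mg n : measurable_fun setT (fun x => (g n x)%:E).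
  apply/measurable_EFinP; rewrite /g; apply/(measurable_restrictT f) => //.
  exact: measurable_funTS.
have mEf : measurable_fun setT (EFin \o f) by exact/measurable_EFinP.
have gf : {ae mu, forall x, setT x -> (g n x)%:E @[n --> \oo] --> (EFin \o f) x}.
  apply: aeW => x _; apply: cvg_near_cst.
  near=> n; congr EFin; rewrite /g patchE mem_set//= in_itv/= -ler_norml.
  by near: n; exact: nbhs_infty_ger.
have gle : {ae mu, forall x n, setT x -> (`|(g n x)%:E| <= (`|f x|)%:E)%E}.
  apply: aeW => x n _; rewrite lee_fin /g patchE; case: ifPn => //.
  by rewrite normr0.
have H := @dominated_convergence _ _ _ mu setT measurableT
  (fun n x => (g n x)%:E) (EFin \o f) (fun x => (`|f x|)%:E) mg mEf.
have [_ _] := H gf (integrable_norm if_) gle.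
rewrite -[X in _ --> X]fineK; last exact: integrable_fin_num.
move=> /fine_cvg H1.
apply/esym; apply: (cvg_unique _ _ H1) => //.
have H2 : F n%:R - F (- n%:R) @[n --> \oo] --> (0 : R).
  by have := cvgB Fp Fn; rewrite subrr; apply.
apply: cvg_trans H2; apply: near_eq_cvg; near=> n.
by rewrite /= E//; near: n; exact: nbhs_infty_gt.
Unshelve. all: by end_near. Qed.

End line.

Section affine.
Context (R : realType) (l th : R).

Lemma continuous_affine : continuous (fun x : R => l * x + th).
Proof.
by move=> x; apply: cvgD; [apply: cvgM; [exact: cvg_cst|exact: cvg_id]|exact: cvg_cst].
Qed.

Lemma measurable_cos_affine : measurable_fun setT (fun x : R => cos (l * x + th)).
Proof.
apply: continuous_measurable_fun => x.
by apply: continuous_comp; [exact: continuous_affine|exact: continuous_cos].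
Qed.

Lemma measurable_sin_affine : measurable_fun setT (fun x : R => sin (l * x + th)).
Proof.
apply: continuous_measurable_fun => x.
by apply: continuous_comp; [exact: continuous_affine|exact: continuous_sin].
Qed.

End affine.

Section normal.
Context (R : realType) (s : R).
Hypothesis s0 : 0 < s.
Notation mu := (@lebesgue_measure R).
Notation phi := (normal_pdf 0 s).

Lemma normal_pdf0E x : phi x = normal_peak s * expR (- (x ^+ 2) / (2 * s ^+ 2)).
Proof.
by rewrite normal_pdfE ?gt_eqF// /normal_fun subr0 mulr_natl.
Qed.

Lemma is_derive_normal_pdf (x : R) : is_derive x (1 : R) phi (- x / s ^+ 2 * phi x).
Proof.
have -> : (phi : R -> R) = (fun x => normal_peak s * (expR \o (fun x => (- (2 * s ^+ 2)^-1) * x ^+ 2)) x).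
  by apply/funext => y /=; rewrite normal_pdf0E; congr (_ * expR _); rewrite mulNr mulrC mulNr.
apply: is_derive_eq; rewrite /= /GRing.scale /=.
by field; rewrite gt_eqF.
Qed.

Lemma measurable_phi : measurable_fun setT phi.
Proof. exact: measurable_normal_pdf. Qed.

Lemma phi_ge0 x : 0 <= phi x. Proof. exact: normal_pdf_ge0. Qed.

(** From y^n <= n! e^y at y = x^2 / (4 s^2): half of the Gaussian exponent
    pays for the power, and the other half is that of variance 2 s^2. *)
Lemma pow_normal_pdf_le n x : (x ^+ n) ^+ 2 * phi x <=
  (4 * s ^+ 2) ^+ n * n`!%:R * Num.sqrt 2 * normal_pdf 0 (s * Num.sqrt 2) x.
Proof.
have r2 : 0 < Num.sqrt 2 :> R by rewrite sqrtr_gt0.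
have s2 : s * Num.sqrt 2 != 0 by rewrite gt_eqF// mulr_gt0.
have s4 : 0 < 4 * s ^+ 2 by rewrite mulr_gt0// exprn_gt0.
rewrite normal_pdf0E normal_pdfE// /normal_fun subr0.
have -> : normal_peak s = Num.sqrt 2 * normal_peak (s * Num.sqrt 2).
  rewrite /normal_peak.
  have -> : (s * Num.sqrt 2) ^+ 2 * pi *+ 2 = 2 * (s ^+ 2 * pi *+ 2).
    by rewrite exprMn sqr_sqrtr// mulrnAr mulrCA mulrA.
  rewrite (sqrtrM (s ^+ 2 * pi *+ 2))//.
  by rewrite invfM mulrA divff ?mul1r// gt_eqF.
have H : (x ^+ n) ^+ 2 * expR (- x ^+ 2 / (2 * s ^+ 2)) <=
    (4 * s ^+ 2) ^+ n * n`!%:R * expR (- x ^+ 2 / ((s * Num.sqrt 2) ^+ 2 *+ 2)).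
  pose y := x ^+ 2 / (4 * s ^+ 2).
  have y0 : 0 <= y by rewrite divr_ge0 ?sqr_ge0// ltW.
  have -> : (x ^+ n) ^+ 2 = (4 * s ^+ 2) ^+ n * y ^+ n.
    by rewrite -exprMn /y mulrC divfK ?gt_eqF// -!exprM mulnC.
  have yn : y ^+ n <= n`!%:R * expR y.
    case: n => [|n]; first by rewrite expr0 fact0 mul1r -expR0 ler_expR.
    have H := expR_ge1Dxn n y0.
    rewrite mulrC -ler_pdivrMr ?ltr0n ?fact_gt0//; apply: le_trans H.
    by rewrite lerDr.
  have -> : - x ^+ 2 / ((s * Num.sqrt 2) ^+ 2 *+ 2) = y + - x ^+ 2 / (2 * s ^+ 2).
    by rewrite exprMn sqr_sqrtr// -mulr_natr /y; field; rewrite gt_eqF.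
  rewrite expRD mulrA ler_wpM2r ?expR_ge0// -!mulrA ler_wpM2l//.
  by rewrite exprn_ge0// ltW.
rewrite mulrCA [leRHS](_ : _ = Num.sqrt 2 * normal_peak (s * Num.sqrt 2) *
   ((4 * s ^+ 2) ^+ n * n`!%:R * expR (- x ^+ 2 / ((s * Num.sqrt 2) ^+ 2 *+ 2))));
  last by ring.
by rewrite ler_wpM2l// mulr_ge0 ?normal_peak_ge0// ltW.
Qed.

Lemma integrable_pow_phi n :
  mu.-integrable setT (EFin \o (fun x => (x ^+ n) ^+ 2 * phi x)).
Proof.
have := integrableZl measurableT ((4 * s ^+ 2) ^+ n * n`!%:R * Num.sqrt 2)
  (integrable_normal_pdf 0 (s * Num.sqrt 2)).
apply: le_integrable => //.
  apply/measurable_EFinP; apply: measurable_funM; last exact: measurable_phi.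
  by apply: measurable_funX; exact: exprn_measurable.
move=> x _; rewrite /= lee_fin ger0_norm; last first.
  by rewrite mulr_ge0 ?sqr_ge0 ?phi_ge0.
by apply: le_trans (ler_norm _); exact: pow_normal_pdf_le.
Qed.

Lemma integrable_bounded_phi (h : R -> R) (C D : R) : measurable_fun setT h ->
  (forall x, `|h x| <= C + D * x ^+ 2) ->
  mu.-integrable setT (EFin \o (fun x => h x * phi x)).
Proof.
move=> mh hC.
have i0 := integrableZl measurableT C (integrable_pow_phi 0).
have i1 := integrableZl measurableT D (integrable_pow_phi 1).
have := integrableD measurableT i0 i1; apply: le_integrable => //.
  by apply/measurable_EFinP; apply: measurable_funM => //; exact: measurable_phi.
move=> x _; rewrite /= lee_fin; apply: le_trans (ler_norm _).
rewrite expr0 expr1n mul1r mulrA -mulrDl expr1 normrM (ger0_norm (phi_ge0 x)).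
by rewrite ler_wpM2r ?phi_ge0.
Qed.

Lemma phi_decay (x : R) : phi x * x ^+ 2 <= 2 * s ^+ 2 * normal_peak s.
Proof.
have s2 : 0 < 2 * s ^+ 2 by rewrite mulr_gt0// exprn_gt0.
rewrite normal_pdf0E.
have := expR_ge1Dx (x ^+ 2 / (2 * s ^+ 2)); rewrite mulNr expRN => H.
have e0 := expR_gt0 (x ^+ 2 / (2 * s ^+ 2)).
rewrite -[leLHS]mulrA [leRHS]mulrC; apply: ler_wpM2l.
  exact: normal_peak_ge0.
rewrite mulrC ler_pdivrMr// mulrC -ler_pdivrMr//.
by apply: le_trans H; rewrite lerDr.
Qed.

(** Since x^2 phi(x) is bounded, (1 + |x|) phi(x) is of order 1 / |x|. *)
Lemma cvg0_phi (F : R -> R) (C : R) : 0 <= C ->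
  (forall x, `|F x| <= C * (1 + `|x|) * phi x) ->
  F n%:R @[n --> \oo] --> (0 : R) /\ F (- n%:R) @[n --> \oo] --> (0 : R).
Proof.
move=> C0 FC; pose K := 4 * C * (2 * s ^+ 2 * normal_peak s).
have bnd x : 1 <= `|x| -> `|F x| <= K / (1 + `|x|).
  move=> x1; rewrite ler_pdivlMr; last by rewrite ltr_pwDl.
  apply: (@le_trans _ _ (4 * C * (phi x * x ^+ 2))); last first.
    by rewrite ler_wpM2l ?mulr_ge0//; exact: phi_decay.
  apply: (@le_trans _ _ (C * (1 + `|x|) * phi x * (1 + `|x|))).
    by rewrite ler_wpM2r// addr_ge0.
  rewrite (_ : _ * _ = C * phi x * (1 + `|x|) ^+ 2); last by ring.
  rewrite (_ : 4 * C * _ = C * phi x * (4 * `|x| ^+ 2)).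
    by rewrite ler_wpM2l ?mulr_ge0 ?phi_ge0//; nra.
  by rewrite real_normK ?num_real//; ring.
have h0 : K * harmonic n @[n --> \oo] --> (0 : R).
  by rewrite -[X in _ --> X](mulr0 K); apply: cvgM; [exact: cvg_cst|exact: cvg_harmonic].
have H (G : nat -> R) : (forall n, (0 < n)%N -> `|G n| <= K * harmonic n) ->
    G n @[n --> \oo] --> (0 : R).
  move=> GK; apply: norm_cvg0; apply: cvg0_le h0.
  near=> n; rewrite normr_ge0 GK//; near: n; exact: nbhs_infty_gt.
split; apply: H => n n0.
- by have := @bnd n%:R; rewrite ger0_norm// nat1r ler1n; apply.
- by have := @bnd (- n%:R); rewrite normrN ger0_norm// nat1r ler1n; apply.
Unshelve. all: by end_near. Qed.

Lemma continuous_phi : continuous phi.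
Proof. by apply: continuous_normal_pdf; rewrite gt_eqF. Qed.

Lemma normr_le_sqr (x : R) : `|x| <= 1 + x ^+ 2.
Proof.
rewrite -(real_normK (num_real x)); have := sqr_ge0 (`|x| - 1); nra.
Qed.

Lemma moment1_phi : \int[mu]_x (x * phi x) = 0.
Proof.
have i1 : mu.-integrable setT (EFin \o (fun x => (- x / s ^+ 2) * phi x)).
  apply: (@integrable_bounded_phi _ (s ^- 2) (s ^- 2)).
    by apply: measurable_funM => //; exact: measurable_funN.
  move=> x; rewrite normrM normrN (@ger0_norm _ (s ^- 2)) ?invr_ge0 ?sqr_ge0//.
  rewrite -[X in X + _]mulr1 -mulrDr mulrC ler_wpM2l ?invr_ge0 ?sqr_ge0//.
  exact: normr_le_sqr.
have := @integral_derivative0 R phi _ is_derive_normal_pdf _ i1 _ _.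
have [] := @cvg0_phi phi 1 ler01.
  move=> x; rewrite ger0_norm ?phi_ge0// mul1r ler_peMl ?phi_ge0//.
  by rewrite lerDl.
move=> c1 c2 /(_ _ c1 c2) H.
have /H : continuous (fun x : R => - x / s ^+ 2 * phi x).
  move=> x; apply: cvgM; last exact: continuous_phi.
  by apply: cvgM; [apply: cvgN; exact: cvg_id|exact: cvg_cst].
move=> {}H; transitivity (- s ^+ 2 * \int[mu]_x ((- x / s ^+ 2) * phi x)).
  rewrite -RintegralZl//; apply: eq_Rintegral => x _.
  by field; rewrite gt_eqF.
by rewrite H mulr0.
Qed.

Lemma moment2_phi : \int[mu]_x (x ^+ 2 * phi x) = s ^+ 2.
Proof.
have i0 : mu.-integrable setT (EFin \o (fun x => 1 * phi x)).
  by have := integrable_pow_phi 0; apply: eq_integrable => // x _ /=; rewrite expr1n.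
have i2 : mu.-integrable setT (EFin \o (fun x => x ^+ 2 * phi x)).
  by have := integrable_pow_phi 1; apply: eq_integrable => // x _ /=; rewrite expr1.
have i2' : mu.-integrable setT (EFin \o (fun x => s ^- 2 * (x ^+ 2 * phi x))).
  by have := integrableZl measurableT (s ^- 2) i2; exact: eq_integrable.
have iB : mu.-integrable setT (EFin \o (fun x => 1 * phi x - s ^- 2 * (x ^+ 2 * phi x))).
  by have := integrableB measurableT i0 i2'; exact: eq_integrable.
have dF (x : R) : is_derive x (1 : R) (fun x => x * phi x)
    (1 * phi x - s ^- 2 * (x ^+ 2 * phi x)).
  have dphi := is_derive_normal_pdf x.
  apply: is_derive_eq; rewrite /GRing.scale /=.
  by field; rewrite gt_eqF.
have [] := @cvg0_phi (fun x => x * phi x) 1 ler01.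
  move=> x; rewrite normrM (ger0_norm (phi_ge0 x)) mul1r ler_wpM2r ?phi_ge0//.
  by rewrite lerDr.
move=> c1 c2; have := @integral_derivative0 R _ _ dF _ iB c1 c2.
have /[swap]/[apply] : continuous (fun x => 1 * phi x - s ^- 2 * (x ^+ 2 * phi x)).
  move=> x; apply: cvgB; first by apply: cvgM; [exact: cvg_cst|exact: continuous_phi].
  apply: cvgM; first exact: cvg_cst.
  by apply: cvgM; [exact: exprn_continuous|exact: continuous_phi].
rewrite RintegralB// [X in _ - X]RintegralZl// => /eqP; rewrite subr_eq0 => /eqP H.
rewrite -[LHS](mulVKf (_ : s ^+ 2 != 0)) ?expf_neq0 ?gt_eqF// -H.
under eq_Rintegral do rewrite mul1r.
by rewrite /Rintegral integral_normal_pdf /= mulr1.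
Qed.

Let C (th l : R) := \int[mu]_x (cos (l * x + th) * phi x).

Lemma integrable_cos_phi l th :
  mu.-integrable setT (EFin \o (fun x => cos (l * x + th) * phi x)).
Proof.
apply: (@integrable_bounded_phi _ 1 0) => [|x]; first exact: measurable_cos_affine.
by rewrite mul0r addr0 ler_norml cos_geN1 cos_le1.
Qed.

Lemma integrable_xsin_phi l th :
  mu.-integrable setT (EFin \o (fun x => x * sin (l * x + th) * phi x)).
Proof.
apply: (@integrable_bounded_phi _ 1 1) => [|x].
  by apply: measurable_funM => //; exact: measurable_sin_affine.
rewrite mul1r normrM; apply: le_trans (normr_le_sqr x).
by rewrite ler_piMr// ler_norml sin_geN1 sin_le1.
Qed.

(** Integration by parts: the logarithmic derivative of the density at x is -
    x / s^2. *)
Lemma integral_xsin_phi l th :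
  \int[mu]_x (x * sin (l * x + th) * phi x) = s ^+ 2 * l * C th l.
Proof.
have i1' : mu.-integrable setT (EFin \o (fun x => l * (cos (l * x + th) * phi x))).
  by have := integrableZl measurableT l (integrable_cos_phi l th); exact: eq_integrable.
have i2' : mu.-integrable setT
    (EFin \o (fun x => s ^- 2 * (x * sin (l * x + th) * phi x))).
  by have := integrableZl measurableT (s ^- 2) (integrable_xsin_phi l th);
    exact: eq_integrable.
have iB : mu.-integrable setT (EFin \o (fun x => l * (cos (l * x + th) * phi x) -
    s ^- 2 * (x * sin (l * x + th) * phi x))).
  by have := integrableB measurableT i1' i2'; exact: eq_integrable.
have dF (x : R) : is_derive x (1 : R) (fun x => sin (l * x + th) * phi x)
    (l * (cos (l * x + th) * phi x) - s ^- 2 * (x * sin (l * x + th) * phi x)).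
  have dphi := is_derive_normal_pdf x.
  have dsin : is_derive x (1 : R) (fun x => sin (l * x + th)) (l * cos (l * x + th)).
    rewrite (_ : (fun x => _) = sin \o (fun x => l * x + th))//.
    by apply: is_derive_eq; rewrite /GRing.scale /= ; ring.
  apply: is_derive_eq; rewrite /GRing.scale /=.
  by field; rewrite gt_eqF.
have [] := @cvg0_phi (fun x => sin (l * x + th) * phi x) 1 ler01.
  move=> x; rewrite normrM (ger0_norm (phi_ge0 x)) mul1r ler_wpM2r ?phi_ge0//.
  by rewrite (@le_trans _ _ 1) ?lerDl// ler_norml sin_geN1 sin_le1.
move=> c1 c2; have := @integral_derivative0 R _ _ dF _ iB c1 c2.
have /[swap]/[apply] : continuous (fun x => l * (cos (l * x + th) * phi x) -
    s ^- 2 * (x * sin (l * x + th) * phi x)).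
  move=> x; apply: cvgB.
    apply: cvgM; first exact: cvg_cst.
    apply: cvgM; last exact: continuous_phi.
    by apply: continuous_comp; [exact: continuous_affine|exact: continuous_cos].
  apply: cvgM; first exact: cvg_cst.
  apply: cvgM; last exact: continuous_phi.
  apply: cvgM; first exact: cvg_id.
  by apply: continuous_comp; [exact: continuous_affine|exact: continuous_sin].
rewrite RintegralB// RintegralZl; [|by []|exact: integrable_cos_phi].
rewrite RintegralZl; [|by []|exact: integrable_xsin_phi].
move=> /eqP; rewrite subr_eq0 => /eqP H.
rewrite -mulrA /C H mulrA divff ?mul1r// expf_neq0// gt_eqF//.
Qed.

(** Differentiation under the integral sign, with (1 + x^2) phi(x) as
    dominating function. *)
Lemma is_derive_charfun (th l : R) : is_derive l (1 : R) (C th) (- s ^+ 2 * l * C th l).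
Proof.
pose f l x := cos (l * x + th) * phi x.
have df l' x : is_derive l' (1 : R) (f ^~ x) (- (x * sin (l' * x + th) * phi x)).
  have dcos : is_derive l' (1 : R) (fun l => cos (l * x + th)) (- (x * sin (l' * x + th))).
    rewrite (_ : (fun l => _) = cos \o (fun l => l * x + th))//.
    by apply: is_derive_eq; rewrite /GRing.scale /= ; ring.
  by apply: is_derive_eq; rewrite /GRing.scale /=; ring.
have d1f l' x : partial1of2 f l' x = - (x * sin (l' * x + th) * phi x).
  by rewrite partial1of2E; exact: (@derive_val _ _ _ _ _ _ _ (df l' x)).
have lI : `]l - 1, l + 1[%classic l by rewrite /= in_itv/= ltrBlDr ltrDl ltr01.
pose G x := (1 + x ^+ 2) * phi x.
have iG : mu.-integrable setT (EFin \o G).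
  apply: (@integrable_bounded_phi _ 1 1) => [|x].
    by apply: measurable_funD => //; exact: exprn_measurable.
  by rewrite mul1r ger0_norm// addr_ge0// sqr_ge0.
have G0 x : 0 <= G x by rewrite mulr_ge0 ?phi_ge0// addr_ge0// sqr_ge0.
have H1 (x : R) : `]l - 1, l + 1[%classic x -> mu.-integrable setT (EFin \o f x).
  by move=> _; exact: integrable_cos_phi.
have H2 (x y : R) : `]l - 1, l + 1[%classic x -> [set: R] y -> derivable (f ^~ y) x 1.
  by move=> _ _; exact: (@ex_derive _ _ _ _ _ _ _ (df x y)).
have H3 (x y : R) : `]l - 1, l + 1[%classic x -> [set: R] y ->
    `|partial1of2 f x y| <= G y.
  move=> _ _; rewrite d1f normrN !normrM (ger0_norm (phi_ge0 y)).
  rewrite ler_wpM2r ?phi_ge0//; apply: le_trans (normr_le_sqr y).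
  by rewrite ler_piMr// ler_norml sin_geN1 sin_le1.
apply: DeriveDef.
  exact: (derivable_under_integral measurableT lI H1 H2 G0 iG H3).
rewrite -derive1E (differentiation_under_integral measurableT lI H1 H2 G0 iG H3).
under eq_Rintegral do rewrite d1f -mulN1r.
rewrite RintegralZl//; last exact: integrable_xsin_phi.
by rewrite integral_xsin_phi mulN1r !mulNr.
Qed.

(** The transform C solves the differential equation C' = - s^2 l C, so its
    product with exp(s^2 l^2 / 2) is constant. *)
Lemma charfun_normal (th l : R) :
  \int[mu]_x (cos (l * x + th) * phi x) = cos th * expR (- (l ^+ 2 * s ^+ 2) / 2).
Proof.
pose g (l : R) : R := expR (l ^+ 2 * (s ^+ 2 / 2)) * C th l.
have dg (x : R) : is_derive x (1 : R) g 0.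
  have dC := is_derive_charfun th x.
  have de : is_derive x (1 : R) (fun l : R => expR (l ^+ 2 * (s ^+ 2 / 2)))
      (s ^+ 2 * x * expR (x ^+ 2 * (s ^+ 2 / 2))).
    rewrite (_ : (fun l => _) = expR \o (fun l : R => l ^+ 2 * (s ^+ 2 / 2)))//.
    by apply: is_derive_eq; rewrite /GRing.scale /=; field.
  by apply: is_derive_eq; rewrite /GRing.scale /=; ring.
have gl : g l = cos th.
  rewrite (@is_derive_0_is_cst _ g l 0 dg) /g expr0n mul0r expR0 mul1r /C.
  under eq_Rintegral do rewrite mul0r add0r.
  rewrite RintegralZl//; last exact: integrable_normal_pdf.
  by rewrite /Rintegral integral_normal_pdf /= mulr1.
rewrite -gl /g mulrAC -expRD (_ : _ + _ = 0) ?expR0 ?mul1r//; by field.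
Qed.

End normal.

(** * Change of variables and Fubini on a probability space *)

Section fubini_bounded.
Context d (T : measurableType d) (R : realType) (P : probability T R).
Notation mu := (@lebesgue_measure R).

Lemma integrable_bounded (f : T -> R) (M : R) : measurable_fun setT f ->
  (forall x, `|f x| <= M) -> P.-integrable setT (EFin \o f).
Proof. by move=> mf fM; apply: L2_integrable; exact: L2_bounded mf fM. Qed.

Lemma Fubini_bounded (k : T * R -> R) (rho : R -> R) (M : R) :
  measurable_fun setT k -> (forall z, `|k z| <= M) ->
  mu.-integrable setT (EFin \o rho) ->
  \int[P]_w (\int[mu]_y (k (w, y) * rho y)) =
  \int[mu]_y ((\int[P]_w k (w, y)) * rho y).
Proof.
move=> mk kM irho.
have mrho : measurable_fun setT rho.
  by apply/measurable_EFinP; exact: (measurable_int mu).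
have mkrho : measurable_fun setT (fun z : T * R => k z * rho z.2).
  by apply: measurable_funM => //; exact: measurableT_comp.
have mky w : measurable_fun setT (fun y => k (w, y)).
  by apply: measurableT_comp mk _; exact: measurable_pair1.
have mkw y : measurable_fun setT (fun w => k (w, y)).
  by apply: measurableT_comp mk _; exact: measurable_pair2.
have i2 w : mu.-integrable setT (EFin \o (fun y => k (w, y) * rho y)).
  have := integrableZl measurableT M (integrable_norm irho).
  apply: le_integrable => //.
    by apply/measurable_EFinP; apply: measurable_funM; [exact: mky|exact: mrho].
  move=> y _; rewrite /= lee_fin normrM; apply: le_trans (ler_norm _).
  by rewrite ler_wpM2r.
have i1 y : P.-integrable setT (EFin \o (fun w => k (w, y) * rho y)).
  apply: (@integrable_bounded _ (M * `|rho y|)).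
    by apply: measurable_funM.
  by move=> w; rewrite normrM ler_wpM2r.
have i12 : (P \x mu)%E.-integrable setT (EFin \o (fun z => k z * rho z.2)).
  apply/integrable12ltyP; first exact/measurable_EFinP.
  apply: (@le_lt_trans _ _ (\int[P]_w (\int[mu]_y (M * `|rho y|)%:E))%E).
    apply: ge0_le_integral => //.
    - by move=> w _; apply: integral_ge0.
    - have mabs : measurable_fun setT (fun z : T * R => `|(k z * rho z.2)%:E|%E).
        by apply: measurableT_comp => //; exact/measurable_EFinP.
      exact: (@measurable_fun_fubini_tonelli_F _ _ _ _ _ mu _ mabs (fun=> abse_ge0 _)).
    - move=> w _; apply: ge0_le_integral => //.
      + by apply: measurableT_comp => //; have /integrableP[] := i2 w.
      + apply/measurable_EFinP; apply: measurable_funM => //.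
        exact: measurableT_comp.
      + by move=> y _; rewrite lee_fin normrM ler_wpM2r.
  rewrite integral_cst//= probability_setT mule1.
  have := integrableZl measurableT M (integrable_norm irho).
  by move=> /integrable_lty; apply.
rewrite /Rintegral.
transitivity (fine (\int[P]_w \int[mu]_y (k (w, y) * rho y)%:E)%E).
  by congr fine; apply: eq_integral => w _; rewrite fineK//; exact: integrable_fin_num (i2 w).
rewrite (Fubini i12); congr fine; apply: eq_integral => y _ /=.
rewrite -[LHS]fineK; last exact: integrable_fin_num (i1 y).
by rewrite -/(Rintegral P setT _) RintegralZr//; exact: integrable_bounded (mkw y) _.
Qed.
End fubini_bounded.

Section law.
Context d (T : measurableType d) (R : realType) (P : probability T R).

Lemma integral_law (X : T -> R) (rho : R -> R) (h : R -> R) :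
  measurable_fun setT X -> measurable_fun setT rho -> (forall x, 0 <= rho x) ->
  (forall B, measurable B ->
    P (X @^-1` B) = (\int[@lebesgue_measure R]_(x in B) (rho x)%:E)%E) ->
  measurable_fun setT h ->
  (@lebesgue_measure R).-integrable setT (EFin \o (fun x => h x * rho x)) ->
  P.-integrable setT (EFin \o (fun w => h (X w))) /\
  \int[P]_w h (X w) = \int[@lebesgue_measure R]_x (h x * rho x).
Proof.
move=> mX mrho rho0 XB mh ih.
pose X' : {mfun T >-> measurableTypeR R} := HB.pack (X : T -> measurableTypeR R)
  (isMeasurableFun.Build _ _ T (measurableTypeR R) (X : T -> measurableTypeR R) mX).
pose nu := distribution P X'.
have [inu E] := @integrable_density _ (measurableTypeR R) R (@lebesgue_measure R) nu rho mrho rho0 XB h mh ih.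
have ih' : P.-integrable setT (EFin \o (fun w => h (X w))).
  apply/integrableP; split; first by apply/measurable_EFinP; exact: measurableT_comp.
  move/integrableP : inu => [_]; rewrite ge0_integral_pushforward//.
  by apply: measurableT_comp => //; exact/measurable_EFinP.
split=> //; rewrite -E /Rintegral integral_pushforward//.
exact/measurable_EFinP.
Qed.
End law.

(** * Uniqueness of the cosine transform *)

Section gaussian_window.
Context (R : realType).
Notation mu := (@lebesgue_measure R).

Lemma integral_translation (g : R -> R) (x : R) : continuous g ->
  (forall y, 0 <= g y) ->
  (\int[mu]_y (g (y - x))%:E = \int[mu]_y (g y)%:E)%E.
Proof.
move=> cg g0; pose F (y : R) : R := y - x.
have dF (y : R) : is_derive y (1 : R) F 1.
  by rewrite /F; apply: is_derive_eq; rewrite ?oppr0 ?subr0 ?addr0.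
have F'E : F^`()%classic = cst 1.
  by apply/funext => y; rewrite derive1E; exact: (@derive_val _ _ _ _ _ _ _ (dF y)).
rewrite [RHS](@increasing_ge0_integration_by_substitutionT _ F g)//.
- by apply: eq_integral => y _; rewrite F'E /= mulr1.
- by move=> y z yz; rewrite ltrD2r.
- by rewrite F'E => y; exact: cvg_cst.
- by rewrite F'E; exact: is_cvg_cst.
- by rewrite F'E; exact: is_cvg_cst.
- exact: cvg_addrr_Ny.
- exact: cvg_addrr.
Qed.

Variables (s : R) (s0 : 0 < s).
Notation phi := (normal_pdf 0 s).

(** The mass that a Gaussian of standard deviation s centred at x puts on A. *)
Definition window (A : set R) (x : R) : R := \int[mu]_y (\1_A y * phi (y - x)).

Let mphix x : measurable_fun setT (fun y : R => phi (y - x)).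
Proof.
apply: (measurableT_comp (measurable_phi s)) => //.
exact: measurable_funB.
Qed.

Let ge0_total x : (\int[mu]_y (phi (y - x))%:E = 1)%E.
Proof.
rewrite integral_translation; last by move=> y; exact: phi_ge0.
  exact: integral_normal_pdf.
exact: continuous_phi.
Qed.

Lemma integrable_window (A : set R) x : measurable A ->
  mu.-integrable setT (EFin \o (fun y => \1_A y * phi (y - x))).
Proof.
move=> mA; apply/integrableP; split.
  apply/measurable_EFinP; apply: measurable_funM; last exact: mphix.
  exact: measurable_indic.
apply: (@le_lt_trans _ _ (\int[mu]_y (phi (y - x))%:E)%E); last first.
  by rewrite ge0_total ltry.
apply: ge0_le_integral => //.
- apply: measurableT_comp => //; apply/measurable_EFinP.
  by apply: measurable_funM; [exact: measurable_indic|exact: mphix].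
- by apply/measurable_EFinP; exact: mphix.
- move=> y _; rewrite /= lee_fin normrM (ger0_norm (phi_ge0 s _)).
  by rewrite ler_piMl ?phi_ge0// indic_norm_le1.
Qed.

Lemma window_ge0 A x : 0 <= window A x.
Proof. by apply: Rintegral_ge0 => y _; rewrite mulr_ge0 ?phi_ge0. Qed.

Lemma window_setC A x : measurable A -> window A x + window (~` A) x = 1.
Proof.
move=> mA; rewrite /window -RintegralD//; last 2 first.
- exact: integrable_window.
- by apply: integrable_window; exact: measurableC.
transitivity (\int[mu]_y (phi (y - x))).
  apply: eq_Rintegral => y _; rewrite -mulrDl !indicE in_setC.
  by case: (y \in A); rewrite ?addr0 ?add0r mul1r.
by rewrite /Rintegral ge0_total.
Qed.

Lemma window_le1 A x : measurable A -> window A x <= 1.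
Proof. by move=> mA; rewrite -(window_setC x mA) lerDl window_ge0. Qed.

(** Chebyshev's inequality. *)
Lemma window_far (A : set R) x (e : R) : measurable A -> 0 < e ->
  (forall y, A y -> e <= `|y - x|) -> window A x <= s ^+ 2 / e ^+ 2.
Proof.
move=> mA e0 Ae.
pose g (z : R) := e ^- 2 * (z ^+ 2 * phi z).
have cg : continuous g.
  move=> z; apply: cvgM; first exact: cvg_cst.
  by apply: cvgM; [exact: exprn_continuous|exact: continuous_phi].
have g0 z : 0 <= g z.
  rewrite mulr_ge0 ?invr_ge0 ?sqr_ge0//.
  by apply: mulr_ge0; [exact: sqr_ge0|exact: phi_ge0].
have i2 : mu.-integrable setT (EFin \o (fun z => z ^+ 2 * phi z)).
  by have := integrable_pow_phi s0 1; apply: eq_integrable => // x' _ /=; rewrite expr1.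
have gE : (\int[mu]_z (g z)%:E = (s ^+ 2 / e ^+ 2)%:E)%E.
  have ig : mu.-integrable setT (EFin \o g).
    by have := integrableZl measurableT (e ^- 2) i2; exact: eq_integrable.
  rewrite -[LHS]fineK; last exact: integrable_fin_num.
  congr EFin; rewrite -/(Rintegral mu setT g) /g RintegralZl//.
  by rewrite (moment2_phi s0) mulrC.
rewrite -lee_fin -gE -(integral_translation x)//.
rewrite /window /Rintegral fineK; last exact: integrable_fin_num (integrable_window x mA).
apply: ge0_le_integral => //.
- by move=> y _; rewrite lee_fin mulr_ge0 ?phi_ge0.
- apply/measurable_EFinP; apply: measurable_funM; last exact: mphix.
  exact: measurable_indic.
- apply/measurable_EFinP; apply: (@measurableT_comp _ _ _ _ _ _ g).
    exact: continuous_measurable_fun.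
  exact: measurable_funB.
- move=> y _; rewrite lee_fin /g mulrA ler_wpM2r ?phi_ge0// indicE.
  case: (boolP (y \in A)) => [|_]; last by rewrite mulr_ge0 ?invr_ge0 ?sqr_ge0.
  rewrite inE => /Ae H; rewrite mulrC ler_pdivlMr ?exprn_gt0// mul1r.
  by rewrite -[leRHS](real_normK (num_real _)) lerXn2r// ?nnegrE// ltW.
Qed.

End gaussian_window.

Section charfun_unique.
Context (R : realType).
Notation mu := (@lebesgue_measure R).

Section one_space.
Context d (T : measurableType d) (P : probability T R).
Variables (Z X : T -> R) (M : R).
Hypothesis mZ : measurable_fun setT Z.
Hypothesis ZM : forall w, `|Z w| <= M.
Hypothesis mX : measurable_fun setT X.

Let mXy (y : R) : measurable_fun setT (fun w => y - X w).
Proof. exact: measurable_funB. Qed.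

(** A Gaussian is itself a mixture of cosines, weighted by the Gaussian of
    inverse width; Fubini exchanges the mixture with the mean. *)
Lemma gaussian_average (s y : R) : 0 < s ->
  \int[P]_w (Z w * normal_pdf 0 s (y - X w)) =
  normal_peak s * \int[mu]_l ((\int[P]_w (Z w * cos (- l * X w + l * y))) *
    normal_pdf 0 s^-1 l).
Proof.
move=> s0; have s1 : 0 < s^-1 by rewrite invr_gt0.
pose k (z : T * R) := Z z.1 * cos (- z.2 * X z.1 + z.2 * y).
have mk : measurable_fun setT k.
  apply: measurable_funM; first exact: measurableT_comp.
  apply: (@measurableT_comp _ _ _ _ _ _ (@cos R)).
    by apply: continuous_measurable_fun; exact: continuous_cos.
  apply: measurable_funD; apply: measurable_funM => //.
    exact: measurable_funN.
  exact: measurableT_comp.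
have kM z : `|k z| <= M.
  rewrite normrM (le_trans _ (ZM z.1))// ler_piMr// ler_norml.
  by rewrite cos_geN1 cos_le1.
rewrite -(Fubini_bounded P mk kM (integrable_normal_pdf 0 s^-1)).
rewrite -RintegralZl//; last first.
  have E : (fun w => \int[mu]_l (k (w, l) * normal_pdf 0 s^-1 l)) =
      (fun w => Z w * expR (- (y - X w) ^+ 2 * s^-1 ^+ 2 / 2)).
    apply/funext => w; transitivity
      (Z w * \int[mu]_l (cos ((y - X w) * l + 0) * normal_pdf 0 s^-1 l)).
      rewrite -RintegralZl//; last exact: integrable_cos_phi.
      apply: eq_Rintegral => l _; rewrite /k /= mulrA; congr (_ * cos _ * _); ring.
    by rewrite charfun_normal// cos0 mul1r -mulNr.
  rewrite E; apply: (@integrable_bounded _ _ _ _ _ M).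
    apply: measurable_funM => //; apply: measurableT_comp => //.
    apply: measurable_funM => //; apply: measurable_funM => //.
    by apply: measurable_funN; exact: measurable_funX.
  move=> w; rewrite normrM (le_trans _ (ZM w))// ler_piMr//.
  rewrite ger0_norm ?expR_ge0// -expR0 ler_expR.
  by rewrite -mulrA mulNr oppr_le0 mulr_ge0 ?sqr_ge0// divr_ge0// sqr_ge0.
apply: eq_Rintegral => w _.
transitivity (normal_peak s * (Z w *
    \int[mu]_l (cos ((y - X w) * l + 0) * normal_pdf 0 s^-1 l))).
  rewrite charfun_normal// cos0 mul1r normal_pdf0E// mulrCA.
  congr (_ * (_ * expR _)); field; rewrite gt_eqF//.
congr (_ * _); rewrite -RintegralZl//; last exact: integrable_cos_phi.
by apply: eq_Rintegral => l _; rewrite /k /= mulrA; congr (_ * cos _ * _); ring.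
Qed.

Lemma window_average (s a b : R) : 0 < s ->
  \int[P]_w (Z w * window s `[a, b] (X w)) =
  \int[mu]_y ((\int[P]_w (Z w * normal_pdf 0 s (y - X w))) * \1_`[a, b] y).
Proof.
move=> s0; pose k (z : T * R) := Z z.1 * normal_pdf 0 s (z.2 - X z.1).
have mk : measurable_fun setT k.
  apply: measurable_funM; first exact: measurableT_comp.
  apply: (measurableT_comp (measurable_phi s)) => //.
  apply: measurable_funB => //; exact: measurableT_comp.
have kM z : `|k z| <= M * normal_peak s.
  rewrite normrM ler_pM// ger0_norm ?phi_ge0// normal_pdf_ub// gt_eqF//.
have iab := @integrable_indic_itv R a b true false.
rewrite -(Fubini_bounded P mk kM iab); apply: eq_Rintegral => w _.
rewrite /window -RintegralZl//; last exact: integrable_window.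
by apply: eq_Rintegral => y _; rewrite /k /= mulrCA mulrC.
Qed.

(** The width 1 / n^2 of the Gaussian vanishes faster than the gap 1 / n
    between the closed and the open interval, so that the convergence holds at
    every point, including a and b. *)
Lemma cvg_window_average (a b : R) :
  \int[P]_w (Z w * window ((n.+1%:R ^+ 2)^-1)
     `[a + n.+1%:R^-1, b - n.+1%:R^-1] (X w)) @[n --> \oo]
  --> \int[P]_w (Z w * \1_`]a, b[ (X w)).
Proof.
pose e n : R := n.+1%:R^-1.
have e0 n : 0 < e n by rewrite invr_gt0 ltr0n.
pose s n : R := (n.+1%:R ^+ 2)^-1.
have s0 n : 0 < s n by rewrite invr_gt0 exprn_gt0 ?ltr0n.
have sE n : s n = e n ^+ 2 by rewrite /s /e exprVn.
pose W n x := window (s n) `[a + e n, b - e n] x.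
have mI n : measurable (`[a + e n, b - e n] : set R) by [].
have W0 n x : 0 <= W n x by exact: window_ge0.
have W1 n x : W n x <= 1 by exact: window_le1.
have cvg_e : e n @[n --> \oo] --> (0 : R) by exact: cvg_harmonic.
have cvg_e2 (c : R) : e n ^+ 2 * c @[n --> \oo] --> (0 : R).
  rewrite -[X in _ --> X](mul0r c) -[X in _ --> X * c](mulr0 0).
  by apply: cvgM; [apply: cvgM|exact: cvg_cst].
have cW x : W n x @[n --> \oo] --> (\1_`]a, b[ x : R).
  have [xab|xab] := boolP (x \in `]a, b[).
    rewrite indicE mem_set//.
    move: (xab); rewrite in_itv/= => /andP[ax xb].
    pose del := Num.min (x - a) (b - x) / 2.
    have del0 : 0 < del by rewrite divr_gt0// lt_min !subr_gt0 ax xb.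
    apply/cvgrPdist_le => eps eps0.
    near=> n.
    rewrite -(window_setC (s0 n) x (mI n)) -/(W n x) addrAC subrr add0r.
    rewrite ger0_norm ?window_ge0//.
    have en : e n <= del.
      near: n; move/cvgrPdist_le : cvg_e => /(_ _ del0).
      by apply: filterS => n; rewrite sub0r normrN ger0_norm// ltW.
    apply: (@le_trans _ _ (s n ^+ 2 / del ^+ 2)).
      apply: window_far => //; first exact: measurableC.
      move=> y /=; rewrite in_itv/= => /negP; rewrite negb_and -!ltNge => H.
      have d1 : del * 2 <= x - a by rewrite divfK// ge_min lexx.
      have d2 : del * 2 <= b - x by rewrite divfK// ge_min lexx orbT.
      case/orP : H => H.
        by rewrite distrC (le_trans _ (ler_norm _))//; lra.
      by rewrite (le_trans _ (ler_norm _))//; lra.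
    rewrite sE.
    near: n; move/cvgrPdist_le : (cvg_e2 (del ^+ 2)^-1) => /(_ _ eps0).
    apply: filterS => n; rewrite sub0r normrN.
    move=> /(le_trans (ler_norm _)); apply: le_trans.
    rewrite ler_wpM2r ?invr_ge0 ?sqr_ge0// -[leRHS]mulr1 expr2 ler_wpM2l ?sqr_ge0//.
    by apply: exprn_ile1; [exact: ltW|rewrite /e invf_le1 ?ltr0n// ler1n].
  rewrite indicE memNset; last by move=> H; move: xab; rewrite H.
  have le_W n : 0 <= W n x <= e n ^+ 2 * 1.
    rewrite W0 /=; apply: le_trans (window_far (s0 n) (mI n) (e0 n) _) _.
      move=> y /=; rewrite in_itv/= => /andP[y1 y2].
      have [xa|xa] := leP x a.
        by rewrite (le_trans _ (ler_norm _))//; lra.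
      move: xab; rewrite in_itv/= xa /= -leNgt => bx.
      by rewrite distrC (le_trans _ (ler_norm _))//; lra.
    by rewrite sE mulr1 expr2 mulfK// gt_eqF// exprn_gt0.
  by apply: cvg0_le (cvg_e2 1); exact: nearW.
have mW n : measurable_fun setT (W n).
  pose h (z : R * R) : \bar R := (\1_`[a + e n, b - e n] z.2 * normal_pdf 0 (s n) (z.2 - z.1))%:E.
  have mh : measurable_fun setT h.
    apply/measurable_EFinP; apply: measurable_funM.
      by apply: (@measurableT_comp _ _ _ _ _ _ (\1_`[a + e n, b - e n] : R -> R)).
    apply: (measurableT_comp (measurable_phi (s n))) => //.
    exact: measurable_funB.
  have h0 z : (0 <= h z)%E by rewrite lee_fin mulr_ge0 ?phi_ge0.
  apply: (measurableT_comp (@fine_measurable R setT measurableT)) => //.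
  exact: (@measurable_fun_fubini_tonelli_F _ _ _ _ _ mu h mh h0).
have mg n : measurable_fun setT (fun w => (Z w * W n (X w))%:E).
  apply/measurable_EFinP; apply: measurable_funM => //.
  exact: (measurableT_comp (mW n)).
have mlim : measurable_fun setT (fun w => (Z w * \1_`]a, b[ (X w))%:E).
  apply/measurable_EFinP; apply: measurable_funM => //.
  by apply: (@measurableT_comp _ _ _ _ _ _ (\1_`]a, b[ : R -> R)).
have ae1 : {ae P, forall w, setT w -> (Z w * W n (X w))%:E @[n --> \oo] -->
    (Z w * \1_`]a, b[ (X w))%:E}.
  apply: aeW => w _; apply: cvg_EFin; first exact: nearW.
  by apply: cvgM; [exact: cvg_cst|exact: cW].
have ae2 : {ae P, forall w n, setT w -> (`|(Z w * W n (X w))%:E| <= M%:E)%E}.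
  apply: aeW => w n _; rewrite lee_fin normrM (ger0_norm (W0 _ _)).
  by rewrite (le_trans _ (ZM w))// ler_piMr.
have [_ _] := @dominated_convergence _ _ _ P setT measurableT
  (fun n w => (Z w * W n (X w))%:E) (fun w => (Z w * \1_`]a, b[ (X w))%:E)
  (cst M%:E) mg mlim ae1 (finite_measure_integrable_cst P M measurableT) ae2.
rewrite -[X in _ --> X]fineK; last first.
  apply: integrable_fin_num => //.
  apply: (@integrable_bounded _ _ _ P (fun w => Z w * \1_`]a, b[ (X w)) M).
    exact/measurable_EFinP.
  by move=> w; rewrite normrM (le_trans _ (ZM w))// ler_piMr// indic_norm_le1.
exact: fine_cvg.
Unshelve. all: by end_near. Qed.

Lemma sigma_additive_average (F : (set R)^nat) :
  (forall n, measurable (F n)) -> trivIset [set: nat] F ->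
  \sum_(i < n) \int[P]_w (Z w * \1_(F i) (X w)) @[n --> \oo] -->
  \int[P]_w (Z w * \1_(\bigcup_k F k) (X w)).
Proof.
move=> mF tF.
have mB (B : set R) : measurable B -> measurable_fun setT (fun w => Z w * \1_B (X w)).
  move=> mB; apply: measurable_funM => //.
  by apply: (@measurableT_comp _ _ _ _ _ _ (\1_B : R -> R)) => //; exact: measurable_indic.
have leM (B : set R) w : `|Z w * \1_B (X w)| <= M.
  by rewrite normrM (le_trans _ (ZM w))// ler_piMr// indic_norm_le1.
pose U n := \big[setU/set0]_(i < n) F i.
have mU n : measurable (U n) by exact: bigsetU_measurable.
have UE n x : \1_(U n) x = \sum_(i < n) \1_(F i) x :> R.
  elim: n => [|n ih]; first by rewrite /U !big_ord0 indic0.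
  rewrite /U !big_ord_recr /= -/(U n) -ih !indicE in_setU.
  have [xU|xU] /= := boolP (x \in U n); last by rewrite add0r.
  rewrite (_ : (x \in F n) = false) ?addr0//; apply/negP; rewrite inE => xF.
  move: xU; rewrite inE /U -bigcup_mkord => -[i /= ni xFi].
  have ii : i = n by apply: tF => //; exists x.
  by move: ni; rewrite ii ltnn.
have cU x : \1_(U n) x @[n --> \oo] --> (\1_(\bigcup_k F k) x : R).
  apply: cvg_near_cst.
  have [[k _ xk]|xF] := pselect ((\bigcup_k F k) x).
    near=> n; suff Ux : U n x by rewrite !indicE !mem_set//; exists k.
    rewrite /U -bigcup_mkord; exists k => //=; near: n; exact: nbhs_infty_gt.
  near=> n; rewrite !indicE !memNset//.
  by apply: contra_not xF; rewrite /U -bigcup_mkord => -[i _ Fi]; exists i.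
have ae1 : {ae P, forall w, setT w -> (Z w * \1_(U n) (X w))%:E @[n --> \oo] -->
    (Z w * \1_(\bigcup_k F k) (X w))%:E}.
  apply: aeW => w _; apply: cvg_EFin; first exact: nearW.
  by apply: cvgM; [exact: cvg_cst|exact: cU].
have ae2 : {ae P, forall w n, setT w -> (`|(Z w * \1_(U n) (X w))%:E| <= M%:E)%E}.
  by apply: aeW => w n _; rewrite lee_fin.
have mE (B : set R) : measurable B ->
  measurable_fun setT (fun w => (Z w * \1_B (X w))%:E).
  by move=> /mB; move/measurable_EFinP.
have [_ _] := @dominated_convergence _ _ _ P setT measurableT
  (fun n w => (Z w * \1_(U n) (X w))%:E) (fun w => (Z w * \1_(\bigcup_k F k) (X w))%:E)
  (cst M%:E) (fun n => mE _ (mU n)) (mE _ (bigcupT_measurable _ mF)) ae1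
  (finite_measure_integrable_cst P M measurableT) ae2.
rewrite -[X in _ --> X]fineK; last first.
  apply: integrable_fin_num => //.
  apply: (@integrable_bounded _ _ _ P (fun w => Z w * \1_(\bigcup_k F k) (X w)) M) => //.
  by apply: mB; exact: bigcupT_measurable.
move=> /fine_cvg; apply: cvg_trans; apply: near_eq_cvg; near=> n.
rewrite -Rint_sum; last first.
  by move=> i; apply: (@integrable_bounded _ _ _ P _ M) => //; exact: mB.
by congr fine; apply: eq_integral => w _; rewrite UE mulr_sumr.
Unshelve. all: by end_near. Qed.

End one_space.

(** Lévy's uniqueness theorem, for the signed measures with density Z and Z'
    transported by X and X'. Cosines determine Gaussian averages, these
    determine open intervals, and the latter generate the Borel sets. *)
Theorem charfun_unique d (T : measurableType d) (P : probability T R) (Z X : T -> R)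
    d' (T' : measurableType d') (P' : probability T' R) (Z' X' : T' -> R) (M : R) :
  measurable_fun setT Z -> (forall w, `|Z w| <= M) -> measurable_fun setT X ->
  measurable_fun setT Z' -> (forall w, `|Z' w| <= M) -> measurable_fun setT X' ->
  (forall l th, \int[P]_w (Z w * cos (l * X w + th)) =
                \int[P']_w (Z' w * cos (l * X' w + th))) ->
  forall B, measurable B ->
    \int[P]_w (Z w * \1_B (X w)) = \int[P']_w (Z' w * \1_B (X' w)).
Proof.
move=> mZ ZM mX mZ' ZM' mX' H B mB.
have E1 : \int[P]_w Z w = \int[P']_w Z' w.
  have := H 0 0; under eq_Rintegral do rewrite mul0r addr0 cos0 mulr1.
  by move=> ->; apply: eq_Rintegral => w _; rewrite mul0r addr0 cos0 mulr1.
have iB dd (S : measurableType dd) (Q : probability S R) (z x : S -> R) (A : set R) :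
    measurable_fun setT z -> (forall w, `|z w| <= M) -> measurable_fun setT x ->
    measurable A -> Q.-integrable setT (EFin \o (fun w => z w * \1_A (x w))).
  move=> mz zM mx mA; apply: (@integrable_bounded _ _ _ Q _ M).
    apply: measurable_funM => //.
    by apply: (@measurableT_comp _ _ _ _ _ _ (\1_A : R -> R)) => //; exact: measurable_indic.
  by move=> w; rewrite normrM (le_trans _ (zM w))// ler_piMr// indic_norm_le1.
have itv a b : \int[P]_w (Z w * \1_`]a, b[ (X w)) = \int[P']_w (Z' w * \1_`]a, b[ (X' w)).
  have c1 := @cvg_window_average _ _ P _ _ _ mZ ZM mX a b.
  apply: (cvg_unique (@norm_hausdorff _ R) c1).
  have := @cvg_window_average _ _ P' _ _ _ mZ' ZM' mX' a b; apply: cvg_trans; apply: near_eq_cvg.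
  near=> n; have s0 : 0 < (n.+1%:R ^+ 2)^-1 :> R by rewrite invr_gt0 exprn_gt0 ?ltr0n.
  rewrite /= (window_average P mZ ZM mX) ?(window_average P' mZ' ZM' mX')//.
  apply: eq_Rintegral => y _; congr (_ * _).
  rewrite (gaussian_average P mZ ZM mX) ?(gaussian_average P' mZ' ZM' mX')//.
  by congr (_ * _); apply: eq_Rintegral => l _; rewrite H.
pose G : set (set R) := [set A | exists x y, A = `]x, y[%classic].
have GE : @measurable _ (measurableTypeR R) = <<s G >>.
  exact: RGenOpens.measurableE.
move: B mB; rewrite -[X in forall B, X B -> _]/(@measurable _ (measurableTypeR R)) GE.
apply: (@dynkin_induction _ (measurableTypeR R) G _ GE).
- move=> _ _ [a [b ->]] [a' [b' ->]]; exists (Num.max a a'), (Num.min b b').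
  apply/seteqP; split => x /=; rewrite !in_itv/= gt_max lt_min.
    by move=> [/andP[-> ->] /andP[-> ->]].
  by move=> /andP[/andP[-> ->] /andP[-> ->]].
- under eq_Rintegral do rewrite indicT mulr1.
  by rewrite E1; apply: eq_Rintegral => w _; rewrite indicT mulr1.
- by move=> _ [a [b ->]]; exact: itv.
- move=> S mS ES.
  have C dd (U : measurableType dd) (Q : probability U R) (z x : U -> R) :
      measurable_fun setT z -> (forall w, `|z w| <= M) -> measurable_fun setT x ->
      \int[Q]_w (z w * \1_(~` S) (x w)) = \int[Q]_w z w - \int[Q]_w (z w * \1_S (x w)).
    move=> mz zM mx; rewrite -RintegralB//; last 2 first.
    - exact: (@integrable_bounded _ _ _ Q _ M).
    - exact: iB.
    apply: eq_Rintegral => w _; rewrite !indicE in_setC.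
    by case: (x w \in S); rewrite ?mulr0 ?mulr1 ?subr0 ?subrr.
  by rewrite !C// ES E1.
- move=> F mF tF EF.
  have c1 := @sigma_additive_average _ _ P _ _ _ mZ ZM mX F mF tF.
  have c2 := @sigma_additive_average _ _ P' _ _ _ mZ' ZM' mX' F mF tF.
  have E : (fun n => \sum_(i < n) \int[P']_w (Z' w * \1_(F i) (X' w))) =
      (fun n => \sum_(i < n) \int[P]_w (Z w * \1_(F i) (X w))).
    by apply/funext => n; apply: eq_bigr => i _; rewrite EF.
  by move: c2; rewrite E => c2; exact: (cvg_unique (@norm_hausdorff _ R) c1 c2).
Unshelve. all: by end_near. Qed.

End charfun_unique.

(** * Adapted variables and independence *)

Section adapted.
Context (R : realType) (d : measure_display) (Omega : measurableType d).
Variable G : set_system Omega.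
Implicit Types X Y : Omega -> R.

Lemma adaptedP X : sigma_algebra setT G ->
  adapted_to G X <-> measurable_fun setT (X : g_sigma_algebraType G -> R).
Proof.
move=> sG; have GE : @measurable _ (g_sigma_algebraType G) = G.
  by apply: sigma_algebra_id.
split=> [aX _ B mB|mX _ [B mB <-]].
  by rewrite GE; apply: aX; exists B.
by rewrite -GE; exact: mX.
Qed.

Hypothesis sG : sigma_algebra setT G.

Lemma adapted_comp X (h : R -> R) : measurable_fun setT h -> adapted_to G X ->
  adapted_to G (fun w => h (X w)).
Proof.
move=> mh /(adaptedP _ sG) mX; apply/(adaptedP _ sG).
exact: (measurableT_comp mh mX).
Qed.

Lemma adapted_cst (c : R) : adapted_to G (cst c).
Proof. by apply/(adaptedP _ sG); exact: measurable_cst. Qed.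

Lemma adaptedZ c X : adapted_to G X -> adapted_to G (fun w => c * X w).
Proof. by apply: (adapted_comp (h := *%R c)); exact: mulrl_measurable. Qed.

Lemma adaptedD X Y : adapted_to G X -> adapted_to G Y ->
  adapted_to G (fun w => X w + Y w).
Proof.
move=> /(adaptedP _ sG) mX /(adaptedP _ sG) mY; apply/(adaptedP _ sG).
exact: (measurable_funD mX mY).
Qed.

Lemma adaptedM X Y : adapted_to G X -> adapted_to G Y ->
  adapted_to G (fun w => X w * Y w).
Proof.
move=> /(adaptedP _ sG) mX /(adaptedP _ sG) mY; apply/(adaptedP _ sG).
exact: (measurable_funM mX mY).
Qed.

Lemma adaptedB X Y : adapted_to G X -> adapted_to G Y ->
  adapted_to G (fun w => X w - Y w).
Proof.
move=> /(adaptedP _ sG) mX /(adaptedP _ sG) mY; apply/(adaptedP _ sG).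
exact: (measurable_funB mX mY).
Qed.

Lemma adapted_sum I (s : seq I) (X : I -> Omega -> R) :
  (forall i, adapted_to G (X i)) -> adapted_to G (fun w => \sum_(i <- s) X i w).
Proof.
move=> aX; elim: s => [|i s ih].
  rewrite (_ : (fun w => _) = cst 0); first exact: adapted_cst.
  by apply/funext => w; rewrite big_nil.
rewrite (_ : (fun w => _) = (fun w => X i w + \sum_(j <- s) X j w)).
  exact: adaptedD.
by apply/funext => w; rewrite big_cons.
Qed.

End adapted.

Section independence.
Context (R : realType) (d : measure_display) (Omega : measurableType d)
  (P : probability Omega R).

(** Independence says that the joint law is a product measure, so that
    Fubini's theorem applies. *)
Lemma indep_mul (X Y : Omega -> R) (f g : R -> R) :
  measurable_fun setT X -> measurable_fun setT Y ->
  measurable_fun setT f -> measurable_fun setT g ->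
  (forall A B, measurable A -> measurable B ->
    P (X @^-1` A `&` Y @^-1` B) = P (X @^-1` A) * P (Y @^-1` B))%E ->
  P.-integrable setT (EFin \o (fun w => f (X w))) ->
  P.-integrable setT (EFin \o (fun w => g (Y w))) ->
  P.-integrable setT (EFin \o (fun w => f (X w) * g (Y w))) /\
  \int[P]_w (f (X w) * g (Y w)) = \int[P]_w f (X w) * \int[P]_w g (Y w).
Proof.
move=> mX mY mf mg XY if_ ig.
pose RT := measurableTypeR R.
pose X' : {mfun Omega >-> RT} := HB.pack (X : Omega -> RT)
  (isMeasurableFun.Build _ _ Omega RT (X : Omega -> RT) mX).
pose Y' : {mfun Omega >-> RT} := HB.pack (Y : Omega -> RT)
  (isMeasurableFun.Build _ _ Omega RT (Y : Omega -> RT) mY).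
have mJ : measurable_fun setT (fun w => (X w, Y w) : RT * RT).
  exact/measurable_fun_pair.
pose J : {mfun Omega >-> (RT * RT)%type} := HB.pack (fun w => (X w, Y w) : RT * RT)
  (isMeasurableFun.Build _ _ Omega (RT * RT)%type (fun w => (X w, Y w) : RT * RT) mJ).
pose muX := distribution P X'; pose muY := distribution P Y'.
have JE S : measurable S -> (muX \x muY)%E S = distribution P J S.
  apply: product_measure_unique => A B mA mB.
  by rewrite /distribution /pushforward /= -XY.
pose h (z : RT * RT) : R := f z.1 * g z.2.
have mh : measurable_fun setT h.
  by apply: measurable_funM; exact: measurableT_comp.
have iX : muX.-integrable setT (EFin \o f).
  by apply: integrable_pushforward => //; exact/measurable_EFinP.
have iY : muY.-integrable setT (EFin \o g).
  by apply: integrable_pushforward => //; exact/measurable_EFinP.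
have ih : (muX \x muY)%E.-integrable setT (EFin \o h).
  apply/integrable12ltyP; first exact/measurable_EFinP.
  have Eabs x : (\int[muY]_y `|(EFin \o h) (x, y)| =
      `|f x|%:E * \int[muY]_y `|g y|%:E)%E.
    rewrite -ge0_integralZl//; last by apply/measurable_EFinP; exact: measurableT_comp.
    by apply: eq_integral => y _; rewrite /= normrM EFinM.
  under eq_integral do rewrite Eabs.
  rewrite ge0_integralZr//=.
  - have /integrableP[_ Xoo] := iX; have /integrableP[_ Yoo] := iY.
    by apply: lte_mul_pinfty => //; [exact: integral_ge0|
      rewrite ge0_fin_numE//; exact: integral_ge0].
  - by apply/measurable_EFinP; exact: measurableT_comp.
  - by apply: integral_ge0.
have ihP : P.-integrable setT (EFin \o (fun w => f (X w) * g (Y w))).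
  apply/integrableP; split.
    by apply/measurable_EFinP; apply: measurable_funM; exact: measurableT_comp.
  have /integrableP[_] := ih.
  rewrite (eq_measure_integral (distribution P J)); last by move=> A mA _; exact: JE.
  rewrite ge0_integral_pushforward//.
  by apply: measurableT_comp => //; exact/measurable_EFinP.
split => //.
transitivity (fine (\int[distribution P J]_z (h z)%:E)%E).
  by rewrite integral_pushforward//; exact/measurable_EFinP.
rewrite -(eq_measure_integral (distribution P J) (m1 := (muX \x muY)%E)); last first.
  by move=> A mA _; exact: JE.
rewrite -(integral12_prod_meas1 ih) /fubini_F.
transitivity (\int[muX]_x (f x * \int[muY]_y g y)).
  congr fine; apply: eq_integral => x _; rewrite -RintegralZl// /Rintegral fineK//.
  apply: integrable_fin_num => //.
  by have := integrableZl measurableT (f x) iY; exact: eq_integrable.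
rewrite RintegralZr//; congr (_ * _).
- by rewrite /Rintegral integral_pushforward//; exact/measurable_EFinP.
- by rewrite /Rintegral integral_pushforward//; exact/measurable_EFinP.
Qed.

Lemma indep_generated (C : set_system Omega) (E : set Omega) :
  C `<=` measurable -> setI_closed C -> measurable E ->
  (forall A, C A -> P (A `&` E) = P A * P E)%E ->
  forall A, <<s C >> A -> (P (A `&` E) = P A * P E)%E.
Proof.
move=> Cm CI mE CE.
have sCm : <<s C >> `<=` @measurable _ Omega.
  by apply: smallest_sub => //; exact: sigma_algebra_measurable.
have fE : P E \is a fin_num by exact: fin_num_measure.
apply: (@dynkin_induction _ (g_sigma_algebraType C) C).
- by [].
- by [].
- by rewrite setTI probability_setT mul1e.
- exact: CE.
- move=> /= S /sCm mS SE.
  have -> : ~` S `&` E = E `\` (S `&` E).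
    by apply/seteqP; split => x /= [] => [nS Ex|Ex nS]; split => //;
      [case|move=> Sx; exact: nS].
  rewrite measureD//; last 2 first.
  - exact: measurableI.
  - by rewrite ltey_eq fE.
  rewrite probability_setC// (_ : E `&` (S `&` E) = S `&` E); last first.
    by rewrite setIA (setIC E S) -setIA setIid.
  rewrite [RHS]muleBl ?mul1e//.
  by congr (_ - _)%E; exact: SE.
- move=> F mF tF FE.
  have mF' n : @measurable _ Omega (F n) by apply: sCm; exact: mF.
  rewrite setI_bigcupl.
  have tFE : trivIset [set: nat] (fun n => F n `&` E).
    by move=> i j _ _ [x [[Fi _] [Fj _]]]; apply: tF => //; exists x.
  have c1 := measure_semi_sigma_additive (fun n => F n `&` E)
    (fun n => measurableI _ _ (mF' n) mE) tFE
    (bigcupT_measurable _ (fun n => measurableI _ _ (mF' n) mE)) (s := P).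
  have c2 := measure_semi_sigma_additive F mF' tF (bigcupT_measurable _ mF') (s := P).
  have c3 : (\sum_(0 <= i < n) P (F i `&` E))%E @[n --> \oo] -->
      (P (\bigcup_n F n) * P E)%E.
    rewrite (_ : (fun n => _) = (fun n => (\sum_(0 <= i < n) P (F i)) * P E)%E).
      by apply: cvgeZr.
    apply/funext => n; rewrite ge0_sume_distrl => [|i _]; last exact: measure_ge0.
    by apply: eq_bigr => i _; rewrite FE.
  by rewrite -(cvg_lim _ c3)// -(cvg_lim _ c1).
Qed.

End independence.

(** * Increments of a Wiener process *)

Lemma bigcap_finType (Omega : Type) (I : finType) (E : I -> set Omega) :
  \bigcap_i E i = \big[setI/setT]_(i <- index_enum I) E i.
Proof.
have H (s : seq I) x : (\big[setI/setT]_(i <- s) E i) x <-> forall i, i \in s -> E i x.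
  elim: s => [|i s ih]; first by rewrite big_nil; split.
  rewrite big_cons; split=> [[Ei /ih Es] j|Es].
    by rewrite inE => /predU1P[->//|/Es].
  split; first by apply: Es; rewrite mem_head.
  by apply/ih => j js; apply: Es; rewrite inE js orbT.
apply/seteqP; split => x; first by move=> Ex; apply/H => i _; exact: Ex.
by move/H => Ex i _; apply: Ex; exact: mem_index_enum.
Qed.

Lemma adapted_measurable (R : realType) d (Omega : measurableType d)
    (G : set_system Omega) (X : Omega -> R) :
  G `<=` measurable -> adapted_to G X -> measurable_fun setT X.
Proof. by move=> Gm aX _ B mB; apply: Gm; apply: aX; exists B. Qed.

Section wiener.
Context (R : realType) (d : measure_display) (Omega : measurableType d)
  (P : probability Omega R) (T : R) (F : R -> set_system Omega) (m : nat)
  (f : 'I_m -> R -> Omega -> R).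
Hypotheses (hF : filtration T F) (hf : wiener_process P T F f).

Lemma filtrationS s u : 0 <= s -> s <= u -> u <= T -> forall X : Omega -> R,
  adapted_to (F s) X -> adapted_to (F u) X.
Proof.
by move=> s0 su uT X aX; apply: subset_trans aX _; exact: filtration_nondecreasing hF _ _ s0 su uT.
Qed.

Lemma filtration_sa s : 0 <= s -> s <= T -> sigma_algebra setT (F s).
Proof. by move=> s0 sT; apply: (filtration_sigma_algebra hF); rewrite s0. Qed.

Lemma filtration_sub s : 0 <= s -> s <= T -> F s `<=` measurable.
Proof. by move=> s0 sT; apply: (filtration_measurable hF); rewrite s0. Qed.

Lemma wiener_adapted_le r s u : 0 <= s -> s <= u -> u <= T -> adapted_to (F u) (f r s).
Proof.
move=> s0 su uT; apply: (filtrationS s0 su uT); apply: (wiener_adapted hf).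
by rewrite s0 (le_trans su).
Qed.

Variables s u : R.
Hypotheses (s0 : 0 <= s) (su : s < u) (uT : u <= T).
Let sT : s <= T. Proof. exact: le_trans (ltW su) uT. Qed.
Let u0 : 0 <= u. Proof. exact: le_trans s0 (ltW su). Qed.

Definition increment (r : 'I_m) (w : Omega) : R := f r u w - f r s w.

Lemma measurable_increment r : measurable_fun setT (increment r).
Proof.
apply: (adapted_measurable (filtration_sub u0 uT)).
apply: adaptedB; first exact: filtration_sa.
  exact: wiener_adapted_le.
by apply: wiener_adapted_le => //; exact: ltW.
Qed.

Let mpre r B : measurable B -> measurable (increment r @^-1` B).
Proof.
by move=> mB; rewrite -[X in measurable X]setTI; exact: measurable_increment.
Qed.

Lemma box_increments A (B : 'I_m -> set R) : F s A -> (forall r, measurable (B r)) ->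
  P (A `&` \bigcap_r (increment r @^-1` B r)) =
  (P A * \big[*%E/1]_r P (increment r @^-1` B r))%E.
Proof.
move=> FA mB; rewrite (wiener_increments hf s0 (ltW su) uT FA mB).
rewrite bigcap_finType; congr (_ * _)%E.
apply: (wiener_components hf); first exact: index_enum_uniq.
move=> r _; pose G := process_sigma_algebra T (f r).
have sG : sigma_algebra setT G by exact: smallest_sigma_algebra.
have aG v : 0 <= v <= T -> adapted_to G (f r v).
  move=> v0T; apply: subset_trans (@sub_sigma_algebra _ _ _).
  by move=> E HE; exists v => //; rewrite /= in_itv.
have : adapted_to G (increment r).
  by apply: adaptedB => //; apply: aG; rewrite ?u0 ?s0 ?sT.
by apply; exists (B r) => //; rewrite setTI.
Qed.

(** What an increment of the r-th component is independent of: the past and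
    the increments of the other components. *)
Definition others r := [set E | exists A (B : 'I_m -> set R),
  [/\ F s A, forall q, measurable (B q), B r = setT &
    E = A `&` \bigcap_q (increment q @^-1` B q)]].

Let others_measurable r : others r `<=` measurable.
Proof.
move=> _ [A [B [FA mB _ ->]]]; apply: measurableI.
  exact: filtration_sub FA.
by apply: fin_bigcap_measurable => // q _; exact: mpre.
Qed.

Lemma increment_indep r A B : <<s others r >> A -> measurable B ->
  (P (A `&` increment r @^-1` B) = P A * P (increment r @^-1` B))%E.
Proof.
move=> + mB; move: A; apply: indep_generated => //.
- move=> _ _ [A [C [FA mC Cr ->]]] [A' [C' [FA' mC' C'r ->]]].
  exists (A `&` A'), (fun q => C q `&` C' q); split.
  + pose GT := g_sigma_algebraType (F s).
    have E : @measurable _ GT = F s by apply: sigma_algebra_id; exact: filtration_sa.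
    by rewrite -E; apply: (@measurableI _ GT); rewrite E.
  + by move=> q; exact: measurableI.
  + by rewrite Cr C'r setTI.
  + apply/seteqP; split => w /=.
      by move=> [[Aw Cw] [A'w C'w]]; split => // q _; split; [exact: Cw|exact: C'w].
    by move=> [[Aw A'w] CC]; split; split => // q _; have [] := CC q Logic.I.
- exact: mpre.
- move=> _ [A [C [FA mC Cr ->]]].
  pose C' q := if q == r then B else C q.
  have mC' q : measurable (C' q) by rewrite /C'; case: ifP.
  have -> : A `&` \bigcap_q (increment q @^-1` C q) `&` increment r @^-1` B =
      A `&` \bigcap_q (increment q @^-1` C' q).
    apply/seteqP; split => w /=.
      move=> [[Aw Cw] Bw]; split => // q _; rewrite /C' /=.
      by case: eqP => [->//|_]; exact: Cw.
    move=> [Aw Cw]; split; first split => //.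
      move=> q _ /=; have := Cw q Logic.I; rewrite /C' /=.
      by case: eqP => // -> _; rewrite Cr.
    by have := Cw r Logic.I; rewrite /C' eqxx.
  rewrite !box_increments// -muleA; congr (_ * _)%E.
  rewrite (bigD1 r)//= [in RHS](bigD1 r)//= Cr preimage_setT probability_setT mul1e.
  rewrite /C' eqxx muleC; congr (_ * _)%E.
  by apply: eq_bigr => q /negbTE ->.
Qed.

Lemma adapted_others r (X : Omega -> R) : adapted_to (F s) X -> adapted_to <<s others r >> X.
Proof.
move=> aX; apply: subset_trans aX _ => A FA; apply: sub_sigma_algebra.
exists A, (fun=> setT); split => //.
by rewrite (_ : \bigcap_q _ = setT) ?setIT//; apply/seteqP; split.
Qed.

Lemma increment_others r q : q != r -> adapted_to <<s others r >> (increment q).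
Proof.
move=> qr _ [B mB <-]; apply: sub_sigma_algebra.
exists setT, (fun p => if p == q then B else setT); split.
- pose GT := g_sigma_algebraType (F s).
  have E : @measurable _ GT = F s by apply: sigma_algebra_id; exact: filtration_sa.
  by rewrite -E; exact: (@measurableT _ GT).
- by move=> p; case: ifP.
- by rewrite eq_sym (negbTE qr).
- apply/seteqP; split => w [_ Bw]; split => //.
    by move=> p _ /=; case: eqP => // ->.
  by have := Bw q Logic.I; rewrite /= eqxx.
Qed.

Lemma integral_increment r (h : R -> R) : measurable_fun setT h ->
  (@lebesgue_measure R).-integrable setT
     (EFin \o (fun x => h x * normal_pdf 0 (Num.sqrt (u - s)) x)) ->
  P.-integrable setT (EFin \o (fun w => h (increment r w))) /\
  \int[P]_w h (increment r w) =
    \int[@lebesgue_measure R]_x (h x * normal_pdf 0 (Num.sqrt (u - s)) x).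
Proof.
move=> mh ih; apply: integral_law => //.
- exact: measurable_increment.
- exact: measurable_normal_pdf.
- by move=> x; exact: normal_pdf_ge0.
- by move=> B mB; exact: (wiener_gaussian hf).
Qed.

Lemma mul_increment r (G : set_system Omega) (Z : Omega -> R) (h g : R -> R) :
  G `<=` <<s others r >> -> adapted_to G Z ->
  measurable_fun setT g -> P.-integrable setT (EFin \o (fun w => g (Z w))) ->
  measurable_fun setT h ->
  (@lebesgue_measure R).-integrable setT
     (EFin \o (fun x => h x * normal_pdf 0 (Num.sqrt (u - s)) x)) ->
  P.-integrable setT (EFin \o (fun w => g (Z w) * h (increment r w))) /\
  \int[P]_w (g (Z w) * h (increment r w)) = \int[P]_w g (Z w) *
    \int[@lebesgue_measure R]_x (h x * normal_pdf 0 (Num.sqrt (u - s)) x).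
Proof.
move=> GO aZ mg iZ mh ih; have [ih' <-] := integral_increment r mh ih.
apply: indep_mul => //.
- apply: (adapted_measurable (G := <<s others r >>)).
    by apply: smallest_sub; [exact: sigma_algebra_measurable|exact: others_measurable].
  exact: subset_trans GO.
- exact: measurable_increment.
- move=> A B mA mB; apply: increment_indep => //; apply: GO; apply: aZ.
  by exists A => //; rewrite setTI.
Qed.

Let sd := Num.sqrt (u - s).
Let sd0 : 0 < sd. Proof. by rewrite sqrtr_gt0 subr_gt0. Qed.
Let sdE : sd ^+ 2 = u - s. Proof. by rewrite sqr_sqrtr// subr_ge0 ltW. Qed.

Let F_others r : F s `<=` <<s others r >>.
Proof.
move=> A FA; apply: sub_sigma_algebra.
exists A, (fun=> setT); split => //.
by rewrite (_ : \bigcap_q _ = setT) ?setIT//; apply/seteqP; split.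
Qed.

Lemma mul_increment0 r (Z : Omega -> R) : adapted_to (F s) Z ->
  P.-integrable setT (EFin \o Z) ->
  P.-integrable setT (EFin \o (fun w => Z w * increment r w)) /\
  \int[P]_w (Z w * increment r w) = 0.
Proof.
move=> aZ iZ.
have i1 : (@lebesgue_measure R).-integrable setT
    (EFin \o (fun x => id x * normal_pdf 0 sd x)).
  apply: (@integrable_bounded_phi _ _ sd0 id 1 1) => // x.
  by rewrite mul1r; exact: normr_le_sqr.
have [] := @mul_increment r (F s) Z id id (@F_others r) aZ
  (@measurable_id _ _ setT) iZ (@measurable_id _ _ setT) i1.
by rewrite (moment1_phi sd0) mulr0.
Qed.

Lemma mul_increment2 r (Z : Omega -> R) : adapted_to (F s) Z ->
  P.-integrable setT (EFin \o Z) ->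
  P.-integrable setT (EFin \o (fun w => Z w * increment r w ^+ 2)) /\
  \int[P]_w (Z w * increment r w ^+ 2) = \int[P]_w Z w * (u - s).
Proof.
move=> aZ iZ.
have m2 : measurable_fun setT (fun x : R => x ^+ 2) by exact: exprn_measurable.
have i1 : (@lebesgue_measure R).-integrable setT
    (EFin \o (fun x => x ^+ 2 * normal_pdf 0 sd x)).
  apply: (@integrable_bounded_phi _ _ sd0 _ 1 1) => // x.
  by rewrite mul1r ger0_norm ?sqr_ge0// lerDr.
have [] := @mul_increment r (F s) Z (fun x => x ^+ 2) id (@F_others r) aZ
  (@measurable_id _ _ setT) iZ m2 i1.
by rewrite (moment2_phi sd0) sdE.
Qed.

(** In cos(Y + c D + th) = cos(Y + th) cos(c D) - sin(Y + th) sin(c D) the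
    increment D is independent of Y, and the second term is odd in D, hence of
    mean zero. *)
Lemma cos_increment r (G : set_system Omega) (Y : Omega -> R) c th :
  sigma_algebra setT G -> G `<=` <<s others r >> -> adapted_to G Y ->
  \int[P]_w cos (Y w + c * increment r w + th) =
  expR (- (c ^+ 2 * (u - s)) / 2) * \int[P]_w cos (Y w + th).
Proof.
move=> sG GO aY.
have mcos (e : R) : measurable_fun setT (fun x : R => cos (x + e)).
  by have := measurable_cos_affine 1 e; under eq_fun do rewrite mul1r.
have mY : measurable_fun setT Y.
  apply: (adapted_measurable _ aY); apply: subset_trans GO _.
  by apply: smallest_sub; [exact: sigma_algebra_measurable|exact: others_measurable].
have icos e : P.-integrable setT (EFin \o (fun w => cos (Y w + e))).
  apply: (@integrable_bounded _ _ _ _ _ 1); first exact: measurableT_comp (mcos e) mY.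
  by move=> w; rewrite ler_norml cos_geN1 cos_le1.
have H e e' : P.-integrable setT
    (EFin \o (fun w => cos (Y w + e) * cos (c * increment r w + e'))) /\
  \int[P]_w (cos (Y w + e) * cos (c * increment r w + e')) =
  \int[P]_w cos (Y w + e) * (cos e' * expR (- (c ^+ 2 * sd ^+ 2) / 2)).
  rewrite -(charfun_normal sd0).
  apply: (@mul_increment r G Y (fun x => cos (c * x + e')) (fun x => cos (x + e))) => //.
    exact: measurable_cos_affine.
  exact: integrable_cos_phi.
transitivity (\int[P]_w (cos (Y w + th) * cos (c * increment r w + 0) -
    cos (Y w + (th - pi / 2)) * cos (c * increment r w + - (pi / 2)))).
  apply: eq_Rintegral => w _.
  have sinE x : cos (x - pi / 2) = sin x by rewrite cosBpihalf.
  rewrite addr0 [Y w + (th - _)]addrA !sinE -cosD; congr cos; ring.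
have [i1 e1] := H th 0; have [i2 e2] := H (th - pi / 2) (- (pi / 2)).
rewrite RintegralB// e1 e2 cosN cos_pihalf mul0r mulr0 subr0 cos0 mul1r mulrC.
by rewrite sdE.
Qed.

Lemma cos_increments (X : Omega -> R) (c : 'I_m -> R) th : adapted_to (F s) X ->
  \int[P]_w cos (X w + \sum_r c r * increment r w + th) =
  expR (- ((\sum_r c r ^+ 2) * (u - s)) / 2) * \int[P]_w cos (X w + th).
Proof.
move=> aX.
have H (l : seq 'I_m) : uniq l ->
  \int[P]_w cos (X w + \sum_(r <- l) c r * increment r w + th) =
  expR (- ((\sum_(r <- l) c r ^+ 2) * (u - s)) / 2) * \int[P]_w cos (X w + th).
  elim: l => [_|r l ih /= /andP[rl ul]].
    rewrite big_nil mul0r oppr0 mul0r expR0 mul1r.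
    by apply: eq_Rintegral => w _; rewrite big_nil addr0.
  transitivity (\int[P]_w cos (X w + \sum_(q <- l) c q * increment q w +
      c r * increment r w + th)).
    by apply: eq_Rintegral => w _; rewrite big_cons; congr cos; ring.
  have sG : sigma_algebra setT <<s others r >> by exact: smallest_sigma_algebra.
  rewrite (@cos_increment r <<s others r >>)//.
    rewrite ih// mulrA -expRD big_cons; congr (expR _ * _); ring.
  apply: adaptedD => //; first exact: adapted_others.
  rewrite (_ : (fun w => _) = (fun w => \sum_(q <- l) (if q == r then 0 else c q * increment q w))).
    apply: adapted_sum => // q; case: eqP => [_|/eqP qr].
      exact: adapted_cst.
    by apply: (adaptedZ sG); exact: increment_others.
  apply/funext => w; rewrite big_seq [RHS]big_seq; apply: eq_bigr => q ql.
  by case: eqP => // qr; rewrite -qr ql in rl.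
by have := H (index_enum 'I_m) (index_enum_uniq _).
Qed.

End wiener.

(** * Step integrals *)

Section overlap.
Context (R : realType).
Notation mu := (@lebesgue_measure R).

(** The length of the intersection of [a, b[ and [a', b'[. *)
Definition overlap (a b a' b' : R) : R := Num.max 0 (Num.min b b' - Num.max a a').

Lemma overlapC a b a' b' : overlap a b a' b' = overlap a' b' a b.
Proof. by rewrite /overlap (minC b) (maxC a). Qed.

Lemma integrable_indic_co (a b : R) D : measurable D ->
  mu.-integrable D (EFin \o (\1_`[a, b[ : R -> R)).
Proof.
by move=> mD; apply: (integrableS measurableT) => //; exact: integrable_indic_itv.
Qed.

Lemma integrable_indic2 (a b a' b' : R) D : measurable D ->
  mu.-integrable D (EFin \o (fun v => \1_`[a, b[ v * \1_`[a', b'[ v)).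
Proof.
move=> mD; apply: le_integrable (integrable_indic_co a b mD) => //.
  by apply/measurable_EFinP; apply: measurable_funM; exact: measurable_indic.
by move=> v _; rewrite /= lee_fin normrM ler_piMr// indic_norm_le1.
Qed.

Lemma integral_overlap (al be a b a' b' : R) : al <= a -> b <= be ->
  \int[mu]_(v in `[al, be[) (\1_`[a, b[ v * \1_`[a', b'[ v) = overlap a b a' b'.
Proof.
move=> ala bbe; rewrite /Rintegral.
have -> : (fun v => (\1_`[a, b[ v * \1_`[a', b'[ v)%:E) =
    (fun v => (\1_`[Num.max a a', Num.min b b'[ v)%:E) :> (R -> \bar R).
  apply/funext => v.
  have -> : \1_`[a, b[ v * \1_`[a', b'[ v = \1_(`[a, b[ `&` `[a', b'[) v :> R.
    by rewrite indicI.
  congr (\1__ v)%:E; apply/seteqP; split => x /=;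
    rewrite !in_itv/= ge_max lt_min.
    by move=> [/andP[-> ->] /andP[-> ->]].
  by move=> /andP[/andP[-> ->] /andP[-> ->]].
rewrite integral_indic//= setIidl; last first.
  move=> x /=; rewrite !in_itv/= ge_max lt_min => /andP[/andP[ax _] /andP[xb _]].
  by rewrite (le_trans ala)// (lt_le_trans xb).
rewrite lebesgue_measure_itv/= lte_fin /overlap.
have [H|H] := ltP (Num.max a a') (Num.min b b').
  by rewrite /= [RHS]max_r// subr_ge0 ltW.
by rewrite /= max_l// subr_le0.
Qed.

Lemma integral_indic_co (al be a b : R) : al <= a -> a <= b -> b <= be ->
  \int[mu]_(v in `[al, be[) \1_`[a, b[ v = b - a.
Proof.
move=> ala ab bbe.
have -> : \int[mu]_(v in `[al, be[) \1_`[a, b[ v =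
   \int[mu]_(v in `[al, be[) (\1_`[a, b[ v * \1_`[a, b[ v).
  by apply: eq_Rintegral => x _; rewrite indicE; case: (_ \in _); rewrite ?mulr1 ?mulr0.
by rewrite integral_overlap// /overlap minxx maxxx max_r// subr_ge0.
Qed.

Lemma integral_quad_overlap (J : finType) (al be : R) (g : J -> J -> R) (a b : J -> R) :
  (forall j, al <= a j /\ b j <= be) ->
  mu.-integrable `[al, be[ (EFin \o (fun v => \sum_j \sum_j'
    g j j' * (\1_`[a j, b j[ v * \1_`[a j', b j'[ v))) /\
  \int[mu]_(v in `[al, be[) (\sum_j \sum_j'
    g j j' * (\1_`[a j, b j[ v * \1_`[a j', b j'[ v)) =
  \sum_j \sum_j' g j j' * overlap (a j) (b j) (a j') (b j').
Proof.
move=> ab.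
have mI : measurable (`[al, be[ : set (measurableTypeR R)) by exact: measurable_itv.
have i1 j j' : mu.-integrable `[al, be[ (EFin \o (fun v =>
    g j j' * (\1_`[a j, b j[ v * \1_`[a j', b j'[ v))).
  have := integrableZl mI (g j j') (integrable_indic2 (a j) (b j) (a j') (b j') mI).
  exact: eq_integrable.
have i2 j := Rint_sum_in (index_enum J) mI (i1 j).
have [i3 ->] := Rint_sum_in (index_enum J) mI (fun j => (i2 j).1).
split => //; apply: eq_bigr => j _; rewrite (i2 j).2; apply: eq_bigr => j' _.
rewrite RintegralZl//; last exact: integrable_indic2.
by rewrite integral_overlap//; have [] := ab j.
Qed.

(** Cauchy-Schwarz on [al, be[ for the step function with coefficients c: the
    discriminant of the integral of (step + x)^2, a quadratic polynomial in x,
    is nonpositive. *)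
Lemma time_sqr_le (I : finType) (al be : R) (c a b : I -> R) : al <= be ->
  (forall j, [/\ al <= a j, a j <= b j & b j <= be]) ->
  (\sum_j c j * (b j - a j)) ^+ 2 <=
  (be - al) * \sum_j \sum_j' c j * c j' * overlap (a j) (b j) (a j') (b j').
Proof.
move=> albe ab.
(* The index None carries the constant x as a step on all of [al, be[. *)
pose A (o : option I) : R := if o is Some j then a j else al.
pose B (o : option I) : R := if o is Some j then b j else be.
have AB o : al <= A o /\ B o <= be by case: o => [j|] //=; have [] := ab j.
have Q (d : option I -> R) :
    0 <= \sum_o \sum_o' d o * d o' * overlap (A o) (B o) (A o') (B o').
  have [_ <-] := integral_quad_overlap (fun o o' => d o * d o') AB.
  apply: Rintegral_ge0 => v _.
  have -> : \sum_o \sum_o' d o * d o' * (\1_`[A o, B o[ v * \1_`[A o', B o'[ v) =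
      (\sum_o d o * \1_`[A o, B o[ v) ^+ 2.
    rewrite expr2 mulr_suml; apply: eq_bigr => o _; rewrite mulr_sumr.
    by apply: eq_bigr => o' _; ring.
  exact: sqr_ge0.
set S := \sum_j c j * _; set V := \sum_j _.
have H x : 0 <= V + 2 * x * S + x ^+ 2 * (be - al).
  have := Q (fun o => if o is Some j then c j else x).
  have big_opt (h : option I -> R) : \sum_o h o = h None + \sum_j h (Some j).
    rewrite (bigD1 None)//=; congr (_ + _).
    rewrite (reindex_omap Some id)/=; last by case.
    by apply: eq_bigl => j; rewrite eqxx.
  rewrite big_opt /= big_opt /= [X in _ + X](eq_bigr (fun j =>
    c j * x * overlap (a j) (b j) al be +
    \sum_j' c j * c j' * overlap (a j) (b j) (a j') (b j'))); last first.
    by move=> j _; rewrite big_opt.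
  have ov0 : overlap al be al be = be - al.
    by rewrite /overlap minxx maxxx max_r// subr_ge0.
  have ovN j : overlap al be (a j) (b j) = b j - a j.
    have [h1 h2 h3] := ab j.
    by rewrite /overlap min_r// max_r// max_r// subr_ge0.
  rewrite ov0 big_split /= -/V.
  have -> : \sum_j x * c j * overlap al be (a j) (b j) = x * S.
    by rewrite mulr_sumr; apply: eq_bigr => j _; rewrite ovN mulrA.
  have -> : \sum_j c j * x * overlap (a j) (b j) al be = x * S.
    by rewrite mulr_sumr; apply: eq_bigr => j _; rewrite overlapC ovN; ring.
  by congr (_ <= _); ring.
have [E|NE] := eqVneq al be.
  rewrite (_ : S = 0) ?expr0n ?mulr_ge0 ?subr_ge0 //=.
    by have := H 0; rewrite expr0n/= mulr0 !mul0r !addr0.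
  apply: big1 => j _; have [h1 h2 h3] := ab j.
  by rewrite (_ : b j = a j) ?subrr ?mulr0//; apply/eqP; rewrite eq_le; apply/andP; split; lra.
have L0 : 0 < be - al by rewrite subr_gt0 lt_neqAle NE.
have := H (- S / (be - al)).
have -> : V + 2 * (- S / (be - al)) * S + (- S / (be - al)) ^+ 2 * (be - al) =
    ((be - al) * V - S ^+ 2) / (be - al) by field; rewrite gt_eqF.
by rewrite pmulr_lge0 ?invr_gt0// subr_ge0.
Qed.

End overlap.

Section isometry.
Context (R : realType) (d : measure_display) (Omega : measurableType d)
  (P : probability Omega R) (T : R) (F : R -> set_system Omega) (m : nat)
  (f : 'I_m -> R -> Omega -> R).
Hypotheses (hF : filtration T F) (hf : wiener_process P T F f).
Notation mu := (@lebesgue_measure R).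
Notation dw i a b := (fun w => integrator f i b w - integrator f i a w).

Lemma integratorE0 s w : integrator f ord0 s w = s.
Proof. by rewrite /integrator unlift_none. Qed.

Lemma integratorE r s w : integrator f (lift ord0 r) s w = f r s w.
Proof. by rewrite /integrator liftK. Qed.

Lemma integratorP (i : 'I_m.+1) : i = ord0 \/ exists r, i = lift ord0 r.
Proof. by case: (unliftP ord0 i) => [r ->|->]; [right; exists r|left]. Qed.

Lemma integrator_adapted i s u : 0 <= s -> s <= u -> u <= T ->
  adapted_to (F u) (integrator f i s).
Proof.
move=> s0 su uT; have [->|[r ->]] := integratorP i.
  rewrite (_ : integrator _ _ _ = cst s).
    by apply: adapted_cst; apply: (filtration_sa hF) => //; exact: le_trans su.
  by apply/funext => w; rewrite integratorE0.
rewrite (_ : integrator _ _ _ = f r s); last by apply/funext => w; rewrite integratorE.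
exact: (wiener_adapted_le hF hf).
Qed.

Lemma dw_adapted i a b u : 0 <= a -> a <= b -> b <= u -> u <= T ->
  adapted_to (F u) (dw i a b).
Proof.
move=> a0 ab bu uT; have u0 : 0 <= u by rewrite (le_trans a0)// (le_trans ab).
apply: adaptedB; first exact: (filtration_sa hF).
  by apply: integrator_adapted => //; exact: le_trans ab.
by apply: integrator_adapted => //; exact: le_trans bu.
Qed.

Section wiener_terms.
Variable r : 'I_m.
Notation df a b := (fun w => f r b w - f r a w).

Lemma L2_mul_df (eta : Omega -> R) a b : 0 <= a -> a <= b -> b <= T ->
  (a < b -> adapted_to (F a) eta) -> L2 P eta -> L2 P (fun w => eta w * df a b w).
Proof.
move=> a0; rewrite le_eqVlt => /predU1P[<- _ _ Le|ab bT ae Le].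
  rewrite (_ : (fun w => _) = (fun=> 0)); first exact: L2_0.
  by apply/funext => w; rewrite subrr mulr0.
have aa := ae ab; have aT : a <= T by exact: le_trans (ltW ab) bT.
split.
  apply: measurable_funM; first by case: Le.
  exact: (measurable_increment hF hf a0 ab bT).
have [] := @mul_increment2 _ _ _ P T F m f hF hf a b a0 ab bT r (fun w => eta w ^+ 2).
- by apply: (adapted_comp (filtration_sa hF a0 aT) (h := fun x => x ^+ 2)) => //;
    exact: exprn_measurable.
- by case: Le.
- move=> H _; move: H; apply: eq_integrable => // w _.
  by rewrite /= /increment exprMn.
Qed.

(** The later increment is centred and independent of the other factors. *)
Lemma ip_df_orth (eta eta' : Omega -> R) a b c e : 0 <= a -> a <= b -> b <= c ->
  c <= e -> e <= T -> (a < b -> adapted_to (F a) eta) -> (c < e -> adapted_to (F c) eta') ->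
  L2 P eta -> L2 P eta' ->
  ip P (fun w => eta w * df a b w) (fun w => eta' w * df c e w) = 0.
Proof.
move=> a0 ab bc; rewrite le_eqVlt => /predU1P[<- _ _ _ _ _|ce eT ae ae' Le Le'].
  by rewrite /ip; under eq_Rintegral do rewrite subrr !mulr0; rewrite Rint_cst.
have [eab|nab] := eqVneq a b.
  rewrite -eab; rewrite /ip; under eq_Rintegral do rewrite subrr mulr0 mul0r.
  by rewrite Rint_cst.
have ab' : a < b by rewrite lt_neqAle nab.
have c0 : 0 <= c by rewrite (le_trans a0)// (le_trans ab).
have cT : c <= T by exact: le_trans (ltW ce) eT.
have L1 : L2 P (fun w => eta w * df a b w).
  by apply: L2_mul_df => //; exact: le_trans bc cT.
have sG := filtration_sa hF c0 cT.
have [] := @mul_increment0 _ _ _ P T F m f hF hf c e c0 ce eT r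
  (fun w => eta w * df a b w * eta' w).
- apply: adaptedM => //; last exact: ae'.
  apply: adaptedM => //.
    by apply: (filtrationS hF a0) (ae ab') => //; exact: le_trans bc.
  apply: adaptedB => //; apply: (wiener_adapted_le hF hf) => //.
    exact: le_trans ab.
  exact: le_trans bc.
- exact: L2M_integrable.
- move=> _ <-; apply: eq_Rintegral => w _; rewrite /increment; ring.
Qed.

Lemma ip_df_same (eta eta' : Omega -> R) a b : 0 <= a -> a <= b -> b <= T ->
  (a < b -> adapted_to (F a) eta) -> (a < b -> adapted_to (F a) eta') ->
  L2 P eta -> L2 P eta' ->
  ip P (fun w => eta w * df a b w) (fun w => eta' w * df a b w) =
  ip P eta eta' * (b - a).
Proof.
move=> a0; rewrite le_eqVlt => /predU1P[<- _ _ _ _ _|ab bT ae ae' Le Le'].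
  rewrite subrr mulr0 /ip; under eq_Rintegral do rewrite subrr mulr0 mul0r.
  by rewrite Rint_cst.
have aT : a <= T by exact: le_trans (ltW ab) bT.
have [] := @mul_increment2 _ _ _ P T F m f hF hf a b a0 ab bT r
  (fun w => eta w * eta' w).
- by apply: (adaptedM (filtration_sa hF a0 aT)); [exact: ae|exact: ae'].
- exact: L2M_integrable.
- move=> _ <-; apply: eq_Rintegral => w _; rewrite /increment; ring.
Qed.

(** Cut both intervals at a' and at the smaller end point: the resulting
    pieces are pairwise equal or ordered, and only the common piece
    contributes. *)
Let ip_df_overlap (eta eta' : Omega -> R) a b a' b' : 0 <= a -> a <= b -> b <= T ->
  a <= a' -> a' <= b' -> b' <= T ->
  (a < b -> adapted_to (F a) eta) -> (a' < b' -> adapted_to (F a') eta') ->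
  L2 P eta -> L2 P eta' ->
  ip P (fun w => eta w * df a b w) (fun w => eta' w * df a' b' w) =
  ip P eta eta' * overlap a b a' b'.
Proof.
move=> a0 ab bT aa' a'b' b'T ae ae' Le Le'.
have [ba'|a'b] := leP b a'.
  rewrite (@ip_df_orth eta eta' a b a' b')//.
  rewrite /overlap max_l ?mulr0// subr_le0 (max_r aa').
  by rewrite ge_min ba'.
have ab' : a < b by exact: le_lt_trans a'b.
have a'0 : 0 <= a' by exact: le_trans aa'.
have aea' : adapted_to (F a') eta.
  by apply: (filtrationS hF a0 aa') (ae ab'); exact: le_trans a'b' b'T.
have [e1|na'] := eqVneq a' b'.
  rewrite -e1 /overlap max_l; last first.
    rewrite subr_le0 (@le_trans _ _ a')//; first by rewrite ge_min lexx orbT.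
    by rewrite le_max lexx orbT.
  rewrite mulr0 /ip; under eq_Rintegral do rewrite subrr !mulr0.
  by rewrite Rint_cst.
have a'b'2 : a' < b' by rewrite lt_neqAle na'.
pose c := Num.min b b'.
have a'c : a' <= c by rewrite le_min (ltW a'b) a'b'.
have cb : c <= b by rewrite ge_min lexx.
have cb' : c <= b' by rewrite ge_min lexx orbT.
have cT : c <= T by exact: le_trans cb bT.
have c0 : 0 <= c by exact: le_trans a'c.
have aec : adapted_to (F c) eta by apply: (filtrationS hF a'0 a'c cT) aea'.
have ae'c : adapted_to (F c) eta' by apply: (filtrationS hF a'0 a'c cT) (ae' a'b'2).
have L0 : L2 P (fun w => eta w * df a a' w).
  by apply: L2_mul_df => //; [exact: le_trans a'c cT|move=> _; exact: ae].
have L1 : L2 P (fun w => eta w * df a' c w) by apply: L2_mul_df.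
have L2' : L2 P (fun w => eta w * df c b w) by apply: L2_mul_df.
have L1' : L2 P (fun w => eta' w * df a' c w) by apply: L2_mul_df => // _; exact: ae'.
have L2'' : L2 P (fun w => eta' w * df c b' w) by apply: L2_mul_df.
rewrite (@eq_ip _ _ _ _ _ (fun w => eta w * df a a' w + eta w * df a' c w +
   eta w * df c b w) _ (fun w => eta' w * df a' c w + eta' w * df c b' w));
  [|by move=> w; ring|by move=> w; ring].
rewrite ipC !ipDl//; [|by repeat apply: L2D..].
rewrite ![ip P _ (fun w => _ + _)]ipC !ipDl//; [|by repeat apply: L2D..].
have o1 := @ip_df_orth eta eta' a a' a' c a0 aa' (lexx _) a'c cT (fun _ => ae ab') (fun _ => ae' a'b'2) Le Le'.
have o2 := @ip_df_orth eta eta' a a' c b' a0 aa' a'c cb' b'T (fun _ => ae ab') (fun _ => ae'c) Le Le'.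
have o3 := @ip_df_orth eta eta' a' c c b' a'0 a'c (lexx _) cb' b'T (fun _ => aea') (fun _ => ae'c) Le Le'.
have o4 := @ip_df_orth eta' eta a' c c b a'0 a'c (lexx _) cb bT (fun _ => ae' a'b'2) (fun _ => aec) Le' Le.
have s1 := @ip_df_same eta eta' a' c a'0 a'c cT (fun _ => aea') (fun _ => ae' a'b'2) Le Le'.
have z1 : ip P (fun w => eta w * df c b w) (fun w => eta' w * df c b' w) = 0.
  have [bb'|bb'] := leP b b'.
    have -> : c = b by rewrite /c min_l.
    rewrite /ip; under eq_Rintegral do rewrite subrr mulr0 mul0r.
    by rewrite Rint_cst.
  have -> : c = b' by rewrite /c min_r// ltW.
  rewrite /ip; under eq_Rintegral do rewrite subrr !mulr0.
  by rewrite Rint_cst.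
have -> : overlap a b a' b' = c - a'.
  by rewrite /overlap (max_r aa') -/c max_r// subr_ge0.
rewrite o1 o2 o3 s1 z1 (ipC _ (fun w => eta w * df c b w)) o4; ring.
Qed.

Lemma wiener_isometry (eta eta' : Omega -> R) a b a' b' : 0 <= a -> a <= b -> b <= T ->
  0 <= a' -> a' <= b' -> b' <= T ->
  (a < b -> adapted_to (F a) eta) -> (a' < b' -> adapted_to (F a') eta') ->
  L2 P eta -> L2 P eta' ->
  ip P (fun w => eta w * df a b w) (fun w => eta' w * df a' b' w) =
  ip P eta eta' * overlap a b a' b'.
Proof.
move=> a0 ab bT a'0 a'b' b'T ae ae' Le Le'.
have [aa'|/ltW a'a] := leP a a'; first exact: ip_df_overlap.
by rewrite ipC (ip_df_overlap a'0)// ipC overlapC.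
Qed.

End wiener_terms.

Hypothesis T0 : 0 <= T.

(** Large enough for both kinds of integrator: 1 suffices for a Wiener process
    and T for the time. *)
Definition ito_const : R := 1 + T.

Lemma ito_const_ge0 : 0 <= ito_const. Proof. by rewrite addr_ge0. Qed.

Section terms.
Variables (I : finType) (eta : I -> Omega -> R) (a b : I -> R) (al be : R).
Hypotheses (al0 : 0 <= al) (albe : al <= be) (beT : be <= T).
Hypothesis ab : forall j, [/\ al <= a j, a j <= b j & b j <= be].
Hypothesis aeta : forall j, a j < b j -> adapted_to (F (a j)) (eta j).
Hypothesis Leta : forall j, L2 P (eta j).

Lemma L2_mul_dw i j : L2 P (fun w => eta j w * dw i (a j) (b j) w).
Proof.
have [h1 h2 h3] := ab j.
have [->|[r ->]] := integratorP i.
  rewrite (_ : (fun w => _) = (fun w => (b j - a j) * eta j w)); first exact: L2Z.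
  by apply/funext => w; rewrite !integratorE0 mulrC.
rewrite (_ : (fun w => _) = (fun w => eta j w * (f r (b j) w - f r (a j) w))).
  by apply: L2_mul_df; [exact: le_trans h1| |exact: le_trans h3 beT|exact: aeta|].
by apply/funext => w; rewrite !integratorE.
Qed.

Lemma L2_ito i : L2 P (fun w => \sum_j eta j w * dw i (a j) (b j) w).
Proof. by apply: L2_sum => j _; exact: L2_mul_dw. Qed.

Let quad : R := \sum_j \sum_j' ip P (eta j) (eta j') * overlap (a j) (b j) (a j') (b j').

Let quadE : mu.-integrable `[al, be[ (EFin \o (fun v =>
    sqnorm P (fun w => \sum_j eta j w * \1_`[a j, b j[ v))) /\
  \int[mu]_(v in `[al, be[)
    sqnorm P (fun w => \sum_j eta j w * \1_`[a j, b j[ v) = quad.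
Proof.
have abb j : al <= a j /\ b j <= be by have [] := ab j.
have -> : (fun v => sqnorm P (fun w => \sum_j eta j w * \1_`[a j, b j[ v)) =
   (fun v => \sum_j \sum_j' ip P (eta j) (eta j') * (\1_`[a j, b j[ v * \1_`[a j', b j'[ v)).
  apply/funext => v; rewrite ip_sum2.
  - apply: eq_bigr => j _; apply: eq_bigr => j' _.
    rewrite (@eq_ip _ _ _ _ _ (fun w => \1_`[a j, b j[ v * eta j w) _
      (fun w => \1_`[a j', b j'[ v * eta j' w)); [|by move=> w; rewrite mulrC..].
    rewrite ipZl//; last exact: L2Z.
    by rewrite ipC ipZl// ipC; ring.
  - by move=> j; apply: L2_ext (L2Z (\1_`[a j, b j[ v) (Leta j)) => w; rewrite mulrC.
  - by move=> j; apply: L2_ext (L2Z (\1_`[a j, b j[ v) (Leta j)) => w; rewrite mulrC.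
exact: (integral_quad_overlap (fun j j' => ip P (eta j) (eta j')) abb).
Qed.

Let quad_ge0 : 0 <= quad.
Proof. by rewrite -quadE.2; apply: Rintegral_ge0 => v _; exact: ip_ge0. Qed.

Lemma integrable_step : mu.-integrable `[al, be[ (EFin \o (fun v =>
    sqnorm P (fun w => \sum_j eta j w * \1_`[a j, b j[ v))).
Proof. exact: quadE.1. Qed.

(** Itô's isometry for possibly overlapping steps, as an inequality that also
    covers integration in time. Overlaps are allowed so that it applies to
    differences of step integrals on unrelated partitions. *)
Lemma ito_le i :
  sqnorm P (fun w => \sum_j eta j w * dw i (a j) (b j) w) <=
  ito_const * \int[mu]_(v in `[al, be[)
    sqnorm P (fun w => \sum_j eta j w * \1_`[a j, b j[ v).
Proof.
rewrite quadE.2.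
have [->|[r ->]] := integratorP i; last first.
  rewrite ip_sum2; [|by move=> j; exact: L2_mul_dw..].
  apply: (@le_trans _ _ quad); last first.
    by rewrite ler_peMl// /ito_const lerDl.
  apply: le_of_eq.
  apply: eq_bigr => j _; apply: eq_bigr => j' _.
  have [h1 h2 h3] := ab j; have [h1' h2' h3'] := ab j'.
  rewrite -(@wiener_isometry r).
  - by apply: eq_ip => w; rewrite !integratorE.
  - exact: le_trans h1.
  - by [].
  - exact: le_trans h3 beT.
  - exact: le_trans h1'.
  - by [].
  - exact: le_trans h3' beT.
  - exact: aeta.
  - exact: aeta.
  - exact: Leta.
  - exact: Leta.
apply: (@le_trans _ _ ((be - al) * quad)); last first.
  rewrite ler_wpM2r// /ito_const (@le_trans _ _ T)// ?lerDr//.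
  by rewrite lerBlDr (le_trans beT)// lerDl.
have i1 j j' : P.-integrable setT (EFin \o (fun w =>
    eta j w * eta j' w * overlap (a j) (b j) (a j') (b j'))).
  have := integrableZl measurableT (overlap (a j) (b j) (a j') (b j'))
    (L2M_integrable (Leta j) (Leta j')).
  by apply: eq_integrable => // w _; rewrite /= -EFinM mulrC.
have i2 j := Rint_sum_in (index_enum I) measurableT (i1 j).
have [i3 e3] := Rint_sum_in (index_enum I) measurableT (fun j => (i2 j).1).
have -> : quad = \int[P]_w (\sum_j \sum_j' eta j w * eta j' w *
    overlap (a j) (b j) (a j') (b j')).
  rewrite e3; apply: eq_bigr => j _; rewrite (i2 j).2; apply: eq_bigr => j' _.
  by rewrite RintegralZr//; exact: L2M_integrable.
rewrite -RintegralZl//; apply: le_Rintegral => //.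
- by apply: L2M_integrable; exact: L2_ito.
- by have := integrableZl measurableT (be - al) i3; exact: eq_integrable.
- move=> w _; have := time_sqr_le (fun j => eta j w) albe ab.
  rewrite expr2; apply: le_trans; apply: le_of_eq.
  by congr (_ * _); apply: eq_bigr => j _; rewrite !integratorE0.
Qed.

Lemma ito_le_cst i e :
  (forall v, al <= v -> v < be ->
    sqnorm P (fun w => \sum_j eta j w * \1_`[a j, b j[ v) <= e) ->
  sqnorm P (fun w => \sum_j eta j w * dw i (a j) (b j) w) <=
  ito_const * (e * (be - al)).
Proof.
move=> He; apply: le_trans (ito_le i) _; rewrite ler_wpM2l ?ito_const_ge0//.
have mI : measurable (`[al, be[ : set (measurableTypeR R)) by exact: measurable_itv.
have E : \int[mu]_(v in `[al, be[) e = e * (be - al).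
  rewrite Rintegral_cst//= lebesgue_measure_itv/= lte_fin.
  case: ltP => [_|H]; first by rewrite -EFinB.
  by rewrite (_ : be - al = 0) ?mulr0//; apply/eqP; rewrite subr_eq0 eq_le H albe.
rewrite -E; apply: le_Rintegral => //; first exact: integrable_step.
  apply: measurable_bounded_integrable => //; last first.
    by exists `|e|; split => // x xe v _ /=; exact: ltW.
  by rewrite /= lebesgue_measure_itv/=; case: ifP => _; rewrite ?ltry.
by move=> v /=; rewrite in_itv/= => /andP[]; exact: He.
Qed.

End terms.

End isometry.

(** * Approximation of a stochastic integral by step integrals *)

Section compact_continuity.
Context (R : realType) (a b : R) (g : R -> R).
Hypothesis cg : {within `[a, b], continuous g}.

(** The Heine-Cantor theorem on [a, b]. *)
Lemma within_unif_continuous (e : R) : 0 < e -> exists2 r, 0 < r &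
  forall x y, a <= x <= b -> a <= y <= b -> `|x - y| <= r -> `|g x - g y| <= e.
Proof.
move=> e0; have e2 : 0 < e / 2 by rewrite divr_gt0.
pose Q (r x : R) := a <= x <= b -> forall y, a <= y <= b -> `|x - y| <= r -> `|g x - g y| <= e.
have /compact_near_coveringP/(_ R (0^'+) Q _) : compact (`[a, b] : set R).
  exact: segment_compact.
case.
  move=> x /=; rewrite in_itv/= => xab.
  have /subspace_continuousP/(_ x) := cg; rewrite /= in_itv/= => /(_ xab).
  move=> /cvgrPdist_le/(_ _ e2)/nbhs_ballP[r /= r0 Hr].
  have r2 : 0 < r / 2 by rewrite divr_gt0.
  near=> x' r'.
  have rr : r' <= r / 2 by near: r'; apply: nbhs_right_le.
  move=> x'ab y yab x'y.
  have xx' : `|x - x'| < r / 2 by near: x'; apply/nbhs_ballP; exists (r / 2).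
  have xy : ball x r y.
    rewrite /ball /= (le_lt_trans (ler_distD x' _ _))// (splitr r) ltr_leD//.
    exact: le_trans x'y rr.
  have xx'2 : ball x r x'.
    by rewrite /ball /= (lt_le_trans xx')// ler_pdivrMr// mulr2n mulrDr mulr1 lerDl ltW.
  have h1 : `|g x - g x'| <= e / 2 by apply: Hr => //; rewrite /= in_itv.
  have h2 : `|g x - g y| <= e / 2 by apply: Hr => //; rewrite /= in_itv.
  rewrite (le_trans (ler_distD (g x) _ _))// (splitr e) lerD// distrC//.
move=> r /= r0 H.
exists (r / 2); first by rewrite divr_gt0.
have HQ : `[a, b] `<=` Q (r / 2).
  apply: H => /=; last by rewrite divr_gt0.
  by rewrite sub0r normrN gtr0_norm ?divr_gt0// ltr_pdivrMr// ltr_pMr// ltr1n.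
by move=> x y xab yab xy; apply: (HQ x).
Unshelve. all: by end_near.
Qed.

Lemma within_bounded : exists2 C, 0 <= C & forall x, a <= x <= b -> `|g x| <= C.
Proof.
have /compact_bounded[M [_ HM]] : compact (g @` `[a, b]).
  by apply: continuous_compact => //; exact: segment_compact.
exists (`|M| + 1); first by rewrite addr_ge0.
move=> x xab; apply: (HM (`|M| + 1)).
  by rewrite (le_lt_trans (ler_norm _))// ltrDl.
by exists x => //=; rewrite in_itv.
Qed.

End compact_continuity.

Section approximation.
Context (R : realType) (d : measure_display) (Omega : measurableType d)
  (P : probability Omega R).
Notation mu := (@lebesgue_measure R).

Lemma measurable_mean_square (a b : R) (g : R -> Omega -> R) :
  measurable_fun (`[a, b] `*` setT) (fun p : R * Omega => g p.1 p.2) ->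
  measurable_fun `[a, b] (fun v => mean_square P (g v)).
Proof.
move=> mg.
have mD : measurable (`[a, b] `*` setT : set (measurableTypeR R * Omega)).
  by apply: measurableX => //; exact: measurable_itv.
pose h : R * Omega -> \bar R := (fun p => (g p.1 p.2 ^+ 2)%:E) \_ (`[a, b] `*` setT).
have mh : measurable_fun setT h.
  apply/(measurable_restrictT _ mD)/measurable_EFinP.
  exact: measurable_funX.
have h0 p : (0 <= h p)%E.
  by rewrite /h patchE; case: ifP => // _; rewrite lee_fin sqr_ge0.
have := @measurable_fun_fubini_tonelli_F _ _ _ _ _ P _ mh h0.
move=> /(measurable_funS measurableT (@subsetT _ `[a, b])).
apply: eq_measurable_fun => v; rewrite inE => vab.
rewrite mean_squareE /fubini_F; apply: eq_integral => w _.
by rewrite /h patchE ifT// inE.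
Qed.

End approximation.

Lemma partition_le (R : realType) (a b : R) n (s : nat -> R) : is_partition a b n s ->
  forall i j, (i <= j <= n)%N -> s i <= s j.
Proof.
move=> [_ _ hs] i j /andP[+ +]; elim: j => [|j ih].
  by rewrite leqn0 => /eqP ->.
rewrite leq_eqVlt => /predU1P[-> //|ij jn].
by apply: le_trans (ltW (hs j jn)); apply: ih => //; exact: ltnW.
Qed.

Lemma partition_bounds (R : realType) (a b : R) n (s : nat -> R) : is_partition a b n s ->
  forall i, (i <= n)%N -> a <= s i <= b.
Proof.
move=> hs i i_n; have [s0 sn _] := hs.
by rewrite -{1}s0 -sn !(partition_le hs) ?i_n ?leqnn.
Qed.

Lemma partition_cell_bounds (R : realType) (a b : R) n (s : nat -> R) :
  is_partition a b n s ->
  forall j : 'I_n, [/\ a <= s j, s j <= s j.+1 & s j.+1 <= b].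
Proof.
move=> hs j; have /andP[h1 _] := partition_bounds hs (ltnW (ltn_ord j)).
have /andP[_ h2] := partition_bounds hs (ltn_ord j).
by split => //; apply: (partition_le hs); rewrite leqnSn ltn_ord.
Qed.

Section ito_approx.
Context (R : realType) (d : measure_display) (Omega : measurableType d)
  (P : probability Omega R) (T : R) (F : R -> set_system Omega) (m : nat)
  (f : 'I_m -> R -> Omega -> R).
Hypotheses (hF : filtration T F) (hf : wiener_process P T F f) (T0 : 0 <= T).
Notation mu := (@lebesgue_measure R).
Notation dw i a b := (fun w => integrator f i b w - integrator f i a w).

Lemma measurable_step (n : nat) (s : nat -> R) (eta : nat -> Omega -> R) (a b : R) :
  (forall j, (j < n)%N -> measurable_fun setT (eta j)) ->
  measurable_fun (`[a, b] `*` setT) (fun p : R * Omega => step_process n s eta p.1 p.2).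
Proof.
move=> meta; apply: measurable_funTS; rewrite /step_process.
apply: measurable_sum => j; apply: measurable_funM.
  by apply: measurableT_comp measurable_snd; exact: meta.
by apply: measurableT_comp measurable_fst; exact: measurable_indic.
Qed.

Variables (I : finType) (eta : I -> Omega -> R) (a b : I -> R) (al be : R).
Hypotheses (al0 : 0 <= al) (albe : al <= be) (beT : be <= T).
Hypothesis ab : forall j, [/\ al <= a j, a j <= b j & b j <= be].
Hypothesis aeta : forall j, a j < b j -> adapted_to (F (a j)) (eta j).
Hypothesis Leta : forall j, L2 P (eta j).
Variables (i : 'I_m.+1) (xi : R -> Omega -> R) (X : Omega -> R).
Hypothesis hX : is_ito_integral P F (integrator f i) al be xi X.

Lemma ito_integral_L2 : L2 P X.
Proof. by case: hX => _ [n [s [e [_ _ _ [/square_integrableP]]]]]. Qed.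

Let xi_L2 v : al <= v <= be -> L2 P (xi v).
Proof. by move=> vab; apply/square_integrableP; case: hX => -[_ _ h _] _; exact: h. Qed.

(** The defining step processes may be compared with any other step process,
    so an integral is close to the step integrals whose integrand is close. *)
Lemma ito_approx (e : R) : 0 <= e ->
  (forall v, al <= v -> v < be -> sqnorm P (fun w => \sum_j eta j w * \1_`[a j, b j[ v - xi v w) <= e) ->
  sqnorm P (fun w => X w - \sum_j eta j w * dw i (a j) (b j) w) <=
  4 * ito_const T * (e * (be - al)).
Proof.
move=> e0 He.
have [M [n [s [h [hs hh D0 hXlim]]]]] := hX.
have C0 : 0 <= ito_const T by exact: ito_const_ge0.
have step_L2 v : L2 P (fun w => \sum_j eta j w * \1_`[a j, b j[ v).
  by apply: L2_sum => j _; apply: L2_ext (L2Z (\1_`[a j, b j[ v) (Leta j)) => w; rewrite mulrC.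
have h_L2 N j : (j < n N)%N -> L2 P (h N j).
  by move=> jn; apply/square_integrableP; have [] := hh N j jn.
have steph_L2 N v : L2 P (step_process (n N) (s N) (h N) v).
  apply: L2_sum => j _.
  by apply: L2_ext (L2Z (\1_`[s N j, s N j.+1[ v) (h_L2 N j _)) => // w; rewrite mulrC.
pose D N := (\int[mu]_(u in `[al, be]) mean_square P (fun w => step_process (n N) (s N) (h N) u w - xi u w)%R)%E.
pose S N := step_integral (integrator f i) (n N) (s N) (h N).
pose eta2 N (o : 'I_(n N) + I) := match o with inl j => h N j | inr j => (fun w => - eta j w) end.
pose a2 N (o : 'I_(n N) + I) := match o with inl j => s N j | inr j => a j end.
pose b2 N (o : 'I_(n N) + I) := match o with inl j => s N j.+1 | inr j => b j end.
have ab2 N o : [/\ al <= a2 N o, a2 N o <= b2 N o & b2 N o <= be].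
  by case: o => [j|j] /=; [exact: partition_cell_bounds|exact: ab].
have aeta2 N o : a2 N o < b2 N o -> adapted_to (F (a2 N o)) (eta2 N o).
  case: o => [j _|j] /=; first by have [] := hh N j (ltn_ord j).
  move=> /aeta h1; rewrite (_ : (fun w => _) = (fun w => -1 * eta j w)).
    have [h2 h3 h4] := ab j; apply: adaptedZ => //.
    apply: (filtration_sa hF); first exact: le_trans h2.
    by apply: le_trans beT; exact: le_trans h4.
  by apply/funext => w; rewrite mulN1r.
have Leta2 N o : L2 P (eta2 N o).
  by case: o => j /=; [exact: h_L2|exact: L2N].
have LS N : L2 P (S N).
  have := @L2_ito _ _ _ P T F m f hF hf _ (fun j : 'I_(n N) => h N j) (fun j => s N j)
    (fun j => s N j.+1) al be al0 beT (fun j => ab2 N (inl j)) (fun j => aeta2 N (inl j))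
    (fun j => Leta2 N (inl j)) i.
  exact.
have LY : L2 P (fun w => \sum_j eta j w * dw i (a j) (b j) w).
  exact: (@L2_ito _ _ _ P T F m f hF hf _ eta a b al be).
have LX := ito_integral_L2.
have mI : measurable (`[al, be[ : set (measurableTypeR R)) by exact: measurable_itv.
have mIc : measurable (`[al, be] : set (measurableTypeR R)) by exact: measurable_itv.
have mms N : measurable_fun (`[al, be] : set (measurableTypeR R)) (fun u => mean_square P
    (fun w => step_process (n N) (s N) (h N) u w - xi u w)).
  apply: (@measurable_mean_square _ _ _ P al be (fun u w => step_process (n N) (s N) (h N) u w - xi u w)).
  apply: measurable_funB; last by case: M.
  by apply: measurable_step => j jn; exact: L2_measurable (h_L2 _ _ jn).
have sub : (`[al, be[ : set (measurableTypeR R)) `<=` `[al, be].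
  by move=> x /=; rewrite !in_itv/= => /andP[-> /ltW].
have mmso N := measurable_funS mIc sub (mms N).
have ms0 N u : (0 <= mean_square P (fun w => step_process (n N) (s N) (h N) u w - xi u w)%R)%E.
  by rewrite mean_squareE integral_ge0// => w _; rewrite lee_fin sqr_ge0.
have key N c : (D N <= c%:E)%E ->
    sqnorm P (fun w => S N w - \sum_j eta j w * dw i (a j) (b j) w) <=
    ito_const T * (2 * c + 2 * (e * (be - al))).
  move=> Dc.
  have := @ito_le _ _ _ P T F m f hF hf T0 _ (eta2 N) (a2 N) (b2 N) al be al0 albe beT
    (ab2 N) (@aeta2 N) (Leta2 N) i.
  have := @integrable_step _ _ _ P _ (eta2 N) (a2 N) (b2 N) al be (ab2 N) (Leta2 N).
  have st v : (fun w => \sum_o eta2 N o w * \1_`[a2 N o, b2 N o[ v) =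
      (fun w => step_process (n N) (s N) (h N) v w - \sum_j eta j w * \1_`[a j, b j[ v).
    apply/funext => w; rewrite big_sumType/= -sumrN; congr (_ + _).
    by apply: eq_bigr => j _; rewrite mulNr.
  under [X in EFin \o X]eq_fun do rewrite st.
  under eq_Rintegral do rewrite st.
  set g := (fun v => ip P _ _) => ig.
  rewrite (@eq_ip _ _ _ _ _ (fun w => S N w - \sum_j eta j w * dw i (a j) (b j) w) _
     (fun w => S N w - \sum_j eta j w * dw i (a j) (b j) w)); last 2 first.
    by move=> w; rewrite big_sumType/= -sumrN; congr (_ + _);
      apply: eq_bigr => j _; rewrite mulNr.
    by move=> w; rewrite big_sumType/= -sumrN; congr (_ + _);
      apply: eq_bigr => j _; rewrite mulNr.
  move/le_trans; apply; rewrite ler_wpM2l//.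
  rewrite -lee_fin fineK; last exact: integrable_fin_num.
  apply: (@le_trans _ _ (\int[mu]_(v in `[al, be[) (2%:E * mean_square P
      (fun w => step_process (n N) (s N) (h N) v w - xi v w)%R + (2 * e)%:E))%E).
    apply: ge0_le_integral => //.
    - by move=> v _; rewrite lee_fin ip_ge0.
    - exact: measurable_int ig.
    - apply: emeasurable_funD => //; apply: measurable_funeM.
      exact: mmso.
    - move=> v /=; rewrite in_itv/= => /andP[av vb].
      have Lxi : L2 P (xi v) by apply: xi_L2; rewrite av ltW.
      rewrite L2_mean_square ?lee_fin; last exact: L2B.
      have := ipD_le (L2B (steph_L2 N v) Lxi) (L2B Lxi (step_L2 v)).
      rewrite (@eq_ip _ _ _ _ _ (fun w => step_process (n N) (s N) (h N) v w -
        \sum_j eta j w * \1_`[a j, b j[ v) _ (fun w => step_process (n N) (s N) (h N) v w -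
        \sum_j eta j w * \1_`[a j, b j[ v));
        [|by move=> w; rewrite addrA subrK..].
      rewrite (ipBC _ (xi v)) => /le_trans; apply.
      by rewrite mulrDr lerD2l ler_wpM2l//; exact: He.
  rewrite ge0_integralD//; last 3 first.
  - by move=> v _; rewrite mule_ge0// lee_fin.
  - by apply: measurable_funeM; exact: mmso.
  - by move=> v _; rewrite lee_fin mulr_ge0.
  rewrite (EFinD (2 * c)); apply: leeD.
    rewrite (ge0_integralZl_EFin mu mI (fun v _ => ms0 N v) (mmso N))//.
    rewrite (EFinM 2 c) lee_wpmul2l ?lee_fin//; apply: le_trans Dc.
    exact: ge0_subset_integral.
  rewrite integral_cst//= lebesgue_measure_itv/= lte_fin.
  case: ltP => [_|H]; first by rewrite -EFinB -EFinM mulrA.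
  by rewrite mule0 lee_fin !mulr_ge0// subr_ge0.
apply/ler_addgt0Pr => e1 e1_0.
pose e2 := e1 / (2 + 4 * ito_const T).
have den0 : 0 < 2 + 4 * ito_const T by rewrite ltr_wpDr// mulr_ge0.
have e2_0 : 0 < e2 by rewrite divr_gt0.
have SX := (lim_mean_squareP LS LX).1 hXlim.
have : \forall N \near \oo, (D N <= e2%:E)%E.
  have /fine_cvgP[fD D0'] : D N @[N --> \oo] --> 0%E by exact: D0.
  have := D0' => /cvgr0_norm_le/(_ _ e2_0); apply: filterS2 fD => N fD.
  by rewrite /= -lee_fin => /(le_trans _); apply; rewrite -abse_EFin fineK// lee_abs.
move: SX => /cvgr0_norm_le/(_ _ e2_0) SX /(filterI SX).
move=> /filter_ex[N [SXN DN]].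
have Lk := key N _ DN.
have := ipD_le (L2B LX (LS N)) (L2B (LS N) LY).
rewrite (@eq_ip _ _ _ _ _ (fun w => X w - \sum_j eta j w * dw i (a j) (b j) w) _
  (fun w => X w - \sum_j eta j w * dw i (a j) (b j) w));
  [|by move=> w; rewrite addrA subrK..].
move=> /le_trans; apply.
have h1 : sqnorm P (fun w => X w - S N w) <= e2.
  by rewrite ipBC; apply: le_trans SXN; exact: ler_norm.
have -> : e1 = e2 * (2 + 4 * ito_const T) by rewrite /e2 divfK// gt_eqF.
by move: h1 Lk; nra.
Qed.

End ito_approx.

(** * Riemann sums of iterated integrals *)

Notation init g := (g \o widen_ord (leqnSn _)).

Section iterated_sums.
Context (R : realType) (d : measure_display) (Omega : measurableType d)
  (P : probability Omega R) (T : R) (F : R -> set_system Omega) (m : nat)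
  (f : 'I_m -> R -> Omega -> R).
Hypotheses (hF : filtration T F) (hf : wiener_process P T F f).
Variable t : R.
Hypotheses (t0 : 0 <= t) (tT : t <= T).
Notation dw i a b := (fun w => integrator f i b w - integrator f i a w).

Let T0 : 0 <= T := le_trans t0 tT.

(** The nodes are clamped at the upper limit v. Thus the sum is, as a function
    of v, the integral up to v of one step process, and its values at the
    nodes are the integrands of the next level. *)
Fixpoint iterated_sum (k : nat) : ('I_k -> 'I_m.+1) -> ('I_k -> R -> R) ->
    (nat -> R) -> nat -> R -> Omega -> R :=
  match k with
  | 0 => fun _ _ _ _ _ _ => 1
  | k'.+1 => fun i psi s n v w => \sum_(l < n)
      (psi ord_max (s l) * iterated_sum (init i)
        (init psi) s n (s l) w) *
      dw (i ord_max) (Num.min (s l) v) (Num.min (s l.+1) v) w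
  end.

Lemma partition_cell n s u : is_partition t T n s -> t <= u -> u < T ->
  exists l : 'I_n, s l <= u < s l.+1.
Proof.
move=> [s0 sn _] tu uT.
have ex : exists j, u < s j by exists n; rewrite sn.
have [[|j] uj minj] := ex_minnP ex.
  by move: uj; rewrite s0 ltNge tu.
have jn : (j < n)%N by apply: minj; rewrite sn.
exists (Ordinal jn); rewrite /= uj andbT leNgt; apply/negP => /minj.
by rewrite ltnn.
Qed.

(** The definition of the sums clamps the nodes at v from above; comparing
    values at two times clamps them from below as well. Neither changes the
    cell of a point between al and v. *)
Lemma indic_clamp (al x y u v : R) : al <= u -> u < v ->
  \1_`[Num.max al (Num.min x v), Num.max al (Num.min y v)[ u = \1_`[x, y[ u :> R.
Proof.
move=> alu uv; rewrite !indicE; congr (nat_of_bool _)%:R.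
apply/idP/idP; rewrite !inE /= !in_itv /= ge_max ge_min lt_max lt_min.
  by rewrite alu (leNgt v) uv orbF (ltNge u al) alu /= andbT.
by move=> /andP[-> ->]; rewrite alu uv !orbT.
Qed.

Lemma step_cell n s (eta : 'I_n -> R) (l : 'I_n) u : is_partition t T n s ->
  s l <= u < s l.+1 -> \sum_j eta j * \1_`[s j, s j.+1[ u = eta l.
Proof.
move=> hs /andP[sl ul]; rewrite (bigD1 l)//= big1 => [|j jl].
  by rewrite addr0 indicE mem_set/= ?in_itv/= ?sl ?ul// mulr1.
rewrite indicE memNset ?mulr0//= in_itv/= => /andP[sj uj].
move: jl; rewrite -val_eqE/= neq_ltn => /orP[jl|lj].
  have : s j.+1 <= s l by apply: (partition_le hs); rewrite jl ltnW.
  by move=> /le_trans/(_ sl); rewrite leNgt uj.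
have : s l.+1 <= s j by apply: (partition_le hs); rewrite lj ltnW.
by move=> /(lt_le_trans ul); rewrite ltNge sj.
Qed.

Section terms.
Variables (n : nat) (s : nat -> R) (eta : nat -> Omega -> R) (u v : R).
Hypotheses (hs : is_partition t T n s) (uv : u <= v) (vT : v <= T).
Hypothesis aeta : forall l, (l < n)%N -> adapted_to (F (s l)) (eta l).

Lemma clamp_bounds (j : 'I_n) : [/\ u <= Num.max u (Num.min (s j) v),
  Num.max u (Num.min (s j) v) <= Num.max u (Num.min (s j.+1) v) &
  Num.max u (Num.min (s j.+1) v) <= v].
Proof.
have sj : s j <= s j.+1 by apply: (partition_le hs); rewrite leqnSn ltn_ord.
split; first by rewrite le_max lexx.
  by rewrite ge_max le_max lexx/= le_max le_min !ge_min sj lexx !orbT.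
by rewrite ge_max uv ge_min lexx orbT.
Qed.

Lemma clamp_adapted (j : 'I_n) :
  Num.max u (Num.min (s j) v) < Num.max u (Num.min (s j.+1) v) ->
  adapted_to (F (Num.max u (Num.min (s j) v))) (eta j).
Proof.
move=> jlt; have [h1 h2 h3] := clamp_bounds j.
have /andP[tsj _] := partition_bounds hs (ltnW (ltn_ord j)).
apply: (filtrationS hF _ _ _ (aeta (ltn_ord j))).
- exact: le_trans tsj.
- have [sv|vs] := leP (s j) v; first by rewrite le_max lexx orbT.
  move: jlt; rewrite (min_r (ltW vs)) min_r ?ltxx// (le_trans (ltW vs))//.
  by apply: (partition_le hs); rewrite leqnSn ltn_ord.
- by apply: le_trans vT; exact: le_trans h3.
Qed.
End terms.

Lemma clampE (x v : R) : t <= x -> t <= v -> Num.max t (Num.min x v) = Num.min x v.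
Proof. by move=> tx tv; rewrite max_r// le_min tx. Qed.

Lemma clampB i x u v w : u <= v ->
  integrator f i (Num.min x v) w - integrator f i (Num.min x u) w =
  integrator f i (Num.max u (Num.min x v)) w - integrator f i u w.
Proof.
move=> uv; have [xu|ux] := leP x u.
  by rewrite min_l ?(le_trans xu)// max_l// !subrr.
by congr (_ - _); rewrite max_r// le_min uv ltW.
Qed.

Lemma iterated_sum_adapted k i psi n s v : is_partition t T n s -> t <= v <= T ->
  adapted_to (F v) (@iterated_sum k i psi s n v) /\ L2 P (@iterated_sum k i psi s n v).
Proof.
move=> hs; elim: k i psi v => [|k ih] i psi v /andP[tv vT].
  have v0 : 0 <= v by exact: le_trans tv.
  by split; [apply: adapted_cst; exact: (filtration_sa hF)|exact: L2_cst].
have sl l : (l < n)%N -> t <= s l <= T by move=> /ltnW; exact: partition_bounds.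
have sG := filtration_sa hF (le_trans t0 tv) vT.
pose eta l w := psi ord_max (s l) * iterated_sum (init i)
        (init psi) s n (s l) w.
have aeta l : (l < n)%N -> adapted_to (F (s l)) (eta l).
  move=> /sl tl; have [+ _] := ih (init i) (init psi) _ tl.
  apply: adaptedZ; have /andP[h1 h2] := tl.
  by apply: (filtration_sa hF) => //; exact: le_trans h1.
have Leta l : (l < n)%N -> L2 P (eta l).
  by move=> /sl tl; apply: L2Z; have [_] := ih (init i)
    (init psi) _ tl.
have E : iterated_sum i psi s n v = (fun w => \sum_(l < n) eta l w *
   dw (i ord_max) (Num.max t (Num.min (s l) v)) (Num.max t (Num.min (s l.+1) v)) w).
  apply/funext => w /=; apply: eq_bigr => l _.
  have /andP[h1 _] := sl _ (ltn_ord l).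
  have /andP[h2 _] := partition_bounds hs (ltn_ord l).
  by rewrite !clampE.
rewrite E; split.
  apply: (adapted_sum sG) => l.
  have [h1 h2 h3] := clamp_bounds hs tv l.
  have al0 : 0 <= Num.max t (Num.min (s l) v) by exact: le_trans h1.
  have [ll|ll] := ltP (Num.max t (Num.min (s l) v)) (Num.max t (Num.min (s l.+1) v)).
    apply: (adaptedM sG); last exact: (dw_adapted hF hf).
    apply: (filtrationS hF _ (le_trans h2 h3) vT) => //.
    exact: (clamp_adapted hs tv vT aeta).
  have -> : Num.max t (Num.min (s l.+1) v) = Num.max t (Num.min (s l) v).
    by apply/eqP; rewrite eq_le ll h2.
  rewrite (_ : (fun w => _) = cst 0); first exact: adapted_cst.
  by apply/funext => w; rewrite subrr mulr0.
apply: (@L2_ito _ _ _ P T F m f hF hf _ (fun l : 'I_n => eta l) _ _ t v) => //.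
- exact: clamp_bounds.
- by move=> l; exact: clamp_adapted.
- by move=> l; exact: Leta.
Qed.

Section succ.
Variables (k : nat) (i : 'I_k.+1 -> 'I_m.+1) (psi : 'I_k.+1 -> R -> R).
Let i' := init i.
Let psi' := init psi.

Let eta s n l w := psi ord_max (s l) * iterated_sum i' psi' s n (s l) w.

Let aeta n s : is_partition t T n s -> forall l, (l < n)%N -> adapted_to (F (s l)) (eta s n l).
Proof.
move=> hs l ln; have /andP[h1 h2] := partition_bounds hs (ltnW ln).
apply: adaptedZ; first by apply: (filtration_sa hF) => //; exact: le_trans h1.
by have [] := iterated_sum_adapted i' psi' hs (partition_bounds hs (ltnW ln)).
Qed.

Let Leta n s : is_partition t T n s -> forall l, (l < n)%N -> L2 P (eta s n l).
Proof.
move=> hs l ln; apply: L2Z.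
by have [] := iterated_sum_adapted i' psi' hs (partition_bounds hs (ltnW ln)).
Qed.

Lemma iterated_sumS n s v w : is_partition t T n s -> t <= v ->
  iterated_sum i psi s n v w = \sum_(l < n) eta s n l w *
   dw (i ord_max) (Num.max t (Num.min (s l) v)) (Num.max t (Num.min (s l.+1) v)) w.
Proof.
move=> hs tv; apply: eq_bigr => l _.
have /andP[h1 _] := partition_bounds hs (ltnW (ltn_ord l)).
have /andP[h2 _] := partition_bounds hs (ltn_ord l).
by rewrite !clampE.
Qed.

Lemma iterated_sum_incr_le e n s u v : is_partition t T n s -> t <= u -> u <= v -> v <= T ->
  (forall l, (l < n)%N -> sqnorm P (eta s n l) <= e) ->
  sqnorm P (fun w => iterated_sum i psi s n v w - iterated_sum i psi s n u w)
  <= ito_const T * (e * (v - u)).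
Proof.
move=> hs tu uv vT He.
have E w : iterated_sum i psi s n v w - iterated_sum i psi s n u w = \sum_(l < n) eta s n l w *
    dw (i ord_max) (Num.max u (Num.min (s l) v)) (Num.max u (Num.min (s l.+1) v)) w.
  rewrite /= -sumrB; apply: eq_bigr => l _.
  rewrite -mulrBr; congr (_ * _).
  have := clampB (i ord_max) (s l) w uv; have := clampB (i ord_max) (s l.+1) w uv; lra.
rewrite (eq_ip _ E E).
apply: (@ito_le_cst _ _ _ P T F m f hF hf T0 _ (fun l : 'I_n => eta s n l) _ _ u v).
- exact: le_trans tu.
- by [].
- by [].
- exact: clamp_bounds.
- by move=> l; apply: clamp_adapted => //; exact: aeta.
- by move=> l; exact: Leta.
- move=> x ux xv.
  have [||l ll] := partition_cell hs (u := x); [exact: le_trans ux|exact: lt_le_trans vT|].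
  rewrite (@eq_ip _ _ _ _ _ (eta s n l) _ (eta s n l)); first exact: He.
    move=> w; under eq_bigr do rewrite indic_clamp//.
    by rewrite (step_cell (fun l => eta s n l w) hs ll).
  move=> w; under eq_bigr do rewrite indic_clamp//.
  by rewrite (step_cell (fun l => eta s n l w) hs ll).
Qed.

Lemma iterated_sum_diff_le e n s n' s' v : is_partition t T n s -> is_partition t T n' s' ->
  t <= v <= T ->
  (forall u (l : 'I_n) (l' : 'I_n'), t <= u < T -> s l <= u < s l.+1 -> s' l' <= u < s' l'.+1 ->
     sqnorm P (fun w => eta s n l w - eta s' n' l' w) <= e) ->
  sqnorm P (fun w => iterated_sum i psi s n v w - iterated_sum i psi s' n' v w)
  <= ito_const T * (e * (v - t)).
Proof.
move=> hs hs' /andP[tv vT] He.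
pose et (o : 'I_n + 'I_n') := match o with inl l => eta s n l | inr l => (fun w => - eta s' n' l w) end.
pose a (o : 'I_n + 'I_n') := match o with inl l => Num.max t (Num.min (s l) v)
  | inr l => Num.max t (Num.min (s' l) v) end.
pose b (o : 'I_n + 'I_n') := match o with inl l => Num.max t (Num.min (s l.+1) v)
  | inr l => Num.max t (Num.min (s' l.+1) v) end.
have E w : iterated_sum i psi s n v w - iterated_sum i psi s' n' v w =
    \sum_o et o w * dw (i ord_max) (a o) (b o) w.
  rewrite !iterated_sumS// big_sumType/= -sumrN; congr (_ + _).
  by apply: eq_bigr => l _; rewrite mulNr.
rewrite (eq_ip _ E E).
apply: (@ito_le_cst _ _ _ P T F m f hF hf T0 _ et a b t v) => //.
- by move=> [l|l]; exact: clamp_bounds.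
- move=> [l|l] /= ab; first by apply: (clamp_adapted hs tv vT (aeta hs)).
  rewrite (_ : (fun w => _) = (fun w => -1 * eta s' n' l w)); last first.
    by apply/funext => w; rewrite mulN1r.
  have [h1 h2 h3] := clamp_bounds hs' tv l.
  apply: adaptedZ; last exact: (clamp_adapted hs' tv vT (aeta hs')).
  apply: (filtration_sa hF); first exact: le_trans h1.
  by apply: le_trans vT; exact: le_trans h3.
- by move=> [l|l] /=; [exact: Leta|apply: L2N; exact: Leta].
- move=> x tx xv.
  have xT := lt_le_trans xv vT.
  have [l ll] := partition_cell hs tx xT.
  have [l' ll'] := partition_cell hs' tx xT.
  have E2 w : \sum_o et o w * \1_`[a o, b o[ x = eta s n l w - eta s' n' l' w.
    rewrite big_sumType/=; congr (_ + _).
      under eq_bigr do rewrite indic_clamp//.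
      exact: (step_cell (fun l => eta s n l w) hs ll).
    under eq_bigr do rewrite indic_clamp//.
    exact: (step_cell (fun l => - eta s' n' l w) hs' ll').
  by rewrite (eq_ip _ E2 E2); apply: He ll ll'; rewrite tx.
Qed.

Lemma iterated_sum_ito_le e n s u xi X : is_partition t T n s -> t <= u <= T ->
  is_ito_integral P F (integrator f (i ord_max)) t u xi X -> 0 <= e ->
  (forall v (l : 'I_n), t <= v < u -> s l <= v < s l.+1 ->
     sqnorm P (fun w => eta s n l w - xi v w) <= e) ->
  sqnorm P (fun w => X w - iterated_sum i psi s n u w)
  <= 4 * ito_const T * (e * (u - t)).
Proof.
move=> hs /andP[tu uT] hX e0 He.
have E w : X w - iterated_sum i psi s n u w = X w - \sum_(l < n) eta s n l w *
   dw (i ord_max) (Num.max t (Num.min (s l) u)) (Num.max t (Num.min (s l.+1) u)) w.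
  by rewrite iterated_sumS.
rewrite (eq_ip _ E E).
apply: (@ito_approx _ _ _ P T F m f hF hf T0 _ (fun l : 'I_n => eta s n l)
  (fun l => Num.max t (Num.min (s l) u)) (fun l => Num.max t (Num.min (s l.+1) u)) t u
  t0 tu uT (clamp_bounds hs tu) _ _ (i ord_max) xi X hX e e0).
- by move=> l ll; apply: (clamp_adapted hs tu uT (aeta hs) ll).
- by move=> l; exact: Leta.
- move=> x tx xu.
  have xT := lt_le_trans xu uT.
  have [l ll] := partition_cell hs tx xT.
  have E2 w : \sum_(j < n) eta s n j w * \1_`[Num.max t (Num.min (s j) u),
      Num.max t (Num.min (s j.+1) u)[ x - xi x w = eta s n l w - xi x w.
    congr (_ - _); under eq_bigr do rewrite indic_clamp//.
    exact: (step_cell (fun l => eta s n l w) hs ll).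
  by rewrite (eq_ip _ E2 E2); apply: He ll; rewrite tx.
Qed.

End succ.

Definition fine_partition (r : R) n s :=
  is_partition t T n s /\ forall l, (l < n)%N -> s l.+1 - s l <= r.

Lemma fine_partition_le r r' n s :
  r <= r' -> fine_partition r n s -> fine_partition r' n s.
Proof. by move=> rr' [hs fs]; split => // l ln; exact: le_trans (fs l ln) rr'. Qed.

Lemma iterated_sum_bounded k i (psi : 'I_k -> R -> R) :
  (forall l, {within `[t, T], continuous (psi l)}) ->
  exists2 M, 0 <= M & forall n s v, is_partition t T n s -> t <= v <= T ->
    sqnorm P (iterated_sum i psi s n v) <= M.
Proof.
elim: k i psi => [|k ih] i psi cpsi.
  by exists 1 => // n s v _ _; rewrite ip_cst mulr1.
have [|M M0 HM] := ih (init i) (init psi).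
  by move=> l; exact: cpsi.
have [C C0 HC] := within_bounded (cpsi ord_max).
have CT0 : 0 <= ito_const T by exact: ito_const_ge0.
exists (ito_const T * (C ^+ 2 * M * T)); first by rewrite !mulr_ge0 ?sqr_ge0.
move=> n s v hs /andP[tv vT].
have Xt w : iterated_sum i psi s n t w = 0.
  rewrite /= big1// => l _.
  have /andP[h1 _] := partition_bounds hs (ltnW (ltn_ord l)).
  have /andP[h2 _] := partition_bounds hs (ltn_ord l).
  by rewrite !min_r// subrr mulr0.
have E w : iterated_sum i psi s n v w = iterated_sum i psi s n v w - iterated_sum i psi s n t w.
  by rewrite Xt subr0.
rewrite (eq_ip _ E E).
apply: le_trans (iterated_sum_incr_le (e := C ^+ 2 * M) hs (lexx t) tv vT _) _; last first.
  rewrite ler_wpM2l// ler_wpM2l//; last by rewrite lerBlDr (le_trans vT)// lerDl.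
  by rewrite mulr_ge0// sqr_ge0.
move=> l ln; have sl := partition_bounds hs (ltnW ln).
rewrite ip_sqrZ; last by have [] := iterated_sum_adapted (init i) (init psi) hs sl.
rewrite ler_pM ?sqr_ge0 ?ip_ge0//; last exact: HM.
by rewrite -real_normK ?num_real// lerXn2r ?nnegrE// HC.
Qed.

Lemma iterated_sum_holder k i (psi : 'I_k -> R -> R) :
  (forall l, {within `[t, T], continuous (psi l)}) ->
  exists2 M, 0 <= M & forall n s u v, is_partition t T n s -> t <= u -> u <= v -> v <= T ->
    sqnorm P (fun w => iterated_sum i psi s n v w - iterated_sum i psi s n u w) <= M * (v - u).
Proof.
case: k i psi => [|k] i psi cpsi.
  exists 0 => // n s u v _ _ _ _ /=; rewrite subrr mul0r.
  by rewrite (_ : (fun _ => 0) = cst 0)// ip_cst mulr0.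
have [|M M0 HM] := @iterated_sum_bounded _ (init i) (init psi).
  by move=> l; exact: cpsi.
have [C C0 HC] := within_bounded (cpsi ord_max).
have CT0 : 0 <= ito_const T by exact: ito_const_ge0.
exists (ito_const T * (C ^+ 2 * M)); first by rewrite !mulr_ge0 ?sqr_ge0.
move=> n s u v hs tu uv vT; rewrite -mulrA.
apply: iterated_sum_incr_le => // l ln; have sl := partition_bounds hs (ltnW ln).
rewrite ip_sqrZ; last by have [] := iterated_sum_adapted (init i) (init psi) hs sl.
rewrite ler_pM ?sqr_ge0 ?ip_ge0//; last exact: HM.
by rewrite -real_normK ?num_real// lerXn2r ?nnegrE// HC.
Qed.

(** Inside a cell both factors vary little: the weight by uniform continuity,
    the inner sum because its increments have second moment of the order of
    the elapsed time. *)
Lemma iterated_sum_step k (i : 'I_k -> 'I_m.+1) (psi : 'I_k -> R -> R) (g : R -> R) (e : R) : 0 < e ->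
  {within `[t, T], continuous g} ->
  (forall l, {within `[t, T], continuous (psi l)}) ->
  exists2 r, 0 < r & forall n s l u, fine_partition r n s -> (l < n)%N ->
    s l <= u <= s l.+1 ->
    sqnorm P (fun w => g (s l) * iterated_sum i psi s n (s l) w - g u * iterated_sum i psi s n u w) <= e.
Proof.
move=> e0 cg cpsi.
have [M M0 HM] := iterated_sum_bounded i cpsi.
have [M' M'0 HM'] := iterated_sum_holder i cpsi.
have [C C0 HC] := within_bounded cg.
have h0 : 0 < e / (4 * (M + 1)) by rewrite divr_gt0// mulr_gt0// ltr_wpDl.
have q0 : 0 < Num.sqrt (e / (4 * (M + 1))) by rewrite sqrtr_gt0.
have [r1 r1_0 Hr1] := within_unif_continuous cg q0.
pose r2 := e / (4 * (C ^+ 2 * M' + 1)).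
have den : 0 < C ^+ 2 * M' + 1 by rewrite ltr_wpDl// mulr_ge0// sqr_ge0.
have r2_0 : 0 < r2 by rewrite divr_gt0// mulr_gt0.
exists (Num.min r1 r2); first by rewrite lt_min r1_0.
move=> n s l u [hs fs] ln /andP[lu ul].
have sl := partition_bounds hs (ltnW ln); have sl' := partition_bounds hs ln.
have hu : t <= u <= T.
  by move: sl sl' => /andP[h1 _] /andP[_ h2]; rewrite (le_trans h1 lu) (le_trans ul h2).
have us : u - s l <= Num.min r1 r2 by apply: le_trans (fs l ln); rewrite lerB.
have [_ L1] := iterated_sum_adapted i psi hs sl.
have [_ L2'] := iterated_sum_adapted i psi hs hu.
pose A w := (g (s l) - g u) * iterated_sum i psi s n (s l) w.
pose B w := g u * (iterated_sum i psi s n (s l) w - iterated_sum i psi s n u w).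
have E w : g (s l) * iterated_sum i psi s n (s l) w - g u * iterated_sum i psi s n u w = A w + B w.
  by rewrite /A /B; ring.
rewrite (eq_ip _ E E); apply: le_trans (ipD_le _ _) _.
- exact: L2Z.
- by apply: L2Z; exact: L2B.
rewrite ip_sqrZ// ip_sqrZ; last exact: L2B.
rewrite (ipBC _ (iterated_sum i psi s n (s l))).
have a1 : (g (s l) - g u) ^+ 2 <= e / (4 * (M + 1)).
  rewrite -[leRHS]sqr_sqrtr; last exact: ltW.
  rewrite -real_normK ?num_real// lerXn2r ?nnegrE ?sqrtr_ge0//.
  apply: Hr1 => //; rewrite distrC ger0_norm ?subr_ge0//.
  by apply: le_trans us _; rewrite ge_min lexx.
have a2 := HM n s (s l) hs sl.
have a3 := HM' n s (s l) u hs.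
have {}a3 := a3 (proj1 (andP sl)) lu (proj2 (andP hu)).
have a4 : (g u) ^+ 2 <= C ^+ 2.
  by rewrite -real_normK ?num_real// lerXn2r ?nnegrE// HC.
have b1 : (g (s l) - g u) ^+ 2 * sqnorm P (iterated_sum i psi s n (s l)) <= e / 4.
  apply: (@le_trans _ _ (e / (4 * (M + 1)) * M)).
    by rewrite ler_pM ?sqr_ge0 ?ip_ge0.
  have M1 : 0 < M + 1 by rewrite ltr_wpDl.
  rewrite mulrAC ler_pdivrMr ?mulr_gt0//.
  rewrite (_ : e / 4 * _ = e * (M + 1)); last by field.
  by rewrite ler_pM2l// lerDl.
have b2 : (g u) ^+ 2 * sqnorm P (fun w => iterated_sum i psi s n u w - iterated_sum i psi s n (s l) w) <= e / 4.
  apply: (@le_trans _ _ (C ^+ 2 * (M' * r2))).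
    rewrite ler_pM ?sqr_ge0 ?ip_ge0//; apply: le_trans a3 _; rewrite ler_wpM2l//.
    by apply: le_trans us _; rewrite ge_min lexx orbT.
  rewrite mulrA /r2 mulrA ler_pdivrMr ?mulr_gt0//.
  rewrite (_ : e / 4 * _ = e * (C ^+ 2 * M' + 1)); last by field.
  by rewrite mulrC ler_wpM2l ?ltW// ltrDl.
lra.
Qed.

(** Induction on the multiplicity. Before applying the isometry, the
    integrands of the two outermost sums at a time u are moved from the nodes
    of their cells to u itself, where the induction hypothesis compares the
    inner sums. *)
Lemma iterated_sum_cauchy k i (psi : 'I_k -> R -> R) e : 0 < e ->
  (forall l, {within `[t, T], continuous (psi l)}) ->
  exists2 r, 0 < r & forall n s n' s' v, fine_partition r n s -> fine_partition r n' s' ->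
    t <= v <= T ->
    sqnorm P (fun w => iterated_sum i psi s n v w - iterated_sum i psi s' n' v w) <= e.
Proof.
move=> e0 cpsi; elim: k i psi e e0 cpsi => [|k ih] i psi e e0 cpsi.
  exists 1 => // n s n' s' v _ _ _ /=; rewrite subrr.
  by rewrite (_ : (fun _ => 0) = cst 0)// ip_cst mulr0 ltW.
have [C C0 HC] := within_bounded (cpsi ord_max).
have CT1 : 1 <= ito_const T by rewrite /ito_const lerDl.
have K0 : 0 < ito_const T * (T + 1).
  by rewrite mulr_gt0 ?(lt_le_trans _ CT1)// ltr_wpDl.
pose e1 := e / (9 * (ito_const T * (T + 1))).
have e1_0 : 0 < e1 by rewrite divr_gt0// mulr_gt0.
pose e2 := e1 / (C ^+ 2 + 1).
have C1 : 0 < C ^+ 2 + 1 by rewrite ltr_wpDl// sqr_ge0.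
have e2_0 : 0 < e2 by rewrite divr_gt0.
pose i' := init i; pose psi' := init psi.
have cpsi' l : {within `[t, T], continuous (psi' l)} by exact: cpsi.
have [r1 r1_0 H1] := iterated_sum_step i' e1_0 (cpsi ord_max) cpsi'.
have [r2 r2_0 H2] := ih i' psi' e2 e2_0 cpsi'.
exists (Num.min r1 r2); first by rewrite lt_min r1_0.
have le_r1 : Num.min r1 r2 <= r1 by rewrite ge_min lexx.
have le_r2 : Num.min r1 r2 <= r2 by rewrite ge_min lexx orbT.
move=> n s n' s' v fs fs' tvT; have [[hs _] [hs' _]] := (fs, fs').
have f1 := fine_partition_le le_r1 fs; have f2 := fine_partition_le le_r2 fs.
have f1' := fine_partition_le le_r1 fs'; have f2' := fine_partition_le le_r2 fs'.
have le1 : ito_const T * (9 * e1 * (v - t)) <= e.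
  apply: (@le_trans _ _ (ito_const T * (9 * e1 * (T + 1)))).
    rewrite ler_wpM2l ?(le_trans _ CT1)// (ler_wpM2l (mulr_ge0 _ (ltW e1_0)))//.
    move: tvT => /andP[_ vT].
    by rewrite lerBlDr (le_trans vT)// -addrA lerDl addr_ge0.
  rewrite [leLHS](_ : _ = e1 * (9 * (ito_const T * (T + 1)))); last by ring.
  by rewrite /e1 divfK// gt_eqF// mulr_gt0.
apply: le_trans le1; apply: iterated_sum_diff_le => // u l l' /andP[tu uT] ll ll'.
have utT : t <= u <= T by rewrite tu ltW.
have [_ Lu] := iterated_sum_adapted i' psi' hs utT.
have [_ Lu'] := iterated_sum_adapted i' psi' hs' utT.
have [_ Ls] := iterated_sum_adapted i' psi' hs (partition_bounds hs (ltnW (ltn_ord l))).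
have [_ Ls'] := iterated_sum_adapted i' psi' hs' (partition_bounds hs' (ltnW (ltn_ord l'))).
pose A w := psi ord_max (s l) * iterated_sum i' psi' s n (s l) w
   - psi ord_max u * iterated_sum i' psi' s n u w.
pose B w := psi ord_max u * (iterated_sum i' psi' s n u w - iterated_sum i' psi' s' n' u w).
pose A' w := psi ord_max (s' l') * iterated_sum i' psi' s' n' (s' l') w
   - psi ord_max u * iterated_sum i' psi' s' n' u w.
have E w : psi ord_max (s l) * iterated_sum i' psi' s n (s l) w -
   psi ord_max (s' l') * iterated_sum i' psi' s' n' (s' l') w = A w + B w + - A' w.
  by rewrite /A /B /A'; ring.
rewrite (eq_ip _ E E).
have LA : L2 P A by apply: L2B; exact: L2Z.
have LA' : L2 P A' by apply: L2B; exact: L2Z.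
have LB : L2 P B by apply: L2Z; exact: L2B.
apply: le_trans (ipD3_le LA LB (L2N LA')) _; rewrite ipN.
have hA : sqnorm P A <= e1.
  by apply: H1 => //; move: ll => /andP[-> /ltW ->].
have hA' : sqnorm P A' <= e1.
  by apply: H1 => //; move: ll' => /andP[-> /ltW ->].
have hB : sqnorm P B <= e1.
  rewrite ip_sqrZ; last exact: L2B.
  apply: (@le_trans _ _ ((C ^+ 2 + 1) * e2)); last by rewrite /e2 mulrC divfK// gt_eqF.
  rewrite ler_pM ?sqr_ge0 ?ip_ge0//; last exact: H2.
  apply: (@le_trans _ _ (C ^+ 2)); last by rewrite lerDl.
  by rewrite -real_normK ?num_real// lerXn2r ?nnegrE// HC.
lra.
Qed.

Lemma iterated_ito_L2 k i (psi : 'I_k -> R -> R) u X :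
  is_iterated_ito P F f t i psi u X -> L2 P X.
Proof.
case: k i psi => [|k] i psi /=; first by move=> ->; exact: L2_cst.
by move=> [xi [_ /ito_integral_L2]].
Qed.

(** The induction of [iterated_sum_cauchy], with the integrand of the given
    integral in place of that of a second sum. *)
Lemma iterated_sum_cvg k i (psi : 'I_k -> R -> R) e : 0 < e ->
  (forall l, {within `[t, T], continuous (psi l)}) ->
  exists2 r, 0 < r & forall n s u X, fine_partition r n s -> t <= u <= T ->
    is_iterated_ito P F f t i psi u X ->
    sqnorm P (fun w => X w - iterated_sum i psi s n u w) <= e.
Proof.
move=> e0 cpsi; elim: k i psi e e0 cpsi => [|k ih] i psi e e0 cpsi.
  exists 1 => // n s u X _ _ /= ->.
  have E w : cst 1 w - 1 = (cst 0 : Omega -> R) w by rewrite /= subrr.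
  by rewrite (eq_ip _ E E) ip_cst mulr0 ltW.
have [C C0 HC] := within_bounded (cpsi ord_max).
have CT1 : 1 <= ito_const T by rewrite /ito_const lerDl.
have K0 : 0 < ito_const T * (T + 1).
  by rewrite mulr_gt0 ?(lt_le_trans _ CT1)// ltr_wpDl.
pose e1 := e / (16 * (ito_const T * (T + 1))).
have e1_0 : 0 < e1 by rewrite divr_gt0// mulr_gt0.
pose e2 := e1 / (C ^+ 2 + 1).
have C1 : 0 < C ^+ 2 + 1 by rewrite ltr_wpDl// sqr_ge0.
have e2_0 : 0 < e2 by rewrite divr_gt0.
pose i' := init i; pose psi' := init psi.
have cpsi' l : {within `[t, T], continuous (psi' l)} by exact: cpsi.
have [r1 r1_0 H1] := iterated_sum_step i' e1_0 (cpsi ord_max) cpsi'.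
have [r2 r2_0 H2] := ih i' psi' e2 e2_0 cpsi'.
exists (Num.min r1 r2); first by rewrite lt_min r1_0.
move=> n s u X fs tuT /= [xi [hxi hX]]; have [hs _] := fs.
have f1 : fine_partition r1 n s by apply: fine_partition_le fs; rewrite ge_min lexx.
have f2 : fine_partition r2 n s by apply: fine_partition_le fs; rewrite ge_min lexx orbT.
have le1 : 4 * ito_const T * (4 * e1 * (u - t)) <= e.
  apply: (@le_trans _ _ (4 * ito_const T * (4 * e1 * (T + 1)))).
    rewrite ler_wpM2l ?mulr_ge0 ?(le_trans _ CT1)// (ler_wpM2l (mulr_ge0 _ (ltW e1_0)))//.
    move: tuT => /andP[_ vT].
    by rewrite lerBlDr (le_trans vT)// -addrA lerDl addr_ge0.
  rewrite [leLHS](_ : _ = e1 * (16 * (ito_const T * (T + 1)))); last by ring.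
  by rewrite /e1 divfK// gt_eqF// mulr_gt0.
apply: le_trans le1; apply: (iterated_sum_ito_le hs tuT hX); first by rewrite mulr_ge0// ltW.
move=> v l /andP[tv vu] ll.
have vT : v <= T by move: tuT => /andP[_]; apply: le_trans; exact: ltW.
have tvT : t <= v <= T by rewrite tv.
have tvu : t <= v <= u by rewrite tv ltW.
have [_ Lu] := iterated_sum_adapted i' psi' hs tvT.
have [_ Ls] := iterated_sum_adapted i' psi' hs (partition_bounds hs (ltnW (ltn_ord l))).
have Lxi := iterated_ito_L2 (hxi v tvu).
pose A w := psi ord_max (s l) * iterated_sum i' psi' s n (s l) w
   - psi ord_max v * iterated_sum i' psi' s n v w.
pose B w := psi ord_max v * (iterated_sum i' psi' s n v w - xi v w).
have E w : psi ord_max (s l) * iterated_sum i' psi' s n (s l) w -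
   psi ord_max v * xi v w = A w + B w.
  by rewrite /A /B; ring.
rewrite (eq_ip _ E E).
have LA : L2 P A by apply: L2B; exact: L2Z.
have LB : L2 P B by apply: L2Z; exact: L2B.
apply: le_trans (ipD_le LA LB) _.
have hA : sqnorm P A <= e1.
  by apply: H1 => //; move: ll => /andP[-> /ltW ->].
have hB : sqnorm P B <= e1.
  rewrite ip_sqrZ; last exact: L2B.
  apply: (@le_trans _ _ ((C ^+ 2 + 1) * e2)); last by rewrite /e2 mulrC divfK// gt_eqF.
  rewrite ipBC.
  rewrite ler_pM ?sqr_ge0 ?ip_ge0//; last by apply: H2 => //; exact: hxi.
  apply: (@le_trans _ _ (C ^+ 2)); last by rewrite lerDl.
  by rewrite -real_normK ?num_real// lerXn2r ?nnegrE// HC.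
lra.
Qed.

End iterated_sums.

(** * Recognizing normal laws *)

Section normal_law.
Context (R : realType) (d : measure_display) (Omega : measurableType d)
  (P : probability Omega R).
Notation mu := (@lebesgue_measure R).
Notation RT := (measurableTypeR R).

Lemma integral_normal_prob (s : R) (h : R -> R) : 0 < s -> measurable_fun setT h ->
  mu.-integrable setT (EFin \o (fun x => h x * normal_pdf 0 s x)) ->
  \int[normal_prob 0 s]_x h x = \int[mu]_x (h x * normal_pdf 0 s x).
Proof.
move=> s0 mh ih.
have [] := @integral_law _ RT R (normal_prob 0 s : probability RT R) id (normal_pdf 0 s) h.
- exact: measurable_id.
- exact: measurable_phi.
- exact: phi_ge0.
- by [].
- exact: mh.
- exact: ih.
- by [].
Qed.

(** The weight Z is what makes the uniqueness theorem detect independence: the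
    mean of Z times an indicator of X factors as soon as the means with
    cosines do. *)
Lemma normal_of_cos (Z X : Omega -> R) (M c s : R) : 0 < s ->
  measurable_fun setT Z -> (forall w, `|Z w| <= M) -> measurable_fun setT X -> `|c| <= M ->
  (forall l th, \int[P]_w (Z w * cos (l * X w + th)) =
     c * (cos th * expR (- (l ^+ 2 * s ^+ 2) / 2))) ->
  forall B : set R, measurable B ->
  \int[P]_w (Z w * \1_B (X w)) = c * fine (normal_prob 0 s B).
Proof.
move=> s0 mZ ZM mX cM H B mB.
rewrite (@charfun_unique _ _ _ P Z X _ RT (normal_prob 0 s : probability RT R) (cst c) id M)//.
- have -> : (fun w : RT => cst c w * \1_B (id w)) = (fun w => c * \1_B w) by [].
  rewrite RintegralZl//.
    by rewrite /Rintegral/= integral_indic// setIT.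
  exact: integrable_indic.
- move=> l th; rewrite H.
  have -> : (fun w : RT => cst c w * cos (l * id w + th)) =
    (fun w => c * cos (l * w + th)) by [].
  have mc := measurable_cos_affine l th.
  rewrite RintegralZl//.
    rewrite integral_normal_prob//; last exact: integrable_cos_phi.
    by rewrite charfun_normal.
  apply: (@measurable_bounded_integrable _ _ _ (normal_prob 0 s : probability RT R)) => //.
    by rewrite (le_lt_trans (@probability_le1 _ _ _ (normal_prob 0 s : probability RT R) _ _))// ltry.
  exists 1; split => // x x1 y _ /=; rewrite (le_trans _ (ltW x1))//.
  by rewrite ler_norml cos_geN1 cos_le1.
Qed.

Lemma normal_law_of_cos (X : Omega -> R) (s : R) : 0 < s -> measurable_fun setT X ->
  (forall l th, \int[P]_w cos (l * X w + th) = cos th * expR (- (l ^+ 2 * s ^+ 2) / 2)) ->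
  forall B : set R, measurable B -> P (X @^-1` B) = normal_prob 0 s B.
Proof.
move=> s0 mX H B mB.
have mXB : measurable (X @^-1` B) by rewrite -[X in measurable X]setTI; exact: mX.
have N1 (w : Omega) : `|(cst 1 w : R)| <= 1 by rewrite normr1.
have N2 : `|1 : R| <= 1 by rewrite normr1.
have H1 l th : \int[P]_w (cst 1 w * cos (l * X w + th)) =
    1 * (cos th * expR (- (l ^+ 2 * s ^+ 2) / 2)).
  by rewrite mul1r -H; apply: eq_Rintegral => w _; rewrite mul1r.
have := normal_of_cos s0 (measurable_cst _) N1 mX N2 H1 mB; rewrite mul1r.
under eq_Rintegral do rewrite mul1r.
rewrite /Rintegral.
have -> : (fun w => (\1_B (X w))%:E) = (fun w => (\1_(X @^-1` B) w)%:E) :> (Omega -> \bar R).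
  by apply/funext => w; rewrite !indicE; congr (nat_of_bool _)%:R%:E; apply/idP/idP; rewrite !inE.
rewrite integral_indic// setIT => E.
rewrite -[LHS]fineK ?fin_num_measure// E fineK//.
exact: (@fin_num_measure _ _ _ (normal_prob 0 s : probability RT R)).
Qed.

(** The bound is explicit in s because it has to be uniform along a sequence
    of Riemann sums. *)
Lemma normal_moment (X : Omega -> R) (s : R) n : 0 < s -> measurable_fun setT X ->
  (forall B : set R, measurable B -> P (X @^-1` B) = normal_prob 0 s B) ->
  L2 P (fun w => X w ^+ n) /\
  sqnorm P (fun w => X w ^+ n) <=
    (4 * s ^+ 2) ^+ n * n`!%:R * Num.sqrt 2.
Proof.
move=> s0 mX law.
have mp : measurable_fun setT (fun x : R => x ^+ n ^+ 2).
  by apply: measurable_funX; exact: exprn_measurable.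
have r2 : 0 < Num.sqrt 2 :> R by rewrite sqrtr_gt0.
have s20 : 0 < s * Num.sqrt 2 by rewrite mulr_gt0.
set K := _ * Num.sqrt 2.
have K0 : 0 <= K by rewrite /K !mulr_ge0 ?exprn_ge0 ?mulr_ge0 ?sqr_ge0// ltW.
have iK : mu.-integrable setT (EFin \o (fun x => K * normal_pdf 0 (s * Num.sqrt 2) x)).
  have := integrableZl measurableT K (integrable_normal_pdf 0 (s * Num.sqrt 2)).
  exact: eq_integrable.
have iX : mu.-integrable setT (EFin \o (fun x => x ^+ n ^+ 2 * normal_pdf 0 s x)).
  apply: le_integrable iK => //.
    apply/measurable_EFinP; apply: measurable_funM => //; exact: measurable_phi.
  move=> x _; rewrite /= lee_fin ger0_norm; last by rewrite mulr_ge0 ?sqr_ge0 ?phi_ge0.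
  by rewrite ger0_norm ?pow_normal_pdf_le// mulr_ge0 ?phi_ge0.
have [i1 i2] := integral_law mX (@measurable_phi _ s) (@phi_ge0 _ s) law mp iX.
split; first by split; [exact: measurable_funX|].
rewrite /ip; under eq_Rintegral do rewrite -expr2.
rewrite i2; apply: (@le_trans _ _ (\int[mu]_x (K * normal_pdf 0 (s * Num.sqrt 2) x))).
  by apply: le_Rintegral => // x _; exact: pow_normal_pdf_le.
rewrite RintegralZl//; last exact: integrable_normal_pdf.
by rewrite /Rintegral integral_normal_pdf/= mulr1.
Qed.

End normal_law.

(** * Riemann sums of deterministic integrands *)

Section partitions.
Context (R : realType) (t T : R) (tau : nat -> nat -> R).
Hypotheses (tT : t <= T) (htau : partition_sequence t T tau).
Notation mu := (@lebesgue_measure R).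

Lemma mesh_near r : 0 < r -> \forall N \near \oo, fine_partition T t r N (tau N).
Proof.
move=> r0; have [hp hm] := htau.
have := hm => /cvgr0_norm_le/(_ _ r0) hm'.
near=> N; split; first by apply: hp; near: N; exact: nbhs_infty_gt.
move=> l lN.
apply: (@le_trans _ _ (\big[Num.max/0]_(j < N) (tau N j.+1 - tau N j))).
  exact: (@le_bigmax _ _ _ 0 (fun j : 'I_N => tau N j.+1 - tau N j) (Ordinal lN)).
by apply: le_trans (ler_norm _) _; near: N.
Unshelve. all: by end_near.
Qed.

Lemma within_integrable (g : R -> R) : {within `[t, T], continuous g} ->
  mu.-integrable `[t, T] (EFin \o g).
Proof.
move=> cg; apply: continuous_compact_integrable => //; exact: segment_compact.
Qed.

Lemma riemann_le (g : R -> R) n s r e : {within `[t, T], continuous g} -> 0 <= e ->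
  (forall x y, t <= x <= T -> t <= y <= T -> `|x - y| <= r -> `|g x - g y| <= e) ->
  fine_partition T t r n s ->
  `|\sum_(l < n) g (s l) * (s l.+1 - s l) - \int[mu]_(x in `[t, T]) g x| <= e * (T - t).
Proof.
move=> cg e0 ug [hs fs].
have mI : measurable (`[t, T[ : set (measurableTypeR R)) by exact: measurable_itv.
have ig := within_integrable cg.
have sub : (`[t, T[ : set (measurableTypeR R)) `<=` `[t, T].
  by move=> x /=; rewrite !in_itv/= => /andP[-> /ltW].
have ig' : mu.-integrable `[t, T[ (EFin \o g).
  apply: integrableS ig => //; exact: measurable_itv.
have -> : \int[mu]_(x in `[t, T]) g x = \int[mu]_(x in `[t, T[) g x.
  exact/esym/(Rintegral_itv_bndo_bndc ig').
have i1 (l : 'I_n) : mu.-integrable `[t, T[ (EFin \o (fun x => g (s l) * \1_`[s l, s l.+1[ x)).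
  have := integrableZl mI (g (s l)) (integrable_indic_co (s l) (s l.+1) mI).
  exact: eq_integrable.
have [i2 E] := Rint_sum_in (index_enum 'I_n) mI i1.
have -> : \sum_(l < n) g (s l) * (s l.+1 - s l) =
   \int[mu]_(x in `[t, T[) \sum_(l < n) g (s l) * \1_`[s l, s l.+1[ x.
  rewrite E; apply: eq_bigr => l _; rewrite RintegralZl//; last exact: integrable_indic_co.
  by have [h1 h2 h3] := partition_cell_bounds hs l; rewrite integral_indic_co.
rewrite -RintegralB//.
apply: le_trans (le_normr_Rintegral _ _) _ => //.
  by have := integrableB mI i2 ig'; exact: eq_integrable.
have E2 : \int[mu]_(v in `[t, T[) e = e * (T - t).
  rewrite Rintegral_cst//= lebesgue_measure_itv/= lte_fin.
  case: ltP => [_|H]; first by rewrite -EFinB.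
  by rewrite (_ : T - t = 0) ?mulr0//; apply/eqP; rewrite subr_eq0 eq_le H tT.
rewrite -E2; apply: le_Rintegral => //.
- by have := integrable_abse (integrableB mI i2 ig'); exact: eq_integrable.
- apply: measurable_bounded_integrable => //; last first.
    by exists `|e|; split => // x xe v _ /=; exact: ltW.
  by rewrite /= lebesgue_measure_itv/=; case: ifP => _; rewrite ?ltry.
move=> v /=; rewrite in_itv/= => /andP[tv vT].
have [l ll] := partition_cell hs tv vT.
rewrite (step_cell (fun l => g (s l)) hs ll).
have sl := partition_bounds hs (ltnW (ltn_ord l)).
apply: ug => //; first by rewrite tv ltW.
move: ll => /andP[l1 l2]; rewrite distrC ger0_norm ?subr_ge0//.
by apply: le_trans (fs l (ltn_ord l)); rewrite lerB// ltW.
Qed.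

Lemma riemann_cvg (g : R -> R) : {within `[t, T], continuous g} ->
  \sum_(l < N) g (tau N l) * (tau N l.+1 - tau N l) @[N --> \oo] -->
  \int[mu]_(x in `[t, T]) g x.
Proof.
move=> cg; apply/cvgrPdist_le => e e0.
have e1 : 0 < e / (T - t + 1) by rewrite divr_gt0// ltr_wpDl// subr_ge0.
have [r r0 ur] := within_unif_continuous cg e1.
have := mesh_near r0; apply: filterS => N fN.
rewrite distrC; apply: le_trans (riemann_le cg (ltW e1) ur fN) _.
by rewrite mulrAC ler_pdivrMr ?ltr_wpDl ?subr_ge0// ler_pM2l// lerDl.
Qed.

End partitions.

Section zeta_sums.
Context (R : realType) (d : measure_display) (Omega : measurableType d)
  (P : probability Omega R) (T : R) (F : R -> set_system Omega) (m : nat)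
  (f : 'I_m -> R -> Omega -> R).
Hypotheses (hF : filtration T F) (hf : wiener_process P T F f).
Variables (t : R) (tau : nat -> nat -> R).
Hypotheses (t0 : 0 <= t) (tT : t <= T) (htau : partition_sequence t T tau).
Notation mu := (@lebesgue_measure R).
Notation dw i a b := (fun w => integrator f i b w - integrator f i a w).

Let T0 : 0 <= T := le_trans t0 tT.

Definition zeta_sum (g : R -> R) (r : 'I_m.+1) N (w : Omega) : R :=
  \sum_(l < N) g (tau N l) * dw r (tau N l) (tau N l.+1) w.

Lemma node_adapted N s (g : R -> R) (j : 'I_N) : is_partition t T N s ->
  s j < s j.+1 -> adapted_to (F (s j)) (cst (g (s j))).
Proof.
move=> hs _; have /andP[h1 h2] := partition_bounds hs (ltnW (ltn_ord j)).
by apply: adapted_cst; apply: (filtration_sa hF) => //; exact: le_trans h1.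
Qed.

Lemma zeta_sum_L2 g r N : (0 < N)%N -> L2 P (zeta_sum g r N).
Proof.
move=> N0; have [+ _] := htau => /(_ N N0) hs.
apply: (@L2_ito _ _ _ P T F m f hF hf _ (fun j : 'I_N => cst (g (tau N j)))
  (fun j => tau N j) (fun j => tau N j.+1) t T) => //.
- exact: partition_cell_bounds.
- by move=> j; exact: node_adapted.
- by move=> j; exact: L2_cst.
Qed.

Lemma zeta_sum_cvg (g : R -> R) r X : {within `[t, T], continuous g} ->
  is_ito_integral P F (integrator f r) t T (fun s _ => g s) X ->
  sqnorm P (fun w => zeta_sum g r N w - X w)
    @[N --> \oo] --> (0 : R).
Proof.
move=> cg hX; apply/cvgrPdist_le => e e0.
have C1 : 1 <= ito_const T by rewrite /ito_const lerDl.
have D0 : 0 < 4 * ito_const T * (T - t + 1).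
  by rewrite mulr_gt0// ?mulr_gt0 ?(lt_le_trans _ C1)// ltr_wpDl// subr_ge0.
pose e1 := e / (4 * ito_const T * (T - t + 1)).
have e1_0 : 0 < e1 by rewrite divr_gt0.
have q0 : 0 < Num.sqrt e1 by rewrite sqrtr_gt0.
have [r1 r1_0 ur] := within_unif_continuous cg q0.
have := mesh_near htau r1_0; apply: filterS => N [hs fs].
rewrite sub0r normrN ger0_norm ?ip_ge0// ipBC.
apply: (@le_trans _ _ (4 * ito_const T * (e1 * (T - t)))).
  apply: (@ito_approx _ _ _ P T F m f hF hf T0 _ (fun j : 'I_N => cst (g (tau N j)))
    (fun j => tau N j) (fun j => tau N j.+1) t T t0 tT (lexx T)
    (partition_cell_bounds hs) _ _ r _ X hX) => //.
  - by move=> j; exact: node_adapted.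
  - by move=> j; exact: L2_cst.
  - exact: ltW.
  - move=> v tv vT; have [l ll] := partition_cell hs tv vT.
    have E (w : Omega) : \sum_(j < N) cst (g (tau N j)) w * \1_`[tau N j, tau N j.+1[ v - g v =
        (cst (g (tau N l) - g v) : Omega -> R) w.
      by rewrite (step_cell (fun l => g (tau N l)) hs ll).
    rewrite (eq_ip _ E E) ip_cst -expr2 -[leRHS]sqr_sqrtr; last exact: ltW.
    rewrite -real_normK ?num_real// lerXn2r ?nnegrE ?sqrtr_ge0//.
    apply: ur; [exact: (partition_bounds hs (ltnW (ltn_ord l)))|by rewrite tv ltW|].
    move: ll => /andP[l1 l2]; rewrite distrC ger0_norm ?subr_ge0//.
    by apply: le_trans (fs l (ltn_ord l)); rewrite lerB// ltW.
rewrite mulrCA /e1 mulrAC ler_pdivrMr// ler_pM2l// ler_pM2l ?lerDl//.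
by rewrite mulr_gt0// (lt_le_trans _ C1).
Qed.

End zeta_sums.

(** * Law and independence of the integrals of the basis *)

Section mean_square_limits.
Context (R : realType) (d : measure_display) (Omega : measurableType d)
  (P : probability Omega R).

Lemma mean_square_lin_cvg (I : Type) (s : seq I) (c : I -> R) (X : I -> nat -> Omega -> R)
    (Y : I -> Omega -> R) :
  (forall i, \forall N \near \oo, L2 P (X i N)) -> (forall i, L2 P (Y i)) ->
  (forall i, sqnorm P (fun w => X i N w - Y i w)
     @[N --> \oo] --> (0 : R)) ->
  (\forall N \near \oo, L2 P (fun w => \sum_(i <- s) c i * X i N w)) /\
  sqnorm P (fun w => \sum_(i <- s) c i * X i N w - \sum_(i <- s) c i * Y i w)
     @[N --> \oo] --> (0 : R).
Proof.
move=> LX LY XY; elim: s => [|i s [ihL ih]].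
  split; first by near=> N; apply: (L2_ext _ (L2_0 P)) => w; rewrite big_nil.
  rewrite (_ : (fun N => _) = cst 0); first exact: cvg_cst.
  apply/funext => N; have E w : \sum_(i <- [::]) c i * X i N w - \sum_(i <- [::]) c i * Y i w =
    (cst 0 : Omega -> R) w by rewrite !big_nil subrr.
  by rewrite (eq_ip _ E E) ip_cst mulr0.
have LXi := LX i; split.
  near=> N; apply: (@L2_ext _ _ _ _ (fun w => c i * X i N w + \sum_(j <- s) c j * X j N w)).
    by move=> w; rewrite big_cons.
  by apply: L2D; [apply: L2Z; near: N|near: N].
have cX : c i ^+ 2 * sqnorm P (fun w => X i N w - Y i w)
    @[N --> \oo] --> (0 : R).
  by have := cvgM (@cvg_cst _ (c i ^+ 2) _ \oo _) (XY i); rewrite mulr0; apply.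
apply: cvg0_le (cvg0_2D cX ih); near=> N.
rewrite ip_ge0/=.
have LXN : L2 P (X i N) by near: N.
have E w : \sum_(j <- i :: s) c j * X j N w - \sum_(j <- i :: s) c j * Y j w =
    c i * (X i N w - Y i w) + (\sum_(j <- s) c j * X j N w - \sum_(j <- s) c j * Y j w).
  by rewrite !big_cons; ring.
rewrite (eq_ip _ E E).
have LN : L2 P (fun w => \sum_(j <- s) c j * X j N w) by near: N.
have LYs : L2 P (fun w => \sum_(j <- s) c j * Y j w) by apply: L2_sum => j _; exact: L2Z.
apply: le_trans (ipD_le (L2Z (c i) (L2B LXN (LY i))) (L2B LN LYs)) _.
by rewrite ip_sqrZ//; exact: L2B.
Unshelve. all: by end_near.
Qed.

Lemma cos_lipschitz (x y : R) : `|cos x - cos y| <= `|x - y|.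
Proof.
wlog xy : x y / x <= y => [H|].
  have [/H //|/ltW/H] := leP x y.
  by rewrite distrC (distrC y).
have [|c _] := @MVT_segment R cos (fun x => - sin x) x y xy.
  by apply: continuous_subspaceT; exact: continuous_cos.
rewrite distrC => ->; rewrite normrM normrN (distrC x) ler_piMl//.
by rewrite ler_norml sin_geN1 sin_le1.
Qed.

Lemma measurable_cos (X : Omega -> R) : measurable_fun setT X ->
  measurable_fun setT (fun w => cos (X w)).
Proof.
move=> mX; apply: (@measurableT_comp _ _ _ _ _ _ (@cos R)) mX.
by apply: continuous_measurable_fun; exact: continuous_cos.
Qed.

Lemma cos_norm1 (x : R) : `|cos x| <= 1.
Proof. by rewrite ler_norml cos_geN1 cos_le1. Qed.

Lemma cos_mean_square_cvg (X : nat -> Omega -> R) Y th :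
  (\forall N \near \oo, L2 P (X N)) -> L2 P Y ->
  sqnorm P (fun w => X N w - Y w) @[N --> \oo] --> (0 : R) ->
  \int[P]_w cos (X N w + th) @[N --> \oo] --> \int[P]_w cos (Y w + th).
Proof.
move=> LX LY XY; apply/cvgrPdist_le => e e0.
have e2 : 0 < e ^+ 2 by rewrite exprn_gt0.
near=> N.
have LXN : L2 P (X N) by near: N.
have ic (Z : Omega -> R) : L2 P Z -> P.-integrable setT (EFin \o (fun w => cos (Z w + th))).
  move=> [mZ _]; apply: (@integrable_bounded _ _ _ _ _ 1); last by move=> w; exact: cos_norm1.
  by apply: measurable_cos; exact: measurable_funD.
rewrite -RintegralB//; [|exact: ic..].
apply: le_trans (le_normr_Rintegral _ _) _ => //.
  by have := integrableB measurableT (ic _ LY) (ic _ LXN); exact: eq_integrable.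
apply: (@le_trans _ _ (\int[P]_w `|X N w - Y w|)).
  apply: le_Rintegral => //.
  - by have := integrable_abse (integrableB measurableT (ic _ LY) (ic _ LXN)); exact: eq_integrable.
  - by have := integrable_abse (L2_integrable (L2B LXN LY)); exact: eq_integrable.
  - move=> w _; apply: le_trans (cos_lipschitz _ _) _.
    by rewrite distrC; apply: le_of_eq; congr `|_|; ring.
apply: le_trans (Rint_norm_le e0 (L2B LXN LY)) _.
rewrite ler_pdivrMr// mulr_natr mulr2n lerD2r ler_pdivrMr// -expr2.
have : `|sqnorm P (fun w => X N w - Y w)| <= e ^+ 2.
  by near: N; exact: (cvgr0_norm_le _ XY).
by apply: le_trans; exact: ler_norm.
Unshelve. all: by end_near.
Qed.

End mean_square_limits.

Section zeta_law.
Context (R : realType) (d : measure_display) (Omega : measurableType d)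
  (P : probability Omega R) (T : R) (F : R -> set_system Omega) (m : nat)
  (f : 'I_m -> R -> Omega -> R).
Hypotheses (hF : filtration T F) (hf : wiener_process P T F f).
Variables (t : R) (tau : nat -> nat -> R).
Hypotheses (t0 : 0 <= t) (tT : t <= T) (htau : partition_sequence t T tau).
Notation mu := (@lebesgue_measure R).
Notation zsum := (zeta_sum f tau).

(** The increments over the last cell are independent of the rest; peeling
    them off contributes one Gaussian factor per cell. *)
Lemma cos_increment_sums n s (c : nat -> 'I_m -> R) th : is_partition t T n s ->
  \int[P]_w cos (\sum_(l < n) \sum_r c l r * increment f (s l) (s l.+1) r w + th) =
  expR (- (\sum_(l < n) (\sum_r c l r ^+ 2) * (s l.+1 - s l)) / 2) * cos th.
Proof.
move=> hs; suff H j : (j <= n)%N ->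
    adapted_to (F (s j)) (fun w => \sum_(l < j) \sum_r c l r * increment f (s l) (s l.+1) r w) /\
    \int[P]_w cos (\sum_(l < j) \sum_r c l r * increment f (s l) (s l.+1) r w + th) =
    expR (- (\sum_(l < j) (\sum_r c l r ^+ 2) * (s l.+1 - s l)) / 2) * cos th.
  by have [] := H n (leqnn n).
elim: j => [_|j ih jn].
  have /andP[h1 h2] := partition_bounds hs (leq0n n).
  split.
    rewrite (_ : (fun w => _) = cst 0); last by apply/funext => w; rewrite big_ord0.
    by apply: adapted_cst; apply: (filtration_sa hF) => //; exact: le_trans h1.
  under eq_Rintegral do rewrite big_ord0.
  by rewrite Rint_cst big_ord0 oppr0 mul0r expR0 mul1r add0r.
have [aX E] := ih (ltnW jn).
have /andP[h1 _] := partition_bounds hs (ltnW jn).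
have /andP[h3 h2] := partition_bounds hs jn.
have [_ _ /(_ j jn) jj] := hs.
have sj0 : 0 <= s j by exact: le_trans h1.
have sG : sigma_algebra setT (F (s j.+1)) by apply: (filtration_sa hF) => //; exact: le_trans h3.
split.
  rewrite (_ : (fun w => _) = (fun w => \sum_(l < j) \sum_r c l r * increment f (s l) (s l.+1) r w
      + \sum_r c j r * increment f (s j) (s j.+1) r w)); last first.
    by apply/funext => w; rewrite big_ord_recr.
  apply: (adaptedD sG); first exact: (filtrationS hF sj0 (ltW jj) h2).
  apply: (adapted_sum sG) => r; apply: (adaptedZ sG).
  apply: (adaptedB sG); first by apply: (wiener_adapted_le hF hf) => //; exact: le_trans h3.
  by apply: (wiener_adapted_le hF hf) => //; exact: ltW.
under eq_Rintegral do rewrite big_ord_recr/=.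
rewrite (cos_increments hF hf sj0 jj h2 (c j) th aX) E big_ord_recr/= mulrA -expRD.
by congr (expR _ * _); ring.
Qed.

Variables (phi : nat -> R -> R).
Hypothesis cphi : forall j, {within `[t, T], continuous (phi j)}.
Hypothesis ophi : forall i j,
    \int[mu]_(x in `[t, T]) (phi i x * phi j x) = (i == j)%:R.

(** The exponent is a quadratic form in the coefficients, whose matrix
    consists of the Riemann sums of the inner products of the basis; different
    components do not interact. *)
Lemma cos_zeta_sums (s : seq ('I_m * nat)) (la : 'I_m * nat -> R) th N : (0 < N)%N ->
  \int[P]_w cos (\sum_(p <- s) la p * zsum (phi p.2) (lift ord0 p.1) N w + th) =
  expR (- (\sum_(p <- s) \sum_(q <- s) (p.1 == q.1)%:R * (la p * la q) *
     \sum_(l < N) phi p.2 (tau N l) * phi q.2 (tau N l) * (tau N l.+1 - tau N l)) / 2) * cos th.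
Proof.
move=> N0; have [/(_ N N0) hs _] := htau.
pose c l r := \sum_(p <- s) (p.1 == r)%:R * (la p * phi p.2 (tau N l)).
have -> : (fun w => cos (\sum_(p <- s) la p * zsum (phi p.2) (lift ord0 p.1) N w + th)) =
    (fun w => cos (\sum_(l < N) \sum_r c l r * increment f (tau N l) (tau N l.+1) r w + th)).
  apply/funext => w; congr (cos (_ + _)).
  under eq_bigr do rewrite /zeta_sum mulr_sumr.
  rewrite exchange_big/=; apply: eq_bigr => l _.
  under [RHS]eq_bigr do rewrite /c mulr_suml.
  rewrite [RHS]exchange_big/=; apply: eq_bigr => p _.
  rewrite (bigD1 p.1)//= eqxx big1 ?addr0 => [|r rp].
    by rewrite !integratorE /increment mul1r; ring.
  by rewrite eq_sym (negbTE rp) !mul0r.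
rewrite (cos_increment_sums c th hs); congr (expR (- _ / 2) * _).
transitivity (\sum_(l < N) \sum_(p <- s) \sum_(q <- s) (p.1 == q.1)%:R * (la p * la q) *
     (phi p.2 (tau N l) * phi q.2 (tau N l) * (tau N l.+1 - tau N l))).
  apply: eq_bigr => l _; rewrite mulr_suml.
  transitivity (\sum_r \sum_(p <- s) \sum_(q <- s) (p.1 == r)%:R * (q.1 == r)%:R * (la p * la q) *
     (phi p.2 (tau N l) * phi q.2 (tau N l) * (tau N l.+1 - tau N l))).
    apply: eq_bigr => r _; rewrite expr2 /c -mulrA mulr_suml.
    apply: eq_bigr => p _; rewrite mulr_suml mulr_sumr.
    by apply: eq_bigr => q _; ring.
  rewrite exchange_big/=; apply: eq_bigr => p _.
  rewrite exchange_big/=; apply: eq_bigr => q _.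
  rewrite (bigD1 p.1)//= eqxx big1 ?addr0 => [|r rp].
    by rewrite mul1r (eq_sym q.1).
  by rewrite eq_sym (negbTE rp) !mul0r.
rewrite exchange_big/=; apply: eq_bigr => p _.
rewrite exchange_big/=; apply: eq_bigr => q _.
by rewrite mulr_sumr.
Qed.

Lemma within_continuousM (g h : R -> R) : {within `[t, T], continuous g} ->
  {within `[t, T], continuous h} -> {within `[t, T], continuous (fun x => g x * h x)}.
Proof. by move=> cg ch x; apply: (@continuousM _ (subspace `[t, T])); [exact: cg|exact: ch]. Qed.

Variable zeta : 'I_m.+1 -> nat -> Omega -> R.
Hypothesis hzeta : forall r j,
      is_ito_integral P F (integrator f r) t T (fun s _ => phi j s) (zeta r j).

Let Z (p : 'I_m * nat) := zeta (lift ord0 p.1) p.2.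

Let LZ p : L2 P (Z p). Proof. exact: ito_integral_L2 (hzeta _ _). Qed.

(** In the limit the quadratic form is the identity by orthonormality. *)
Lemma cos_zetas (s : seq ('I_m * nat)) (la : 'I_m * nat -> R) th : uniq s ->
  \int[P]_w cos (\sum_(p <- s) la p * Z p w + th) =
  expR (- (\sum_(p <- s) la p ^+ 2) / 2) * cos th.
Proof.
move=> us.
have Lz (p : 'I_m * nat) : \forall N \near \oo, L2 P (zsum (phi p.2) (lift ord0 p.1) N).
  near=> N; apply: (zeta_sum_L2 hF hf t0 htau).
  by near: N; exact: nbhs_infty_gt.
have [L1 L2'] := mean_square_lin_cvg s la Lz LZ
  (fun p => zeta_sum_cvg hF hf t0 tT htau (@cphi p.2) (hzeta (lift ord0 p.1) p.2)).
have LY : L2 P (fun w => \sum_(p <- s) la p * Z p w) by apply: L2_sum => p _; exact: L2Z.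
have := cos_mean_square_cvg (th := th) L1 LY L2'.
move=> H0; apply: (cvg_unique (@norm_hausdorff _ R) H0).
pose V := \sum_(p <- s) \sum_(q <- s) (p.1 == q.1)%:R * (la p * la q) * (p.2 == q.2)%:R : R.
have -> : \sum_(p <- s) la p ^+ 2 = V.
  rewrite /V big_seq [RHS]big_seq; apply: eq_bigr => p ps.
  rewrite (bigD1_seq p)//= !eqxx big1 ?addr0; first by rewrite mul1r mulr1 expr2.
  move=> q qp; have [e1|_] := eqVneq p.1 q.1; last by rewrite !mul0r.
  have [e2|_] := eqVneq p.2 q.2; last by rewrite !mulr0.
  by move: qp; rewrite [p]surjective_pairing e1 e2 -surjective_pairing eqxx.
have VN : (\sum_(p <- s) \sum_(q <- s) (p.1 == q.1)%:R * (la p * la q) *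
     \sum_(l < N) phi p.2 (tau N l) * phi q.2 (tau N l) * (tau N l.+1 - tau N l))
    @[N --> \oo] --> V.
  apply: cvg_big; first exact: add_continuous.
  move=> p _; apply: cvg_big; first exact: add_continuous.
  move=> q _.
  apply: cvgMr; rewrite -ophi.
  exact: (riemann_cvg tT htau (within_continuousM (@cphi p.2) (@cphi q.2))).
have : expR (- (\sum_(p <- s) \sum_(q <- s) (p.1 == q.1)%:R * (la p * la q) *
     \sum_(l < N) phi p.2 (tau N l) * phi q.2 (tau N l) * (tau N l.+1 - tau N l)) / 2) * cos th
    @[N --> \oo] --> expR (- V / 2) * cos th.
  apply: cvgMl; apply: continuous_cvg; first exact: continuous_expR.
  by apply: cvgMl; apply: cvgN.
apply: cvg_trans; apply: near_eq_cvg; near=> N.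
rewrite cos_zeta_sums//; near: N; exact: nbhs_infty_gt.
Unshelve. all: by end_near.
Qed.

Lemma prod_norm_le1 (I : Type) (s : seq I) (a : I -> R) : (forall i, `|a i| <= 1) ->
  `|\prod_(i <- s) a i| <= 1.
Proof.
move=> a1; elim/big_ind : _ => [|x y x1 y1|i _]; first by rewrite normr1.
  by rewrite normrM mulr_ile1.
exact: a1.
Qed.

Let mcosZ (la th : 'I_m * nat -> R) p : measurable_fun setT (fun w => cos (la p * Z p w + th p)).
Proof.
apply: measurable_cos; apply: measurable_funD => //.
by apply: measurable_funM => //; exact: L2_measurable.
Qed.

(** The identity 2 cos u cos v = cos(u + v) + cos(u - v) moves the factors one
    by one into the argument of a single cosine. The factor 1 ^+ 2 is the
    variance, in the form in which [charfun_normal] produces it. *)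
Lemma cos_prod_zetas (s2 s1 : seq ('I_m * nat)) (la : 'I_m * nat -> R) th
    (la' th' : 'I_m * nat -> R) : uniq (s1 ++ s2) ->
  \int[P]_w (cos (\sum_(p <- s1) la p * Z p w + th) *
    \prod_(p <- s2) cos (la' p * Z p w + th' p)) =
  expR (- (\sum_(p <- s1) la p ^+ 2) / 2) * cos th *
  \prod_(p <- s2) (cos (th' p) * expR (- (la' p ^+ 2 * 1 ^+ 2) / 2)).
Proof.
elim: s2 s1 la th => [|q s2 ih] s1 la th us.
  rewrite big_nil mulr1 -cos_zetas; last by rewrite cats0 in us.
  by apply: eq_Rintegral => w _; rewrite big_nil mulr1.
have us' : uniq ((q :: s1) ++ s2).
  by move: us; rewrite -cat1s uniq_catCA.
have qs1 : q \notin s1.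
  by move: us' => /= /andP[]; rewrite mem_cat negb_or => /andP[].
pose upd (x : R) p := if p == q then x else la p.
have sum_upd (x : R) (h : R -> 'I_m * nat -> R) : \sum_(p <- q :: s1) h (upd x p) p =
    h x q + \sum_(p <- s1) h (la p) p.
  rewrite big_cons /upd eqxx; congr (_ + _).
  rewrite big_seq [RHS]big_seq; apply: eq_bigr => p ps.
  by case: eqP => // pq; move: qs1; rewrite -pq ps.
pose G (x th1 : R) w := cos (\sum_(p <- q :: s1) upd x p * Z p w + th1) *
    \prod_(p <- s2) cos (la' p * Z p w + th' p).
have iG x th1 : P.-integrable setT (EFin \o G x th1).
  apply: (@integrable_bounded _ _ _ _ _ 1).
    apply: measurable_funM; last by apply: measurable_prod => p _; exact: mcosZ.
    apply: measurable_cos; apply: measurable_funD => //.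
    have Ls : L2 P (fun w => \sum_(p <- q :: s1) upd x p * Z p w).
      by apply: L2_sum => p _; exact: L2Z.
    exact: L2_measurable Ls.
  move=> w; rewrite normrM mulr_ile1 ?cos_norm1//.
  by apply: prod_norm_le1 => p; exact: cos_norm1.
have E w : cos (\sum_(p <- s1) la p * Z p w + th) *
    \prod_(p <- q :: s2) cos (la' p * Z p w + th' p) =
    2^-1 * (G (la' q) (th + th' q) w + G (- la' q) (th - th' q) w).
  rewrite /G !(sum_upd _ (fun x p => x * Z p w)) big_cons.
  set A := \sum_(p <- s1) _; set B := \prod_(p <- s2) _.
  have -> : la' q * Z q w + A + (th + th' q) = (A + th) + (la' q * Z q w + th' q) by ring.
  have -> : - la' q * Z q w + A + (th - th' q) = (A + th) - (la' q * Z q w + th' q) by ring.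
  set U := A + th; set V := la' q * Z q w + th' q.
  by rewrite (cosD U V) (cosB U V); field.
under eq_Rintegral do rewrite E.
rewrite RintegralZl//; last by have := integrableD measurableT (iG (la' q) (th + th' q)) (iG (- la' q) (th - th' q)); exact: eq_integrable.
rewrite RintegralD// /G !ih// !(sum_upd _ (fun x p => x ^+ 2)) big_cons sqrrN expr1n !mulr1.
rewrite cosD cosB opprD mulrDl expRD.
by field.
Qed.

(** One variable at a time, the cosine is replaced by an indicator: the other
    factors are a bounded weight in [normal_of_cos]. *)
Lemma indic_cos_zetas (s1 s2 : seq ('I_m * nat)) (B : 'I_m * nat -> set R)
    (la th : 'I_m * nat -> R) : (forall p, measurable (B p)) -> uniq (s1 ++ s2) ->
  \int[P]_w (\prod_(p <- s1) \1_(B p) (Z p w) * \prod_(p <- s2) cos (la p * Z p w + th p)) =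
  \prod_(p <- s1) fine (normal_prob 0 1 (B p)) *
  \prod_(p <- s2) (cos (th p) * expR (- (la p ^+ 2 * 1 ^+ 2) / 2)).
Proof.
move=> mB; elim: s1 s2 la th => [|q s1 ih] s2 la th us.
  have := @cos_prod_zetas s2 [::] la 0 la th us.
  rewrite !big_nil oppr0 mul0r expR0 cos0 !mul1r => <-.
  by apply: eq_Rintegral => w _; rewrite !big_nil addr0 cos0.
have us' : uniq (s1 ++ q :: s2).
  by move: us; rewrite -(cat1s q s2) uniq_catCA.
have qs2 : q \notin s2.
  by move: us => /= /andP[]; rewrite mem_cat negb_or => /andP[].
pose W w := \prod_(p <- s1) \1_(B p) (Z p w) * \prod_(p <- s2) cos (la p * Z p w + th p) : R.
have mZ p : measurable_fun setT (Z p) by exact: L2_measurable.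
have mi p : measurable_fun setT (fun w => \1_(B p) (Z p w) : R).
  by apply: (measurableT_comp _ (mZ p)); exact: measurable_indic.
have mW : measurable_fun setT W.
  apply: measurable_funM; apply: measurable_prod => p _; first exact: mi.
  exact: mcosZ.
have W1 w : `|W w| <= 1.
  rewrite normrM mulr_ile1 ?prod_norm_le1// => p; [exact: indic_norm_le1|exact: cos_norm1].
set c := \prod_(p <- s1) fine (normal_prob 0 1 (B p)) *
  \prod_(p <- s2) (cos (th p) * expR (- (la p ^+ 2 * 1 ^+ 2) / 2)).
have c1 : `|c| <= 1.
  rewrite normrM mulr_ile1 ?prod_norm_le1// => p.
    have p0 := @measure_ge0 _ _ _ (normal_prob 0 1 : probability (measurableTypeR R) R) (B p).
    have p1 := @probability_le1 _ _ _ (normal_prob 0 1 : probability (measurableTypeR R) R) (B p) (mB p).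
    rewrite ger0_norm ?fine_ge0// -lee_fin fineK//.
    exact: (@fin_num_measure _ _ _ (normal_prob 0 1 : probability (measurableTypeR R) R) _ (mB p)).
  rewrite normrM mulr_ile1 ?cos_norm1// ger0_norm ?expR_ge0//.
  by rewrite -expR0 ler_expR mulNr oppr_le0 divr_ge0// mulr_ge0 ?sqr_ge0.
have H l th1 : \int[P]_w (W w * cos (l * Z q w + th1)) =
    c * (cos th1 * expR (- (l ^+ 2 * 1 ^+ 2) / 2)).
  pose upd (g : 'I_m * nat -> R) x p := if p == q then x else g p.
  have updq g x : upd g x q = x by rewrite /upd eqxx.
  have updE g x p : p \in s2 -> upd g x p = g p.
    by rewrite /upd; case: eqP => // -> qs; rewrite qs in qs2.
  have := ih (q :: s2) (upd la l) (upd th th1) us'.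
  rewrite big_cons !updq.
  rewrite [X in _ * X](_ : _ = \prod_(p <- s2) (cos (th p) * expR (- (la p ^+ 2 * 1 ^+ 2) / 2)) *
     (cos th1 * expR (- (l ^+ 2 * 1 ^+ 2) / 2))); last first.
    rewrite mulrC; congr (_ * _); rewrite big_seq [RHS]big_seq.
    by apply: eq_bigr => p ps; rewrite !updE.
  rewrite mulrA => <-; apply: eq_Rintegral => w _.
  rewrite big_cons !updq /W -mulrA; congr (_ * _); rewrite mulrC; congr (_ * _).
  rewrite big_seq [RHS]big_seq.
  by apply: eq_bigr => p ps; rewrite !updE.
have := normal_of_cos ltr01 mW W1 (mZ q) c1 H (mB q).
have -> : \prod_(p <- q :: s1) fine (normal_prob 0 1 (B p)) *
  \prod_(p <- s2) (cos (th p) * expR (- (la p ^+ 2 * 1 ^+ 2) / 2)) =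
  c * fine (normal_prob 0 1 (B q)) by rewrite big_cons /c; ring.
move=> <-.
by apply: eq_Rintegral => w _; rewrite big_cons /W; ring.
Qed.

Lemma zeta_normal r j B : measurable B ->
  P (zeta (lift ord0 r) j @^-1` B) = normal_prob 0 1 B.
Proof.
apply: normal_law_of_cos => //; first exact: L2_measurable (LZ (r, j)).
move=> l th.
have := @cos_zetas [:: (r, j)] (fun=> l) th erefl.
rewrite big_seq1 expr1n mulr1 mulrC => <-; apply: eq_Rintegral => w _.
by rewrite big_seq1.
Qed.

Lemma zeta_independent : mutually_independent P (fun rj : 'I_m * nat =>
  preimage_set_system setT (zeta (lift ord0 rj.1) rj.2) measurable).
Proof.
move=> s E us hE.
have hB p : exists B : set R, measurable B /\ (p \in s -> E p = Z p @^-1` B).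
  have [ps|ps] := boolP (p \in s); last by exists setT.
  by have [B mB <-] := hE p ps; exists B; split => // _; rewrite setTI.
pose B p := projT1 (cid (hB p)).
have mB p : measurable (B p) by rewrite /B; case: cid => ? [].
have EB p : p \in s -> E p = Z p @^-1` B p by rewrite /B; case: cid => ? [].
have mZB p : measurable (Z p @^-1` B p).
  by rewrite -[X in measurable X]setTI; apply: (L2_measurable (LZ p)).
have -> : \big[setI/setT]_(i <- s) E i = \big[setI/setT]_(i <- s) (Z i @^-1` B i).
  by rewrite big_seq [RHS]big_seq; apply: eq_bigr => p; exact: EB.
have -> : (\big[*%E/1]_(i <- s) P (E i))%E = (\prod_(i <- s) fine (normal_prob 0 1 (B i)))%:E.
  rewrite -prodEFin big_seq [RHS]big_seq; apply: eq_bigr => p ps.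
  rewrite EB// zeta_normal// fineK//.
  exact: (@fin_num_measure _ _ _ (normal_prob 0 1 : probability (measurableTypeR R) R) _ (mB p)).
have := @indic_cos_zetas s [::] B (fun=> 0) (fun=> 0) mB; rewrite cats0 => /(_ us).
under eq_Rintegral do rewrite big_nil mulr1.
rewrite big_nil mulr1 => <-.
have mI : measurable (\big[setI/setT]_(i <- s) (Z i @^-1` B i)).
  by apply: bigsetI_measurable => p _; exact: mZB.
have -> : (fun w => \prod_(p <- s) \1_(B p) (Z p w)) =
    (fun w => \1_(\big[setI/setT]_(i <- s) (Z i @^-1` B i)) w) :> (Omega -> R).
  apply/funext => w; elim: (s) => [|p s' ih]; first by rewrite !big_nil indicT.
  have E1 : \1_(B p) (Z p w) = \1_(Z p @^-1` B p) w :> R.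
    by rewrite !indicE; congr (nat_of_bool _)%:R; apply/idP/idP; rewrite !inE.
  by rewrite !big_cons ih E1 indicI.
by rewrite /Rintegral integral_indic// setIT fineK// fin_num_measure.
Qed.

End zeta_law.

(** * Moments of the integrals of the basis *)

Section constant_moments.
Context (R : realType) (d : measure_display) (Omega : measurableType d)
  (P : probability Omega R).

(** For the integrator time the integral of a basis function is almost surely,
    but perhaps not everywhere, a constant. *)
Lemma ae_cst_moment (Y : Omega -> R) c n : L2 P Y ->
  sqnorm P (fun w => Y w - c) = 0 ->
  L2 P (fun w => Y w ^+ n) /\
  sqnorm P (fun w => Y w ^+ n) = c ^+ n ^+ 2.
Proof.
move=> LY Yc; have mY := L2_measurable LY.
have LYc : L2 P (fun w => Y w - c) by apply: L2B => //; exact: L2_cst.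
have ae0 : ae_eq P setT (fun w => ((Y w - c) ^+ 2)%:E) (cst 0%E).
  apply/ae_eq_integral_abs => //.
    apply/measurable_EFinP; apply: measurable_funX; exact: measurable_funB.
  under eq_integral do rewrite /= ger0_norm ?sqr_ge0//.
  by rewrite -mean_squareE L2_mean_square// Yc.
have mn : measurable_fun setT (fun w => (Y w ^+ n ^+ 2)%:E).
  by apply/measurable_EFinP; apply: measurable_funX; exact: measurable_funX.
have E : (\int[P]_w (Y w ^+ n ^+ 2)%:E = (c ^+ n ^+ 2)%:E)%E.
  rewrite (@ae_eq_integral _ _ _ P setT (cst (c ^+ n ^+ 2)%:E))//.
    by under eq_integral do rewrite /=; rewrite integral_cst// [X in (_ * X)%E]probability_setT mule1.
  apply: filterS ae0 => w H _; have /eqP := H I.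
  by rewrite /= eqe sqrf_eq0 subr_eq0 => /eqP ->.
split; last first.
  by rewrite /ip /Rintegral; under eq_integral do rewrite -expr2; rewrite E.
split; first exact: measurable_funX.
apply/integrableP; split; first exact: mn.
under eq_integral do rewrite /= ger0_norm ?sqr_ge0//.
by rewrite E ltry.
Qed.

End constant_moments.

Section zeta_moments.
Context (R : realType) (d : measure_display) (Omega : measurableType d)
  (P : probability Omega R) (T : R) (F : R -> set_system Omega) (m : nat)
  (f : 'I_m -> R -> Omega -> R).
Hypotheses (hF : filtration T F) (hf : wiener_process P T F f).
Variables (t : R) (tau : nat -> nat -> R).
Hypotheses (t0 : 0 <= t) (tT : t <= T) (htau : partition_sequence t T tau).
Notation mu := (@lebesgue_measure R).
Notation zsum := (zeta_sum f tau).
Variables (phi : nat -> R -> R).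
Hypothesis cphi : forall j, {within `[t, T], continuous (phi j)}.
Hypothesis ophi : forall i j,
    \int[mu]_(x in `[t, T]) (phi i x * phi j x) = (i == j)%:R.
Variable zeta : 'I_m.+1 -> nat -> Omega -> R.
Hypothesis hzeta : forall r j,
      is_ito_integral P F (integrator f r) t T (fun s _ => phi j s) (zeta r j).

Let zsum0 j N w : zsum (phi j) ord0 N w =
  \sum_(l < N) phi j (tau N l) * (tau N l.+1 - tau N l).
Proof. by apply: eq_bigr => l _; rewrite !integratorE0. Qed.

Let zsum_normal r j N : (0 < N)%N ->
  let v := \sum_(l < N) phi j (tau N l) * phi j (tau N l) * (tau N l.+1 - tau N l) in
  0 < v -> forall B, measurable B ->
  P (zsum (phi j) (lift ord0 r) N @^-1` B) = normal_prob 0 (Num.sqrt v) B.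
Proof.
move=> N0 v v0; apply: normal_law_of_cos; first by rewrite sqrtr_gt0.
  exact: L2_measurable (zeta_sum_L2 hF hf t0 htau (phi j) (lift ord0 r) N0).
move=> l th; rewrite sqr_sqrtr; last exact: ltW.
have := @cos_zeta_sums _ _ _ P T F m f hF hf t tau t0 htau phi [:: (r, j)] (fun=> l) th N N0.
rewrite !big_seq1 eqxx mul1r -expr2 mulrC => <-.
by apply: eq_Rintegral => w _; rewrite big_seq1.
Qed.

(** For the time the sums are convergent constants; for a Wiener process they
    are Gaussian, with a variance that tends to 1. *)
Lemma zeta_sum_moments r j : bounded_moments P (zsum (phi j) r).
Proof.
have [->|[r' ->]] := integratorP r.
  move=> n; have cv := riemann_cvg tT htau (@cphi j).
  set I := \int[mu]_(x in `[t, T]) phi j x in cv.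
  have cv2 : (\sum_(l < N) phi j (tau N l) * (tau N l.+1 - tau N l)) ^+ n *
    (\sum_(l < N) phi j (tau N l) * (tau N l.+1 - tau N l)) ^+ n @[N --> \oo]
    --> I ^+ n * I ^+ n.
    have cvn := @continuous_cvg _ _ _ _ _ _ (fun x : R => x ^+ n) _ (@exprn_continuous _ n I) cv.
    by apply: cvgM; exact: cvn.
  exists (I ^+ n * I ^+ n + 1).
  have H : \forall N \near \oo, `|(\sum_(l < N) phi j (tau N l) * (tau N l.+1 - tau N l)) ^+ n *
    (\sum_(l < N) phi j (tau N l) * (tau N l.+1 - tau N l)) ^+ n - I ^+ n * I ^+ n| <= 1.
    by apply: cvgr_distC_le cv2 _ _; exact: ltr01.
  apply: filterS H => N HN.
  have E w : zsum (phi j) ord0 N w ^+ n =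
    (cst ((\sum_(l < N) phi j (tau N l) * (tau N l.+1 - tau N l)) ^+ n) : Omega -> R) w.
    by rewrite zsum0.
  split; first by apply: L2_ext (L2_cst _ _) => w; rewrite E.
  rewrite (eq_ip _ E E) ip_cst -lerBlDl; apply: le_trans HN; exact: ler_norm.
move=> n; exists (8 ^+ n * n`!%:R * Num.sqrt 2).
have := riemann_cvg tT htau (within_continuousM (@cphi j) (@cphi j)).
rewrite ophi eqxx => cv.
have cv1 : \forall N \near \oo, `|\sum_(l < N) phi j (tau N l) * phi j (tau N l) *
    (tau N l.+1 - tau N l) - 1| <= 2^-1.
  by apply: cvgr_distC_le cv _ _; rewrite invr_gt0.
near=> N.
have N0 : (0 < N)%N by near: N; exact: nbhs_infty_gt.
have v1 : `|\sum_(l < N) phi j (tau N l) * phi j (tau N l) *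
    (tau N l.+1 - tau N l) - 1| <= 2^-1 by near: N.
set v := \sum_(l < N) phi j (tau N l) * phi j (tau N l) * (tau N l.+1 - tau N l) in v1.
have v0 : 0 < v by move: v1; rewrite ler_norml; lra.
have v2 : v <= 2 by move: v1; rewrite ler_norml; lra.
have s0 : 0 < Num.sqrt v by rewrite sqrtr_gt0.
have [L1 L2'] := normal_moment n s0
  (L2_measurable (zeta_sum_L2 hF hf t0 htau (phi j) (lift ord0 r') N0)) (zsum_normal r' N0 v0).
split => //; apply: le_trans L2' _; rewrite sqr_sqrtr; last exact: ltW.
rewrite ler_wpM2r ?sqrtr_ge0// ler_wpM2r// lerXn2r// ?nnegrE ?(mulr_ge0 _ (ltW v0))//.
lra.
Unshelve. all: by end_near.
Qed.

Lemma zeta_moments r j : bounded_moments P (fun=> zeta r j).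
Proof.
have LZ : L2 P (zeta r j) by exact: ito_integral_L2 (hzeta _ _).
have [re|[r' re]] := integratorP r.
  have ZI := zeta_sum_cvg hF hf t0 tT htau (@cphi j) (hzeta r j).
  have cv := riemann_cvg tT htau (@cphi j).
  set I := \int[mu]_(x in `[t, T]) phi j x in cv.
  move=> n; exists (I ^+ n ^+ 2); near=> N.
  suff H : sqnorm P (fun w => zeta r j w - I) = 0.
    by have [L1 ->] := ae_cst_moment n LZ H.
  apply/eqP; rewrite eq_le ip_ge0 andbT; apply/ler_addgt0Pr => e e0; rewrite add0r.
  have e4 : 0 < e / 4 by rewrite divr_gt0.
  have cv2 : (\sum_(l < N) phi j (tau N l) * (tau N l.+1 - tau N l) - I) ^+ 2
      @[N --> \oo] --> (0 : R).
    have cB : \sum_(l < N) phi j (tau N l) * (tau N l.+1 - tau N l) - I @[N --> \oo] --> I - I.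
      by apply: cvgB cv _; exact: cvg_cst.
    by under eq_fun do rewrite expr2; have := cvgM cB cB; rewrite subrr mulr0; apply.
  have := ZI => /cvgr0_norm_le/(_ _ e4) H1.
  have := cv2 => /cvgr0_norm_le/(_ _ e4) H2.
  have [M [M0 [H1M H2M]]] := filter_ex (filterI (nbhs_infty_gt 0) (filterI H1 H2)).
  have LM := zeta_sum_L2 hF hf t0 htau (phi j) r M0.
  have E w : zeta r j w - I = (zeta r j w - zsum (phi j) r M w) +
     (zsum (phi j) r M w - I) by rewrite addrA subrK.
  rewrite (eq_ip _ E E); apply: le_trans (ipD_le _ _) _.
  - exact: L2B.
  - by apply: L2B => //; exact: L2_cst.
  have E2 w : zsum (phi j) r M w - I =
      (cst (\sum_(l < M) phi j (tau M l) * (tau M l.+1 - tau M l) - I) : Omega -> R) w.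
    by rewrite re zsum0.
  rewrite (eq_ip _ E2 E2) ip_cst ipBC.
  move: H1M; rewrite ger0_norm ?ip_ge0// => H1M.
  move: H2M; rewrite ger0_norm ?sqr_ge0// expr2 => H2M.
  lra.
move=> n; exists ((4 * 1 ^+ 2) ^+ n * n`!%:R * Num.sqrt 2); near=> N.
apply: (normal_moment n ltr01 (L2_measurable LZ)).
by rewrite re => B mB; apply: (zeta_normal hF hf t0 tT htau cphi ophi hzeta).
Unshelve. all: by end_near.
Qed.

Lemma zeta_prod_cvg (k : nat) (i : 'I_k -> 'I_m.+1) (j : 'I_k -> nat) :
  [/\ bounded_moments P (fun N w => \prod_(q < k) zsum (phi (j q)) (i q) N w),
      L2 P (fun w => \prod_(q < k) zeta (i q) (j q) w) &
   sqnorm P (fun w => \prod_(q < k) zsum (phi (j q)) (i q) N w - \prod_(q < k) zeta (i q) (j q) w)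
     @[N --> \oo] --> (0 : R)].
Proof.
have [h1 h2 h3] := prod_mean_square_cvg (index_enum 'I_k)
  (fun q => zeta_sum_moments (i q) (j q)) (fun q => zeta_moments (i q) (j q))
  (fun q => zeta_sum_cvg hF hf t0 tT htau (@cphi (j q)) (hzeta (i q) (j q))).
by split => //; have /filter_ex[N] := bounded_moments_L2 h2.
Qed.

End zeta_moments.

(** * Sorting tuples of distinct indices *)

Section ordering.
Variables (k N : nat).
Implicit Types (l : {ffun 'I_k -> 'I_N}) (u : 'S_k).

Definition increasing l := [forall g : 'I_k, forall r : 'I_k, (g < r)%N ==> (l g < l r)%N].

Lemma increasingP l : reflect (forall g r : 'I_k, (g < r)%N -> (l g < l r)%N) (increasing l).
Proof.
apply: (iffP forallP) => [H g r|H g]; first by have /forallP/(_ r)/implyP := H g.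
by apply/forallP => r; apply/implyP; exact: H.
Qed.

Lemma L_setP l : reflect (injective l) (l \in L_set k N).
Proof.
rewrite inE inE /=; apply: (iffP forallP) => [H g r|H g].
  by apply: contra_eq => gr; have /forallP/(_ r)/implyP/(_ gr) := H g.
by apply/forallP => r; apply/implyP; apply: contra_neq => /H.
Qed.

Lemma increasing_inj l : increasing l -> injective l.
Proof.
move=> /increasingP H g r lgr; apply/val_inj/eqP; rewrite eqn_leq.
apply/andP; split; rewrite leqNgt; apply/negP => /H; by rewrite lgr ltnn.
Qed.

(** The position of [q] when the values of [l] are sorted. *)
Definition rank l (q : 'I_k) : nat := #|[pred r | (l r < l q)%N]|.

Let rank_ltk l q : (rank l q < k)%N.
Proof.
rewrite /rank -[X in (_ < X)%N](card_ord k); apply: proper_card.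
apply/properP; split; first by apply/fintype.subsetP.
by exists q; rewrite ?inE// ltnn.
Qed.

Let rank_lt l q r : (l q < l r)%N -> (rank l q < rank l r)%N.
Proof.
move=> qr; apply: proper_card; apply/properP; split.
  by apply/fintype.subsetP => x; rewrite !inE => /ltn_trans; apply.
by exists q; rewrite !inE ?ltnn.
Qed.

Let rank_inj l : injective l -> injective (fun q => Ordinal (rank_ltk l q)).
Proof.
move=> li q r /(congr1 val)/= qr; apply: li; apply/val_inj/eqP; rewrite eqn_leq.
by apply/andP; split; rewrite leqNgt; apply/negP => /rank_lt; rewrite qr ltnn.
Qed.

Let rank_increasing l : injective l -> increasing l = [forall q, rank l q == q].
Proof.
move=> li; apply/idP/forallP => [/increasingP H q|H].
  rewrite /rank; apply/eqP; rewrite -[RHS](card_ord q).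
  have qk : (q <= k)%N by exact: ltnW.
  have wi : injective (widen_ord qk) by move=> x y /(congr1 val)/= /val_inj.
  rewrite -(fintype.card_image wi).
  apply: eq_card => r; rewrite inE; apply/idP/fintype.imageP => [rq|[x _ ->]].
    have rq' : (r < q)%N.
      rewrite ltnNge; apply/negP; rewrite leq_eqVlt => /predU1P[/val_inj e|/H].
        by rewrite e ltnn in rq.
      by rewrite ltnNge ltnW.
    by exists (Ordinal rq') => //; apply/val_inj.
  by apply: H; exact: (ltn_ord (x : 'I_q)).
apply/increasingP => g r gr; rewrite ltnNge leq_eqVlt; apply/negP => /predU1P[/val_inj/li e|].
  by rewrite e ltnn in gr.
move=> /rank_lt; rewrite (eqP (H g)) (eqP (H r)) => /(ltn_trans gr).
by rewrite ltnn.
Qed.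

Let rank_perm l u q : rank [ffun x => l (u x)] q = rank l (u q).
Proof.
rewrite /rank -(fintype.card_image (@perm_inj _ u)).
apply: eq_card => r; rewrite inE; apply/fintype.imageP/idP => [[x]|rq].
  by rewrite inE !ffunE => xq ->.
exists (u^-1%g r); last by rewrite permKV.
by rewrite inE !ffunE permKV.
Qed.

(** Each tuple of distinct indices is sorted by exactly one permutation, the
    one given by the ranks. *)
Lemma sum_L_set (V : zmodType) (h : {ffun 'I_k -> 'I_N} -> V) :
  \sum_(l in L_set k N) h l =
  \sum_(u : 'S_k) \sum_(l | increasing l) h [ffun q => l (u^-1%g q)].
Proof.
transitivity (\sum_(l in L_set k N) \sum_(u : 'S_k | increasing [ffun x => l (u x)]) h l).
  apply: eq_bigr => l /L_setP li.
  rewrite (big_pred1 (perm (rank_inj li))^-1%g)// => u.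
  have lui : injective [ffun x => l (u x)].
    by move=> x y; rewrite !ffunE => /li/perm_inj.
  rewrite /= rank_increasing//; apply/forallP/eqP => [H|-> q].
    apply/permP => q; apply/(canRL (permK _))/val_inj; rewrite permE /=.
    by have /eqP := H q; rewrite rank_perm.
  by rewrite rank_perm -[X in _ == val X](permKV (perm (rank_inj li)) q) permE.
rewrite (exchange_big_dep predT)//=; apply: eq_bigr => u _.
rewrite (reindex (fun l => [ffun q => l (u^-1%g q)])); last first.
  exists (fun l => [ffun q => l (u q)]) => l _; apply/ffunP => q; rewrite !ffunE.
    by rewrite permK.
  by rewrite permKV.
apply: eq_bigl => l.
have -> : [ffun x => [ffun q => l (u^-1%g q)] (u x)] = l.
  by apply/ffunP => q; rewrite !ffunE permK.
apply: andb_idl => /increasing_inj li; apply/L_setP => x y; rewrite !ffunE => /li.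
by move=> /perm_inj.
Qed.

End ordering.

Section extension.
Variables (k N : nat).

Definition ffun_rcons (l : {ffun 'I_k -> 'I_N}) (x : 'I_N) : {ffun 'I_k.+1 -> 'I_N} :=
  [ffun q => if unlift ord_max q is Some r then l r else x].

Lemma widen_lift (q : 'I_k) : widen_ord (leqnSn k) q = lift ord_max q.
Proof. by apply/val_inj; rewrite /= /bump leqNgt ltn_ord. Qed.

Lemma ffun_rcons_widen l x q : ffun_rcons l x (widen_ord (leqnSn k) q) = l q.
Proof. by rewrite ffunE widen_lift liftK. Qed.

Lemma ffun_rcons_max l x : ffun_rcons l x ord_max = x.
Proof. by rewrite ffunE unlift_none. Qed.

Lemma increasing_rcons l x :
  increasing (ffun_rcons l x) = increasing l && [forall q, (l q < x)%N].
Proof.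
apply/increasingP/andP => [H|[/increasingP H /forallP Hx] g r].
  split.
    apply/increasingP => g r gr.
    by have := H (widen_ord (leqnSn k) g) (widen_ord (leqnSn k) r) gr; rewrite !ffun_rcons_widen.
  apply/forallP => q; have := H (widen_ord (leqnSn k) q) ord_max (ltn_ord q).
  by rewrite ffun_rcons_widen ffun_rcons_max.
have [r' ->|->] := unliftP ord_max r; have [g' ->|->] := unliftP ord_max g.
- by rewrite -!widen_lift !ffun_rcons_widen => /H.
- by rewrite -widen_lift /= ltnNge ltnW.
- by rewrite -widen_lift ffun_rcons_widen ffun_rcons_max => _; exact: Hx.
- by rewrite ltnn.
Qed.

Lemma sum_ffun_rcons (V : zmodType) (h : {ffun 'I_k.+1 -> 'I_N} -> V) :
  \sum_l h l = \sum_x \sum_l h (ffun_rcons l x).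
Proof.
rewrite pair_big/= (reindex (fun p : 'I_N * {ffun 'I_k -> 'I_N} => ffun_rcons p.2 p.1))//.
exists (fun l : {ffun 'I_k.+1 -> 'I_N} => (l ord_max, [ffun q => l (widen_ord (leqnSn k) q)])).
  move=> [x l] _ /=; rewrite ffun_rcons_max; congr pair; apply/ffunP => q.
  by rewrite ffunE ffun_rcons_widen.
move=> l _; apply/ffunP => q; rewrite ffunE /=.
by case: unliftP => [r ->|->]//; rewrite ffunE widen_lift.
Qed.

End extension.

(** * Stochastic sums over distinct cells *)

Lemma sum_increasing_rcons k N (V : zmodType) (h : {ffun 'I_k.+1 -> 'I_N} -> V) n :
  \sum_(l | increasing l && [forall q, (l q < n)%N]) h l =
  \sum_(x < N | (x < n)%N) \sum_(l | increasing l && [forall q, (l q < x)%N]) h (ffun_rcons l x).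
Proof.
rewrite big_mkcond sum_ffun_rcons [RHS]big_mkcond; apply: eq_bigr => x _.
have E (l : {ffun 'I_k -> 'I_N}) :
    increasing (ffun_rcons l x) && [forall q, (ffun_rcons l x q < n)%N] =
    (x < n)%N && (increasing l && [forall q, (l q < x)%N]).
  rewrite increasing_rcons andbC; apply/andP/andP => -[] H /andP[il lx].
    have /forallP/(_ ord_max) := H; rewrite ffun_rcons_max => xn.
    by rewrite xn il.
  split; last by rewrite il.
  apply/forallP => q; rewrite ffunE; case: unliftP => [r _|//].
  by apply: ltn_trans H; move/forallP : lx; apply.
under eq_bigr do rewrite E.
case: ifP => xn; last by rewrite big1.
by rewrite [RHS]big_mkcond.
Qed.

Section ordered_sums.
Context (R : realType) (d : measure_display) (Omega : measurableType d)
  (P : probability Omega R) (T : R) (F : R -> set_system Omega) (m : nat)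
  (f : 'I_m -> R -> Omega -> R).
Hypotheses (hF : filtration T F) (hf : wiener_process P T F f).
Variables (t : R) (N : nat) (s : nat -> R).
Hypotheses (t0 : 0 <= t) (tT : t <= T) (hs : is_partition t T N s).
Notation mu := (@lebesgue_measure R).

Let T0 : 0 <= T := le_trans t0 tT.

Definition cell_incr (i : 'I_m.+1) (x : nat) (w : Omega) : R :=
  integrator f i (s x.+1) w - integrator f i (s x) w.

Definition cell_prod k (i : 'I_k -> 'I_m.+1) (l : {ffun 'I_k -> 'I_N}) (w : Omega) : R :=
  \prod_(q < k) cell_incr (i q) (l q) w.

Definition cell_volume k (l : {ffun 'I_k -> 'I_N}) : R :=
  \prod_(q < k) (s (l q).+1 - s (l q)).

(** The bound [n] on the indices makes room for a further, larger index: it is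
    the variable of the recursion in [ordered_sumS]. *)
Definition ordered_sum k (i : 'I_k -> 'I_m.+1) (a : {ffun 'I_k -> 'I_N} -> R) (n : nat)
    (w : Omega) : R :=
  \sum_(l | increasing l && [forall q, (l q < n)%N]) a l * cell_prod i l w.

Let sl (x : nat) : (x <= N)%N -> t <= s x <= T. Proof. exact: partition_bounds. Qed.

Let sS (x : 'I_N) : s x <= s x.+1.
Proof. by apply: (partition_le hs); rewrite leqnSn ltn_ord. Qed.

Lemma ordered_sumS k (i : 'I_k.+1 -> 'I_m.+1) a n w :
  ordered_sum i a n w = \sum_(x < N | (x < n)%N)
    ordered_sum (init i) (fun l => a (ffun_rcons l x)) x w *
    cell_incr (i ord_max) x w.
Proof.
rewrite /ordered_sum sum_increasing_rcons; apply: eq_bigr => x _.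
rewrite mulr_suml; apply: eq_bigr => l _; rewrite -mulrA; congr (_ * _).
rewrite /cell_prod big_ord_recr/= ffun_rcons_max; congr (_ * _).
by apply: eq_bigr => q _; rewrite ffun_rcons_widen.
Qed.

Lemma ordered_sum_scale k (i : 'I_k -> 'I_m.+1) c a n w :
  ordered_sum i (fun l => a l * c) n w = c * ordered_sum i a n w.
Proof. by rewrite mulr_sumr; apply: eq_bigr => l _; ring. Qed.

(** At a node, clamping drops the cells to the right of it, so expanding the
    nested sums yields the increasing tuples. *)
Lemma iterated_sum_ordered k (i : 'I_k -> 'I_m.+1) (psi : 'I_k -> R -> R) n w :
  (n <= N)%N -> iterated_sum f i psi s N (s n) w =
    ordered_sum i (fun l => \prod_(q < k) psi q (s (l q))) n w.
Proof.
elim: k i psi n => [|k ih] i psi n nN.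
  rewrite /ordered_sum /=.
  have l0E (l : {ffun 'I_0 -> 'I_N}) : l = ffun0 (card_ord 0) by apply/ffunP => -[].
  rewrite (big_pred1 (ffun0 (card_ord 0))) ?/cell_prod ?big_ord0 ?mulr1//.
  move=> l /=; rewrite [l]l0E eqxx; apply/andP; split; last by apply/forallP => -[].
  by apply/increasingP => -[].
rewrite ordered_sumS /= [RHS]big_mkcond; apply: eq_bigr => x _.
case: ifP => xn; last first.
  have nx : (n <= x)%N by rewrite leqNgt xn.
  have h1 : s n <= s x by apply: (partition_le hs); rewrite nx ltnW.
  have h2 : s n <= s x.+1 by exact: le_trans h1 (sS x).
  by rewrite !min_r// subrr mulr0.
have h2 : s x.+1 <= s n by apply: (partition_le hs); rewrite xn nN.
have h1 : s x <= s n by exact: le_trans (sS x) h2.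
rewrite !min_l// ih; last exact: ltnW.
congr (_ * _); rewrite -ordered_sum_scale; apply: eq_bigr => l _; congr (_ * _).
rewrite big_ord_recr/= ffun_rcons_max; congr (_ * _).
by apply: eq_bigr => q _; rewrite ffun_rcons_widen.
Qed.

Lemma ito_le_cells (eta : 'I_N -> Omega -> R) i :
  (forall j : 'I_N, adapted_to (F (s j)) (eta j)) -> (forall j, L2 P (eta j)) ->
  L2 P (fun w => \sum_j eta j w * cell_incr i j w) /\
  sqnorm P (fun w => \sum_j eta j w * cell_incr i j w) <=
  ito_const T * \sum_j sqnorm P (eta j) * (s j.+1 - s j).
Proof.
move=> ae Le.
have ab := partition_cell_bounds hs.
split.
  exact: (@L2_ito _ _ _ P T F m f hF hf _ eta (fun j => s j) (fun j => s j.+1) t T).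
apply: le_trans (@ito_le _ _ _ P T F m f hF hf T0 _ eta (fun j => s j) (fun j => s j.+1) t T
  t0 tT (lexx T) ab (fun j _ => ae j) Le i) _.
rewrite ler_wpM2l ?ito_const_ge0//; apply: le_of_eq.
have mI : measurable (`[t, T[ : set (measurableTypeR R)) by exact: measurable_itv.
have i1 (j : 'I_N) : mu.-integrable `[t, T[ (EFin \o
    (fun x => sqnorm P (eta j) * \1_`[s j, s j.+1[ x)).
  have := integrableZl mI (sqnorm P (eta j)) (integrable_indic_co (s j) (s j.+1) mI).
  exact: eq_integrable.
have [i2 E] := Rint_sum_in (index_enum 'I_N) mI i1.
transitivity (\int[mu]_(x in `[t, T[) \sum_j sqnorm P (eta j) * \1_`[s j, s j.+1[ x).
  apply: eq_Rintegral => v /set_mem; rewrite /= in_itv/= => /andP[tv vT].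
  have [l ll] := partition_cell hs tv vT.
  have E1 w : \sum_j eta j w * \1_`[s j, s j.+1[ v = eta l w.
    exact: (step_cell (fun j => eta j w) hs ll).
  by rewrite (eq_ip _ E1 E1) (step_cell (fun j => sqnorm P (eta j)) hs ll).
rewrite E; apply: eq_bigr => j _; rewrite RintegralZl//; last exact: integrable_indic_co.
by have [h1 h2 h3] := ab j; rewrite integral_indic_co.
Qed.

(** The largest index carries the increment, and the sum over the other
    indices is measurable with respect to the past of that increment: each
    level of the recursion costs one factor [ito_const]. *)
Lemma ordered_sum_le k (i : 'I_k -> 'I_m.+1) a n : (n <= N)%N ->
  [/\ adapted_to (F (s n)) (ordered_sum i a n), L2 P (ordered_sum i a n) &
   sqnorm P (ordered_sum i a n) <=
   ito_const T ^+ k * \sum_(l | increasing l && [forall q, (l q < n)%N]) a l ^+ 2 * cell_volume l].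
Proof.
elim: k i a n => [|k ih] i a n nN.
  have l0E (l : {ffun 'I_0 -> 'I_N}) : l = ffun0 (card_ord 0) by apply/ffunP => -[].
  have cond : (fun l : {ffun 'I_0 -> 'I_N} => increasing l && [forall q, (l q < n)%N]) =1
      pred1 (ffun0 (card_ord 0)).
    move=> l /=; rewrite [l]l0E eqxx; apply/andP; split; last by apply/forallP => -[].
    by apply/increasingP => -[].
  have E : ordered_sum i a n = cst (a (ffun0 (card_ord 0))).
    by apply/funext => w; rewrite /ordered_sum (big_pred1 _ cond) /cell_prod big_ord0 mulr1.
  rewrite E; split; [|exact: L2_cst|].
    have /andP[h1 h2] := sl nN.
    by apply: adapted_cst; apply: (filtration_sa hF) => //; exact: le_trans h1.
  by rewrite ip_cst (big_pred1 _ cond) /cell_volume big_ord0 expr0 mulr1 mul1r expr2.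
pose eta (x : 'I_N) : Omega -> R := if (x < n)%N then
  ordered_sum (init i) (fun l => a (ffun_rcons l x)) x else cst 0.
have H (x : 'I_N) := ih (init i) (fun l => a (ffun_rcons l x)) x (ltnW (ltn_ord x)).
have sG (x : nat) : (x <= N)%N -> sigma_algebra setT (F (s x)).
  by move=> /sl/andP[h1 h2]; apply: (filtration_sa hF) => //; exact: le_trans h1.
have ae (x : 'I_N) : adapted_to (F (s x)) (eta x).
  rewrite /eta; case: ifP => _; first by have [] := H x.
  by apply: adapted_cst; apply: sG; exact: ltnW.
have Le x : L2 P (eta x).
  by rewrite /eta; case: ifP => _; [have [] := H x|exact: L2_0].
have E : ordered_sum i a n = (fun w => \sum_x eta x w * cell_incr (i ord_max) x w).
  apply/funext => w; rewrite ordered_sumS big_mkcond; apply: eq_bigr => x _.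
  by rewrite /eta; case: ifP; rewrite ?mul0r.
have [L1 Lle] := ito_le_cells (i ord_max) ae Le.
rewrite E; split; [|exact: L1|].
  apply: (adapted_sum (sG n nN)) => x; rewrite /eta; case: ifP => xn; last first.
    rewrite (_ : (fun w => _) = cst 0); first by apply: adapted_cst; exact: sG.
    by apply/funext => w; rewrite mul0r.
  have /andP[h1 h2] := sl nN; have /andP[h3 h4] := sl (ltnW (ltn_ord x)).
  have h5 : s x.+1 <= s n by apply: (partition_le hs); rewrite xn nN.
  apply: (adaptedM (sG n nN)).
    have [+ _ _] := H x; apply: (filtrationS hF) => //; first exact: le_trans h3.
    exact: le_trans h5.
  by apply: (dw_adapted hF hf) => //; exact: le_trans h3.
apply: le_trans Lle _; rewrite exprS -mulrA ler_wpM2l ?ito_const_ge0//.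
rewrite sum_increasing_rcons mulr_sumr [leRHS]big_mkcond; apply: ler_sum => x _.
rewrite /eta; case: ifP => xn; last first.
  by rewrite ip_cst mulr0 mul0r.
have [_ _ Hx] := H x.
apply: (@le_trans _ _ ((ito_const T ^+ k * \sum_(l | increasing l && [forall q, (l q < x)%N])
   a (ffun_rcons l x) ^+ 2 * cell_volume l) * (s x.+1 - s x))).
  by rewrite ler_wpM2r// subr_ge0.
rewrite -mulrA mulr_suml; apply: le_of_eq; congr (_ * _).
apply: eq_bigr => l _; rewrite -mulrA; congr (_ * _).
rewrite /cell_volume big_ord_recr/= ffun_rcons_max; congr (_ * _).
by apply: eq_bigr => q _; rewrite ffun_rcons_widen.
Qed.

Definition distinct_sum k (i : 'I_k -> 'I_m.+1) (a : {ffun 'I_k -> 'I_N} -> R) (w : Omega) : R :=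
  \sum_(l in L_set k N) a l * cell_prod i l w.

Let allN k (l : {ffun 'I_k -> 'I_N}) : [forall q, (l q < N)%N].
Proof. by apply/forallP. Qed.

Lemma distinct_sum_ordered k (i : 'I_k -> 'I_m.+1) a w :
  distinct_sum i a w =
  \sum_(u : 'S_k) ordered_sum (i \o u) (fun l => a [ffun q => l (u^-1%g q)]) N w.
Proof.
rewrite /distinct_sum sum_L_set; apply: eq_bigr => u _.
apply: eq_big => [l|l _]; first by rewrite allN andbT.
congr (_ * _); rewrite /cell_prod (reindex_inj (@perm_inj _ u))/=.
by apply: eq_bigr => q _; rewrite ffunE permK.
Qed.

(** The k! sums over increasing tuples are bounded separately and combined by
    Cauchy-Schwarz. *)
Lemma distinct_sum_le k (i : 'I_k -> 'I_m.+1) a :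
  L2 P (distinct_sum i a) /\
  sqnorm P (distinct_sum i a) <=
  #|{: 'S_k}|%:R * (ito_const T ^+ k * \sum_(l in L_set k N) a l ^+ 2 * cell_volume l).
Proof.
pose Y (u : 'S_k) := ordered_sum (i \o u) (fun l => a [ffun q => l (u^-1%g q)]) N.
have E : distinct_sum i a = (fun w => \sum_u Y u w).
  by apply/funext => w; rewrite distinct_sum_ordered.
have HY (u : 'S_k) := ordered_sum_le (i \o u) (fun l => a [ffun q => l (u^-1%g q)]) (leqnn N).
have LY u : L2 P (Y u) by have [] := HY u.
rewrite E; split; first by apply: L2_sum => u _.
apply: le_trans (ip_sum_le LY) _; rewrite ler_wpM2l//.
rewrite sum_L_set mulr_sumr; apply: ler_sum => u _.
have [_ _ /le_trans] := HY u; apply; rewrite ler_wpM2l ?exprn_ge0 ?ito_const_ge0//.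
apply: le_of_eq.
apply: eq_big => [l|l _]; first by rewrite allN andbT.
congr (_ * _); rewrite /cell_volume [RHS](reindex_inj (@perm_inj _ u))/=.
by apply: eq_bigr => q _; rewrite ffunE permK.
Qed.

Lemma distinct_sum_prod k (i : 'I_k -> 'I_m.+1) (psi : 'I_k -> R -> R) w :
  distinct_sum i (fun l => \prod_(q < k) psi q (s (l q))) w =
  \sum_(u : 'S_k) iterated_sum f (i \o u) (psi \o u) s N T w.
Proof.
have [_ sN _] := hs; rewrite distinct_sum_ordered -{1}sN.
apply: eq_bigr => u _; rewrite iterated_sum_ordered//.
apply: eq_bigr => l _; congr (_ * _); rewrite (reindex_inj (@perm_inj _ u))/=.
by apply: eq_bigr => q _; rewrite ffunE permK.
Qed.

(** The factor [increasing l] is the value at the nodes of the indicator in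
    the kernel. *)
Lemma distinct_sum_increasing k (i : 'I_k -> 'I_m.+1) (psi : 'I_k -> R -> R) w :
  distinct_sum i (fun l => (increasing l)%:R * \prod_(q < k) psi q (s (l q))) w =
  iterated_sum f i psi s N T w.
Proof.
have [_ sN _] := hs; rewrite -{1}sN iterated_sum_ordered//.
rewrite /distinct_sum /ordered_sum big_mkcond [RHS]big_mkcond; apply: eq_bigr => l _.
rewrite allN andbT; case: ifPn => [_|lL]; first by case: ifP; rewrite ?mul1r ?mul0r.
by case: ifPn => // /increasing_inj/L_setP; rewrite (negbTE lL).
Qed.

Lemma H_set_prod k (i : 'I_k -> 'I_m.+1) (psi : 'I_k -> R -> R) w :
  \sum_(l in H_set k N) (\prod_(q < k) psi q (s (l q))) * cell_prod i l w =
  \prod_(q < k) \sum_(x < N) psi q (s x) * cell_incr (i q) x w.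
Proof.
rewrite bigA_distr_bigA; apply: eq_big => [l|l _]; first by rewrite inE.
by rewrite -big_split.
Qed.

(** A sum over all tuples of a product of weights is a product of sums. *)
Lemma G_set_sum k (i : 'I_k -> 'I_m.+1) (psi : 'I_k -> R -> R) w :
  \sum_(l in G_set k N) \prod_(q < k) (psi q (s (l q)) * cell_incr (i q) (l q) w) =
  \prod_(q < k) (\sum_(x < N) psi q (s x) * cell_incr (i q) x w) -
  distinct_sum i (fun l => \prod_(q < k) psi q (s (l q))) w.
Proof.
rewrite -H_set_prod /distinct_sum [X in _ = X - _](big_setID (L_set k N))/=.
have -> : H_set k N :&: L_set k N = L_set k N.
  by apply/setP => l; rewrite !inE andbA andbb.
rewrite addrC addrK; apply: eq_bigr => l _.
by rewrite big_split.
Qed.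

End ordered_sums.

(** * Products of functions of one variable *)

Section tensor.
Context (R : realType).
Notation mu := (@lebesgue_measure R).
Notation RT := (measurableTypeR R).

Definition tuple_tail k (x : k.+1.-tuple R) : k.-tuple R := [tuple of behead x].

Lemma tuple_tailK k (p : RT * k.-tuple R) : tuple_tail (tuple_cons p) = p.2.
Proof. exact/val_inj. Qed.

Lemma tnth_tail k (x : k.+1.-tuple R) q : tnth (tuple_tail x) q = tnth x (lift ord0 q).
Proof.
rewrite [LHS]tnth_behead; congr (tnth x _); apply/val_inj.
by rewrite /= inordK// ltnS.
Qed.

Lemma prod_tnthS k (u : 'I_k.+1 -> R -> R) (x : k.+1.-tuple R) :
  \prod_(q < k.+1) u q (tnth x q) =
  u ord0 (tnth x ord0) * \prod_(q < k) u (lift ord0 q) (tnth (tuple_tail x) q).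
Proof. by rewrite big_ord_recl; congr (_ * _); apply: eq_bigr => q _; rewrite tnth_tail. Qed.

Lemma measurable_tail k : measurable_fun setT (@tuple_tail k).
Proof. exact: measurable_behead. Qed.

(** Fubini, [lebesgue_tuple R k.+1] being the image of a product measure. *)
Lemma tensor_integral k (f : R -> R) (g : k.-tuple R -> R) :
  mu.-integrable setT (EFin \o f) -> (lebesgue_tuple R k).-integrable setT (EFin \o g) ->
  (lebesgue_tuple R k.+1).-integrable setT
     (EFin \o (fun x => f (tnth x ord0) * g (tuple_tail x))) /\
  \int[lebesgue_tuple R k.+1]_x (f (tnth x ord0) * g (tuple_tail x)) =
  \int[mu]_y f y * \int[lebesgue_tuple R k]_y g y.
Proof.
move=> iF ig.
pose nu := lebesgue_tuple R k.
have mf : measurable_fun setT (f : RT -> R) by apply/measurable_EFinP; exact: (measurable_int mu).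
have mg : measurable_fun setT g by apply/measurable_EFinP; exact: (measurable_int nu).
have mfg : measurable_fun setT (fun p : RT * k.-tuple R => f p.1 * g p.2).
  by apply: measurable_funM; exact: measurableT_comp.
have mh : measurable_fun setT (fun x : k.+1.-tuple R => f (tnth x ord0) * g (tuple_tail x)).
  apply: measurable_funM.
    by apply: measurableT_comp => //; exact: measurable_tnth.
  by apply: measurableT_comp => //; exact: measurable_tail.
have ing := integrable_norm ig.
have inf := integrable_norm iF.
set c := \int[nu]_y `|g y|.
have cE : (\int[nu]_y (`|g y|)%:E = c%:E)%E.
  by rewrite /c /Rintegral fineK//; apply: integrable_fin_num => //; exact: ing.
have i12 : (mu \x nu)%E.-integrable setT (EFin \o (fun p : RT * k.-tuple R => f p.1 * g p.2)).
  apply/integrable12ltyP; first exact/measurable_EFinP.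
  have -> : (fun x : RT => (\int[nu]_y `|(EFin \o (fun p : RT * k.-tuple R => f p.1 * g p.2)%R) (x, y)|)%E)
     = (fun x : RT => (c * `|f x|)%:E).
    apply/funext => x /=.
    under eq_integral do rewrite normrM EFinM.
    rewrite ge0_integralZl//; last exact: (measurable_int nu ing).
    by rewrite cE -EFinM mulrC.
  have := integrableZl measurableT c inf.
  move=> /integrable_lty; apply => //.
have i1 : (mu \x nu)%E.-integrable (@tuple_cons R k @^-1` setT)
    ((EFin \o (fun x => f (tnth x ord0) * g (tuple_tail x))) \o (@tuple_cons R k)).
  rewrite preimage_setT; move: i12; apply: eq_integrable => // p _ /=.
  by rewrite tuple_tailK.
have mh' : measurable_fun setT (EFin \o (fun x : k.+1.-tuple R => f (tnth x ord0) * g (tuple_tail x))).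
  exact/measurable_EFinP.
split; first exact: (integrable_pushforward (@measurable_tuple_cons R k) mh' i1 measurableT).
rewrite /Rintegral.
have -> : (\int[lebesgue_tuple R k.+1]_x (f (tnth x ord0) * g (tuple_tail x))%:E =
   \int[(mu \x nu)%E]_p (f p.1 * g p.2)%:E)%E.
  rewrite [LHS](integral_pushforward (@measurable_tuple_cons R k) mh' i1 measurableT).
  rewrite preimage_setT; apply: eq_integral => p _ /=.
  by rewrite tuple_tailK.
rewrite -(integral12_prod_meas1 i12).
have -> : fubini_F nu (EFin \o (fun p : RT * k.-tuple R => f p.1 * g p.2)) =
   (fun x : RT => (f x * \int[nu]_y g y)%:E).
  apply/funext => x; rewrite /fubini_F /=.
  under eq_integral do rewrite EFinM.
  rewrite integralZl// EFinM; congr (_ * _)%E.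
  by rewrite /Rintegral fineK//; apply: integrable_fin_num => //; exact: ig.
rewrite -/(Rintegral mu setT (fun x => f x * \int[nu]_y g y)).
by rewrite RintegralZr.
Qed.

Notation mu_ k := (lebesgue_tuple R k).

Lemma tensor_L2 k (a : R -> R) (A : k.-tuple R -> R) : L2 mu a -> L2 (mu_ k) A ->
  L2 (mu_ k.+1) (fun x => a (tnth x ord0) * A (tuple_tail x)).
Proof.
move=> [ma ia] [mA iA]; split.
  apply: measurable_funM.
    by apply: (measurableT_comp (f := a : RT -> R)) => //; exact: measurable_tnth.
  by apply: measurableT_comp => //; exact: measurable_tail.
have [+ _] := tensor_integral ia iA; apply: eq_integrable => // x _ /=.
by rewrite exprMn.
Qed.

Lemma tensor_ip k (a b : R -> R) (A B : k.-tuple R -> R) : L2 mu a -> L2 mu b ->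
  L2 (mu_ k) A -> L2 (mu_ k) B ->
  ip (mu_ k.+1) (fun x => a (tnth x ord0) * A (tuple_tail x))
    (fun x => b (tnth x ord0) * B (tuple_tail x)) = ip mu a b * ip (mu_ k) A B.
Proof.
move=> La Lb LA LB.
have [_ <-] := tensor_integral (L2M_integrable La Lb) (L2M_integrable LA LB).
by apply: eq_Rintegral => x _; ring.
Qed.

Lemma prod_L2 k (u : 'I_k -> R -> R) : (forall q, L2 mu (u q)) ->
  L2 (mu_ k) (fun x => \prod_(q < k) u q (tnth x q)).
Proof.
elim: k u => [|k ih] u Lu.
  apply: (@L2_ext _ _ _ _ (cst 1)); first by move=> x; rewrite big_ord0.
  split => //; apply: measurable_bounded_integrable => //.
  - by rewrite /= diracT ltry.
  - by apply: measurable_funX; exact: measurable_cst.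
  - by exists 1; split => // y y1 x _ /=; rewrite expr1n normr1 ltW.
apply: L2_ext (tensor_L2 (Lu ord0) (ih _ (fun q => Lu (lift ord0 q)))) => x.
by rewrite prod_tnthS.
Qed.

Lemma prod_ip k (u v : 'I_k -> R -> R) : (forall q, L2 mu (u q)) -> (forall q, L2 mu (v q)) ->
  ip (mu_ k) (fun x => \prod_(q < k) u q (tnth x q)) (fun x => \prod_(q < k) v q (tnth x q)) =
  \prod_(q < k) ip mu (u q) (v q).
Proof.
elim: k u v => [|k ih] u v Lu Lv.
  rewrite big_ord0.
  have E (w : 'I_0 -> R -> R) (x : 0.-tuple R) :
    \prod_(q < 0) w q (tnth x q) = (cst 1 : 0.-tuple R -> R) x by rewrite big_ord0.
  rewrite (eq_ip _ (E u) (E v)) /ip; under eq_Rintegral do rewrite /= mulr1.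
  have H0 : mu_ 0 setT = 1%E by exact: diracT.
  by rewrite Rintegral_cst// mul1r; exact: (congr1 fine H0).
rewrite big_ord_recl -ih => [|q|q]; [|exact: Lu|exact: Lv].
rewrite -(tensor_ip (Lu ord0) (Lv ord0) (prod_L2 (fun q => Lu (lift ord0 q)))
  (prod_L2 (fun q => Lv (lift ord0 q)))).
by apply: eq_ip => x; rewrite prod_tnthS.
Qed.

End tensor.

(** * Cells of a partition *)

Lemma Rdominated_convergence d (T : measurableType d) (R : realType)
    (mu : {measure set T -> \bar R}) (f_ : nat -> T -> R) (f G : T -> R) :
  (forall n, measurable_fun setT (f_ n)) -> (forall x, f_ n x @[n --> \oo] --> f x) ->
  mu.-integrable setT (EFin \o G) -> (forall n x, `|f_ n x| <= G x) ->
  [/\ measurable_fun setT f, mu.-integrable setT (EFin \o f) &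
      \int[mu]_x f_ n x @[n --> \oo] --> \int[mu]_x f x].
Proof.
move=> mf_ cf iG fG.
have mf : measurable_fun setT f by apply: (measurable_fun_cvg mf_) => x _.
have ae1 : {ae mu, forall x, setT x -> (f_ n x)%:E @[n --> \oo] --> (f x)%:E}.
  by apply: aeW => x _; apply: cvg_EFin; [exact: nearW|exact: cf].
have ae2 : {ae mu, forall x n, setT x -> (`|(f_ n x)%:E| <= (G x)%:E)%E}.
  by apply: aeW => x n _; exact: fG.
have [i1 _ i3] := @dominated_convergence _ _ _ mu setT measurableT
  (fun n => EFin \o f_ n) (EFin \o f) (EFin \o G)
  (fun n => (measurable_EFinP _ _).2 (mf_ n)) ((measurable_EFinP _ _).2 mf)
  ae1 iG ae2.
split => //.
have i4 n : mu.-integrable setT (EFin \o f_ n).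
  apply: le_integrable iG => //; first exact/measurable_EFinP.
  by move=> x _; rewrite /= lee_fin (le_trans (fG n x))// ler_norm.
rewrite /Rintegral; apply: fine_cvg; rewrite fineK; last exact: integrable_fin_num.
exact: i3.
Qed.

Section cells.
Context (R : realType) (t T : R) (n : nat) (s : nat -> R).
Hypotheses (tT : t <= T) (hs : is_partition t T n.+1 s).
Notation mu := (@lebesgue_measure R).

(** The index of the cell that contains x: the number of interior nodes up to
    x. The last cell is closed, so that the end point T needs no separate
    treatment. *)
Definition cell (x : R) : nat := \sum_(1 <= j < n.+1) (s j <= x)%R.

Lemma cell_lt x : (cell x < n.+1)%N.
Proof.
rewrite ltnS /cell; apply: (@leq_trans (\sum_(1 <= j < n.+1) 1)).
  by apply: leq_sum => j _; case: (_ <= _).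
by rewrite sum_nat_const_nat muln1 subn1.
Qed.

Lemma cell_mono x y : x <= y -> (cell x <= cell y)%N.
Proof.
move=> xy; apply: leq_sum => j _.
by have [/le_trans/(_ xy) -> //|] := boolP (s j <= x).
Qed.

Lemma cell_co l x : (l < n.+1)%N -> s l <= x < s l.+1 -> cell x = l.
Proof.
move=> ln /andP[lx xl]; rewrite /cell (@big_cat_nat _ _ _ l.+1)//=.
rewrite [X in (_ + X)%N]big_nat_cond [X in (_ + X)%N]big1 ?addn0; last first.
  move=> j; rewrite andbT => /andP[lj jn]; apply/eqP; rewrite eqb0 -ltNge.
  by apply: (lt_le_trans xl); apply: (partition_le hs); rewrite lj ltnW.
rewrite (eq_big_nat _ _ (F2 := fun=> 1%N)); first by rewrite sum_nat_const_nat muln1 subn1.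
move=> j /andP[_ jl]; apply/eqP; rewrite eqb1; apply: le_trans lx.
by apply: (partition_le hs); rewrite -ltnS jl ltnW.
Qed.

Lemma cell_bounds x : t <= x <= T -> s (cell x) <= x <= s (cell x).+1.
Proof.
move=> /andP[tx]; rewrite le_eqVlt => /predU1P[->|xT]; last first.
  have [l ll] := partition_cell hs tx xT.
  by rewrite (cell_co (ltn_ord l) ll); move: ll => /andP[-> /ltW ->].
have [_ sn _] := hs.
have -> : cell T = n.
  rewrite /cell (eq_big_nat _ _ (F2 := fun=> 1%N)); first by rewrite sum_nat_const_nat muln1 subn1.
  move=> j /andP[_ jn]; apply/eqP; rewrite eqb1 -sn.
  by apply: (partition_le hs); rewrite leqnn ltnW.
by rewrite sn lexx andbT -sn; apply: (partition_le hs); rewrite leqnSn leqnn.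
Qed.

(** Points that are further apart than the mesh lie in different cells. *)
Lemma cell_strict r x y : (forall l, (l < n.+1)%N -> s l.+1 - s l <= r) ->
  t <= x <= T -> t <= y <= T -> r < y - x -> (cell x < cell y)%N.
Proof.
move=> fs xT yT xy.
have /andP[h1 _] := cell_bounds xT; have /andP[_ h2] := cell_bounds yT.
rewrite ltnNge; apply/negP => yx.
have h3 := fs _ (cell_lt y).
have h4 : s (cell y) <= s (cell x) by apply: (partition_le hs); rewrite yx ltnW// cell_lt.
lra.
Qed.

Definition cell_ind (j : nat) (x : R) : R := (cell x == j)%:R.

Lemma measurable_cell_ind j : measurable_fun setT (cell_ind j).
Proof.
have mc : measurable_fun setT (fun x : R => (cell x)%:R : R).
  have -> : (fun x : R => (cell x)%:R : R) = (fun x => \sum_(1 <= l < n.+1) \1_`[s l, +oo[ x).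
    apply/funext => x; rewrite /cell natr_sum; apply: eq_bigr => l _.
    by rewrite indicE mem_setE in_itv/= andbT.
  by apply: measurable_sum => l; exact: measurable_indic.
have -> : cell_ind j = (\1_[set j%:R] \o (fun x : R => (cell x)%:R : R)).
  apply/funext => x; rewrite /cell_ind /= indicE; congr (nat_of_bool _)%:R.
  by apply/eqP/idP => [->|]; rewrite inE//= => /eqP; rewrite eqr_nat => /eqP.
by apply: measurableT_comp => //; exact: measurable_indic.
Qed.

Lemma integral_cell_ind (j : 'I_n.+1) :
  \int[mu]_(x in `[t, T]) cell_ind j x = s j.+1 - s j.
Proof.
have mI : measurable (`[t, T[ : set (measurableTypeR R)) by exact: measurable_itv.
have E x : `[t, T[%classic x -> cell_ind j x = \1_`[s j, s j.+1[ x.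
  rewrite /= in_itv/= => /andP[tx xT].
  have [l ll] := partition_cell hs tx xT.
  rewrite /cell_ind (cell_co (ltn_ord l) ll).
  have [/val_inj <-|lj] := eqVneq (l : nat) j; first by rewrite indicE mem_set//= in_itv.
  have := step_cell (fun x : 'I_n.+1 => (x == j)%:R) hs ll => /esym.
  rewrite (bigD1 j)//= eqxx mul1r big1 ?addr0; last first.
    by move=> i /negbTE ->; rewrite mul0r.
  by rewrite -val_eqE/= (negbTE lj) => ->.
have i1 : mu.-integrable `[t, T[ (EFin \o cell_ind j).
  have := integrable_indic_co (s j) (s j.+1) mI; apply: eq_integrable => // x /set_mem xI.
  by rewrite /= E.
rewrite -(Rintegral_itv_bndo_bndc i1).
have [h1 h2 h3] := partition_cell_bounds hs j.
by rewrite -(integral_indic_co h1 h2 h3); apply: eq_Rintegral => x /set_mem /E ->.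
Qed.

Definition box k : set (k.-tuple R) := [set x | forall l, tnth x l \in `[t, T]].

Definition cells k (x : k.-tuple R) : {ffun 'I_k -> 'I_n.+1} :=
  [ffun q => inord (cell (tnth x q))].

Lemma cellsE k (x : k.-tuple R) q : cells x q = cell (tnth x q) :> nat.
Proof. by rewrite ffunE inordK// cell_lt. Qed.

Lemma prod_patch k (u : 'I_k -> R -> R) (x : k.-tuple R) :
  \prod_(q < k) (u q \_ `[t, T]) (tnth x q) =
  ((fun x => \prod_(q < k) u q (tnth x q)) \_ (@box k)) x.
Proof.
rewrite patchE; case: ifPn => [/set_mem xD|/negP xD].
  by apply: eq_bigr => q _; rewrite patchE mem_set//; exact: xD.
have [q /negP xq] : exists q, ~ (tnth x q \in `[t, T]).
  by apply/existsNP => H; apply: xD; apply/mem_set => q.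
by rewrite (bigD1 q)//= patchE memNset ?mul0r//; exact/negP.
Qed.

(** The product of the indicators of the cells of l is the indicator of those
    x with [cells x = l], so one term of the sum is left. *)
Lemma cells_sum k (Pr : pred {ffun 'I_k -> 'I_n.+1}) (A : {ffun 'I_k -> 'I_n.+1} -> R)
    (x : k.-tuple R) :
  \sum_(l | Pr l) A l * \prod_(q < k) (cell_ind (l q) \_ `[t, T]) (tnth x q) =
  ((fun x => (Pr (cells x))%:R * A (cells x)) \_ (@box k)) x.
Proof.
under eq_bigr do rewrite prod_patch patchE.
rewrite patchE; case: ifPn => xD; last by rewrite big1// => l _; rewrite mulr0.
have E (l : {ffun 'I_k -> 'I_n.+1}) : \prod_(q < k) cell_ind (l q) (tnth x q) = (l == cells x)%:R.
  have [->|ln] := eqVneq l (cells x).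
    by apply: big1 => q _; rewrite /cell_ind cellsE eqxx.
  have [q /eqP lq] : exists q, l q <> cells x q.
    by apply/existsNP => H; move/eqP : ln; apply; apply/ffunP.
  move: lq; rewrite -val_eqE/= cellsE => lq.
  by rewrite (bigD1 q)//= /cell_ind eq_sym (negbTE lq) mul0r.
under eq_bigr do rewrite E.
have [Px|Px] := boolP (Pr (cells x)); last first.
  rewrite mul0r big1// => l Pl; case: eqP => [e|]; last by rewrite mulr0.
  by rewrite -e Pl in Px.
rewrite (bigD1 (cells x))//= eqxx mulr1 mul1r big1 ?addr0// => l /andP[_ /negbTE ->].
by rewrite mulr0.
Qed.

End cells.

(** * Fourier series on the cube *)

Section fourier.
Context (R : realType) (t T : R).
Hypothesis tT : t <= T.
Notation mu := (@lebesgue_measure R).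
Notation RT := (measurableTypeR R).
Notation mu_ k := (lebesgue_tuple R k).
Notation ext g := (g \_ `[t, T]).

Let mI : measurable (`[t, T] : set RT). Proof. exact: measurable_itv. Qed.

Lemma extM (g h : R -> R) x : ext (fun x => g x * h x) x = ext g x * ext h x.
Proof. by rewrite !patchE; case: ifP => //; rewrite mul0r. Qed.

Lemma ext_ip (g h : R -> R) : ip mu (ext g) (ext h) = \int[mu]_(x in `[t, T]) (g x * h x).
Proof.
rewrite Rintegral_mkcond; apply: eq_Rintegral => x _.
by rewrite -extM.
Qed.

Lemma bounded_ext_L2 (g : R -> R) C : measurable_fun `[t, T] (g : RT -> R) ->
  (forall x, t <= x <= T -> `|g x| <= C) -> L2 mu (ext g).
Proof.
move=> mg gC; split; first exact/(measurable_restrictT _ mI).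
have iC : mu.-integrable `[t, T] (EFin \o cst (C ^+ 2)).
  apply: measurable_bounded_integrable => //; last first.
    by exists (`|C ^+ 2|); split => // x xe v _ /=; exact: ltW.
  by rewrite /= lebesgue_measure_itv/=; case: ifP => _; rewrite -?EFinB ltry.
have ig : mu.-integrable `[t, T] (EFin \o (fun x => g x ^+ 2)).
  apply: le_integrable iC => //.
    by apply/measurable_EFinP; exact: measurable_funX.
  move=> x /=; rewrite in_itv/= => xtT; rewrite lee_fin ger0_norm ?sqr_ge0//.
  have C0 : 0 <= C by exact: le_trans (gC x xtT).
  by rewrite ger0_norm ?sqr_ge0// -real_normK ?num_real// lerXn2r ?nnegrE// gC.
move/integrable_mkcond : ig => /(_ mI); apply: eq_integrable => // x _.
by rewrite /= !patchE; case: ifP => // _; rewrite expr0n.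
Qed.

Lemma within_measurable (g : R -> R) : {within `[t, T], continuous g} ->
  measurable_fun `[t, T] (g : RT -> R).
Proof. by move=> cg; apply: subspace_continuous_measurable_fun. Qed.

Lemma continuous_ext_L2 (g : R -> R) : {within `[t, T], continuous g} -> L2 mu (ext g).
Proof.
move=> cg; have [C _ HC] := within_bounded cg.
by apply: (bounded_ext_L2 (C := C)) => //; exact: within_measurable.
Qed.

Variable phi : nat -> R -> R.
Hypothesis cphi : forall j, {within `[t, T], continuous (phi j)}.
Hypothesis hphi : complete_orthonormal t T phi.

Let Lphi j : L2 mu (ext (phi j)). Proof. exact: continuous_ext_L2. Qed.

Definition tensor_phi k (j : 'I_k -> nat) (x : k.-tuple R) : R :=
  \prod_(q < k) ext (phi (j q)) (tnth x q).

Lemma tensor_phi_L2 k (j : 'I_k -> nat) : L2 (mu_ k) (tensor_phi j).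
Proof. exact: (prod_L2 (fun q => Lphi (j q))). Qed.

Lemma tensor_phi_ip k (i j : 'I_k -> nat) :
  ip (mu_ k) (tensor_phi i) (tensor_phi j) = \prod_(q < k) (i q == j q)%:R.
Proof.
rewrite (prod_ip (fun q => Lphi (i q)) (fun q => Lphi (j q))).
by apply: eq_bigr => q _; rewrite ext_ip (phi_orthonormal hphi).
Qed.

(** Linear combinations are lists of coefficients and multi-indices, with
    repetitions allowed: concatenation adds them and pairing the entries
    multiplies them. *)
Definition phi_comb k (s : seq (R * ('I_k -> nat))) (x : k.-tuple R) : R :=
  \sum_(p <- s) p.1 * tensor_phi p.2 x.

Lemma phi_comb_L2 k (s : seq (R * ('I_k -> nat))) : L2 (mu_ k) (phi_comb s).
Proof. by apply: L2_sum => p _; apply: L2Z; exact: tensor_phi_L2. Qed.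

Definition phi_approximable k (h : k.-tuple R -> R) := L2 (mu_ k) h /\
  forall e, 0 < e -> exists s, sqnorm (mu_ k) (fun x => h x - phi_comb s x) <= e.

Lemma phi_approximable_sum k (I : Type) (r : seq I) (Q : pred I) (h : I -> k.-tuple R -> R) :
  (forall i, Q i -> phi_approximable (h i)) -> phi_approximable (fun x => \sum_(i <- r | Q i) h i x).
Proof.
move=> ah; split; first by apply: L2_sum => i Qi; have [] := ah i Qi.
elim: r => [|i r ih] e e0.
  exists [::].
  have E x : \sum_(i <- [::] | Q i) h i x - phi_comb [::] x = (cst 0 : k.-tuple R -> R) x.
    by rewrite /phi_comb !big_nil subrr.
  rewrite (eq_ip _ E E) /ip; under eq_Rintegral do rewrite mulr0.
  by rewrite Rintegral_cst// mul0r ltW.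
have [Qi|Qi] := boolP (Q i); last first.
  have [s Hs] := ih e e0; exists s.
  by under eq_ip do [rewrite big_cons (negbTE Qi)|rewrite big_cons (negbTE Qi)].
have e4 : 0 < e / 4 by rewrite divr_gt0.
have [s Hs] := ih _ e4; have [Li /(_ _ e4)[s' Hs']] := ah i Qi.
exists (s' ++ s).
have E x : \sum_(j <- i :: r | Q j) h j x - phi_comb (s' ++ s) x =
   (h i x - phi_comb s' x) + (\sum_(j <- r | Q j) h j x - phi_comb s x).
  by rewrite big_cons Qi /phi_comb big_cat/=; ring.
have L1 : L2 (mu_ k) (fun x => \sum_(j <- r | Q j) h j x).
  by apply: L2_sum => j Qj; have [] := ah j Qj.
rewrite (eq_ip _ E E); apply: le_trans (ipD_le (L2B Li (phi_comb_L2 s')) (L2B L1 (phi_comb_L2 s))) _.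
lra.
Qed.

(** The completeness assumption, restated for functions extended by 0. *)
Lemma phi_approximable1 (g : R -> R) C e : measurable_fun `[t, T] (g : RT -> R) ->
  (forall x, t <= x <= T -> `|g x| <= C) -> 0 < e -> exists s : seq (R * nat),
  sqnorm mu (fun x => ext g x - \sum_(p <- s) p.1 * ext (phi p.2) x) <= e.
Proof.
move=> mg gC e0.
have Lg := bounded_ext_L2 mg gC.
have toR (h : R -> R) : L2 mu (ext h) ->
    (\int[mu]_(x in `[t, T]) (h x ^+ 2)%:E = (sqnorm mu (ext h))%:E)%E.
  move=> Lh; rewrite /ip /Rintegral fineK; last first.
    by apply: integrable_fin_num => //; exact: (L2M_integrable Lh Lh).
  rewrite [LHS]integral_mkcond; apply: eq_integral => x _.
  by rewrite !patchE; case: ifP => _; rewrite ?expr2 ?mul0r.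
have g2 : (\int[mu]_(x in `[t, T]) (g x ^+ 2)%:E < +oo)%E by rewrite toR// ltry.
have [n [c H]] := phi_complete hphi mg g2 e0.
exists [seq (c j, j) | j <- index_iota 0 n].
have E (x : RT) : ext g x - \sum_(p <- [seq (c j, j) | j <- index_iota 0 n]) p.1 * ext (phi p.2) x =
    ext (fun x => g x - \sum_(j < n) c j * phi j x) x.
  rewrite big_map big_mkord !patchE; case: ifP => xI.
    by congr (_ - _); apply: eq_bigr => j _; rewrite patchE xI.
  by rewrite big1 ?subr0// => j _; rewrite patchE xI mulr0.
rewrite (eq_ip _ E E) -lee_fin -toR; first exact: ltW.
apply: (L2_ext E); apply: L2B => //; apply: L2_sum => p _; exact: L2Z.
Qed.

(** Approximate the first factor, then the product of the others: the two
    errors are measured against the norms of the remaining factors, the second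
    of which depends on the first approximation. *)
Lemma phi_approximable_prod k (g : 'I_k -> R -> R) (C : 'I_k -> R) :
  (forall q, measurable_fun `[t, T] (g q : RT -> R)) ->
  (forall q x, t <= x <= T -> `|g q x| <= C q) ->
  phi_approximable (fun x : k.-tuple R => \prod_(q < k) ext (g q) (tnth x q)).
Proof.
elim: k g C => [|k ih] g C mg gC.
  have Lg q := bounded_ext_L2 (mg q) (gC q).
  split; first exact: (prod_L2 Lg).
  move=> e e0; exists [:: (1, fun=> 0%N)].
  have E (x : 0.-tuple R) : \prod_(q < 0) ext (g q) (tnth x q) - phi_comb [:: (1, fun=> 0%N)] x =
      (cst 0 : 0.-tuple R -> R) x.
    by rewrite /phi_comb big_seq1 /tensor_phi !big_ord0 mul1r subrr.
  rewrite (eq_ip _ E E) /ip; under eq_Rintegral do rewrite mulr0.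
  by rewrite Rintegral_cst// mul0r ltW.
have Lg q := bounded_ext_L2 (mg q) (gC q).
split; first exact: (prod_L2 Lg).
move=> e e0.
pose U (x : k.-tuple R) := \prod_(q < k) ext (g (lift ord0 q)) (tnth x q).
have LU : L2 (mu_ k) U by exact: (prod_L2 (fun q => Lg (lift ord0 q))).
pose NU := sqnorm (mu_ k) U; have NU0 : 0 <= NU by exact: ip_ge0.
have e1_0 : 0 < e / (4 * (NU + 1)) by rewrite divr_gt0// mulr_gt0// ltr_wpDl.
have [s1 H1] := phi_approximable1 (mg ord0) (gC ord0) e1_0.
pose G (x : R) := \sum_(p <- s1) p.1 * ext (phi p.2) x.
have LG : L2 mu G by apply: L2_sum => p _; exact: L2Z.
pose NG := sqnorm mu G; have NG0 : 0 <= NG by exact: ip_ge0.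
have e2_0 : 0 < e / (4 * (NG + 1)) by rewrite divr_gt0// mulr_gt0// ltr_wpDl.
have [_ /(_ _ e2_0)[s2 H2]] := ih (fun q => g (lift ord0 q)) (fun q => C (lift ord0 q))
  (fun q => mg (lift ord0 q)) (fun q => gC (lift ord0 q)).
pose V := phi_comb s2; have LV : L2 (mu_ k) V by exact: phi_comb_L2.
pose idx (j : nat) (J : 'I_k -> nat) : 'I_k.+1 -> nat :=
  fun q => if unlift ord0 q is Some r then J r else j.
exists [seq (p.1 * r.1, idx p.2 r.2) | p <- s1, r <- s2].
have GV x : phi_comb [seq (p.1 * r.1, idx p.2 r.2) | p <- s1, r <- s2] x =
    G (tnth x ord0) * V (tuple_tail x).
  rewrite /phi_comb big_allpairs_dep /G mulr_suml; apply: eq_bigr => p _.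
  rewrite /V /phi_comb mulr_sumr; apply: eq_bigr => r _ /=.
  rewrite /tensor_phi (prod_tnthS (fun q => ext (phi (idx p.2 r.2 q)))) {1}/idx unlift_none.
  rewrite [X in _ * (_ * X) = _](eq_bigr (fun q => ext (phi (r.2 q)) (tnth (tuple_tail x) q))).
    by ring.
  by move=> q _; rewrite /idx liftK.
have E x : \prod_(q < k.+1) ext (g q) (tnth x q) -
    phi_comb [seq (p.1 * r.1, idx p.2 r.2) | p <- s1, r <- s2] x =
    (ext (g ord0) (tnth x ord0) - G (tnth x ord0)) * U (tuple_tail x) +
    G (tnth x ord0) * (U (tuple_tail x) - V (tuple_tail x)).
  by rewrite GV (prod_tnthS (fun q => ext (g q))) -/(U _); ring.
have LgG : L2 mu (fun x => ext (g ord0) x - G x) by exact: L2B.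
have LUV : L2 (mu_ k) (fun x => U x - V x) by exact: L2B.
rewrite (eq_ip _ E E); apply: le_trans (ipD_le (tensor_L2 LgG LU) (tensor_L2 LG LUV)) _.
rewrite (tensor_ip LgG LgG LU LU) (tensor_ip LG LG LUV LUV) -/NU -/NG.
have b1 : sqnorm mu (fun x => ext (g ord0) x - G x) * NU <= e / 4.
  apply: (@le_trans _ _ (e / (4 * (NU + 1)) * NU)); first by rewrite ler_wpM2r.
  rewrite mulrAC ler_pdivrMr ?mulr_gt0 ?ltr_wpDl//.
  rewrite (_ : e / 4 * _ = e * (NU + 1)); last by field.
  by rewrite ler_pM2l// lerDl.
have b2 : NG * sqnorm (mu_ k) (fun x => U x - V x) <= e / 4.
  apply: (@le_trans _ _ (NG * (e / (4 * (NG + 1))))); first by rewrite ler_wpM2l.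
  rewrite mulrA ler_pdivrMr ?mulr_gt0 ?ltr_wpDl//.
  rewrite (_ : e / 4 * _ = e * (NG + 1)); last by field.
  by rewrite mulrC ler_pM2l// lerDl.
lra.
Qed.

Section partial_sums.
Variables (k : nat) (h : k.-tuple R -> R).
Hypothesis Lh : L2 (mu_ k) h.

Definition coef (j : 'I_k -> nat) : R := ip (mu_ k) h (tensor_phi j).

Definition partial_sum (p : 'I_k -> nat) (x : k.-tuple R) : R :=
  \sum_(j : {dffun forall l : 'I_k, 'I_(p l).+1}) coef (fun l => j l) * tensor_phi (fun l => j l) x.

Lemma partial_sum_L2 p : L2 (mu_ k) (partial_sum p).
Proof. by apply: L2_sum => j _; apply: L2Z; exact: tensor_phi_L2. Qed.

Lemma partial_sum_orth p (i : 'I_k -> nat) : (forall l, (i l <= p l)%N) ->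
  ip (mu_ k) (fun x => h x - partial_sum p x) (tensor_phi i) = 0.
Proof.
move=> ip_.
have E x : h x - partial_sum p x = h x + - partial_sum p x by [].
have EN x : - partial_sum p x = -1 * partial_sum p x by rewrite mulN1r.
rewrite ipDl//; [|exact: L2N (partial_sum_L2 p)|exact: tensor_phi_L2].
rewrite (@eq_ip _ _ _ _ _ _ _ _ EN (fun x => erefl (tensor_phi i x))) ipZl;
  [|exact: partial_sum_L2|exact: tensor_phi_L2].
rewrite /partial_sum ip_suml; [|by move=> j; apply: L2Z; exact: tensor_phi_L2|exact: tensor_phi_L2].
pose j0 : {dffun forall l : 'I_k, 'I_(p l).+1} := [ffun l => inord (i l)].
have j0E l : j0 l = i l :> nat by rewrite ffunE inordK// ltnS.
rewrite (bigD1 j0)//= big1 ?addr0 => [|j jj0].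
  rewrite ipZl ?tensor_phi_ip; [|exact: tensor_phi_L2..].
  rewrite big1 ?mulr1 => [|q _]; last by rewrite j0E eqxx.
  have -> : (fun l => nat_of_ord (j0 l)) = i by apply/funext => l; rewrite j0E.
  by rewrite mulN1r subrr.
rewrite ipZl ?tensor_phi_ip; [|exact: tensor_phi_L2..].
have [q jq] : exists q, nat_of_ord (j q) <> i q.
  apply/existsNP => H; move/eqP : jj0; apply; apply/ffunP => l; apply/val_inj.
  by rewrite /= H j0E.
by rewrite (bigD1 q)//=; move/eqP/negbTE : jq => ->; rewrite mul0r mulr0.
Qed.

Lemma partial_sum_orth_comb p (s : seq (R * ('I_k -> nat))) :
  all (fun r => [forall l, (r.2 l <= p l)%N]) s ->
  ip (mu_ k) (fun x => h x - partial_sum p x) (phi_comb s) = 0.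
Proof.
have LhS : L2 (mu_ k) (fun x => h x - partial_sum p x) by apply: L2B => //; exact: partial_sum_L2.
elim: s => [_|r s ih /= /andP[/forallP rp sp]].
  have E x : phi_comb [::] x = (cst 0 : k.-tuple R -> R) x by rewrite /phi_comb big_nil.
  rewrite (eq_ip _ (fun x => erefl) E) /ip; under eq_Rintegral do rewrite mulr0.
  by rewrite Rintegral_cst// mul0r.
have E x : phi_comb (r :: s) x = r.1 * tensor_phi r.2 x + phi_comb s x.
  by rewrite /phi_comb big_cons.
rewrite (eq_ip _ (fun x => erefl) E) ipC ipDl//; last 2 first.
  by apply: L2Z; exact: tensor_phi_L2.
  exact: phi_comb_L2.
rewrite ipZl//; last exact: tensor_phi_L2.
by rewrite ipC partial_sum_orth// mulr0 add0r ipC ih.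
Qed.

(** The error of a partial sum is orthogonal to the span of the basis products
    that the sum ranges over. *)
Lemma partial_sum_best p (s : seq (R * ('I_k -> nat))) :
  all (fun r => [forall l, (r.2 l <= p l)%N]) s ->
  sqnorm (mu_ k) (fun x => h x - partial_sum p x) <=
  sqnorm (mu_ k) (fun x => h x - phi_comb s x).
Proof.
move=> sp.
have LS := partial_sum_L2 p; have Ls := phi_comb_L2 s.
have LhS : L2 (mu_ k) (fun x => h x - partial_sum p x) by exact: L2B.
have LSs : L2 (mu_ k) (fun x => partial_sum p x - phi_comb s x) by exact: L2B.
have E x : h x - phi_comb s x = (h x - partial_sum p x) + (partial_sum p x - phi_comb s x).
  by rewrite addrA subrK.
rewrite [leRHS](eq_ip _ E E) (ip_sqrD LhS LSs).
suff -> : ip (mu_ k) (fun x => h x - partial_sum p x) (fun x => partial_sum p x - phi_comb s x) = 0.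
  by rewrite mulr0 addr0 lerDl ip_ge0.
have EN x : partial_sum p x - phi_comb s x = -1 * phi_comb s x + partial_sum p x.
  by rewrite mulN1r addrC.
rewrite (eq_ip _ (fun x => erefl) EN) ipC ipDl//; last exact: L2Z.
rewrite ipZl// ipC partial_sum_orth_comb// mulr0 add0r ip_suml//; last first.
  by move=> j; apply: L2Z; exact: tensor_phi_L2.
apply: big1 => j _; rewrite ipZl//; last exact: tensor_phi_L2.
by rewrite ipC partial_sum_orth ?mulr0// => l; rewrite -ltnS.
Qed.

(** A good approximation uses finitely many basis products. Any partial sum
    that reaches beyond all of them is at least as good. *)
Lemma partial_sum_cvg e : phi_approximable h -> 0 < e ->
  exists n, forall p : 'I_k -> nat, (forall l, (n <= p l)%N) ->
  sqnorm (mu_ k) (fun x => h x - partial_sum p x) <= e.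
Proof.
move=> [_ /[apply]] [s Hs].
have [n Hn] : exists n, all (fun r => [forall l, (r.2 l <= n)%N]) s.
  elim: s {Hs} => [|r s [n Hn]]; first by exists 0%N.
  exists (maxn n (\max_l r.2 l)); apply/andP; split.
    by apply/forallP => l; rewrite leq_max; apply/orP; right; exact: (leq_bigmax l).
  apply: sub_all Hn => q /forallP qn; apply/forallP => l.
  by rewrite leq_max qn.
exists n => p np; apply: le_trans (partial_sum_best _) Hs.
apply: sub_all Hn => q /forallP qn; apply/forallP => l.
exact: leq_trans (qn l) (np l).
Qed.

End partial_sums.

End fourier.

(** * The kernel as a limit of sums of products *)

Lemma within_continuous_seq (R : realType) (t T : R) (g : R -> R) (x : R) (u : nat -> R) :
  {within `[t, T], continuous g} -> t <= x <= T -> (forall n, t <= u n <= T) ->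
  u n @[n --> \oo] --> x -> g (u n) @[n --> \oo] --> g x.
Proof.
move=> cg xtT utT ux; apply/cvgrPdist_le => e e0.
have [r r0 Hr] := within_unif_continuous cg e0.
by have := ux => /cvgrPdist_le/(_ _ r0); apply: filterS => n xn; exact: Hr.
Qed.

Section kernel.
Context (R : realType) (t T : R).
Hypothesis tT : t <= T.
Notation mu := (@lebesgue_measure R).
Notation RT := (measurableTypeR R).
Notation mu_ k := (lebesgue_tuple R k).
Notation ext g := (g \_ `[t, T]).
Variable phi : nat -> R -> R.
Hypothesis cphi : forall j, {within `[t, T], continuous (phi j)}.
Hypothesis hphi : complete_orthonormal t T phi.
Variable tau : nat -> nat -> R.
Hypothesis htau : partition_sequence t T tau.
Variables (k : nat) (psi : 'I_k -> R -> R).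
Hypothesis cpsi : forall l, {within `[t, T], continuous (psi l)}.

Notation cells n := (@cells R n (tau n.+1) k).
Notation cell n := (cell n (tau n.+1)).
Notation box := (@box R t T k).

Let hs n : is_partition t T n.+1 (tau n.+1). Proof. by have [h _] := htau; exact: h. Qed.

Lemma mesh_nearS r : 0 < r ->
  \forall n \near \oo, fine_partition T t r n.+1 (tau n.+1).
Proof.
move=> /(mesh_near htau)[M _ HM]; exists M => // n /= Mn; apply: HM.
exact: leqW.
Qed.

Definition tuple_ordered (x : k.-tuple R) : bool :=
  [forall r : 'I_k, forall s : 'I_k, (r < s)%N ==> (tnth x r < tnth x s)].

Let cell_near (x : k.-tuple R) q r : box x -> tnth x q < tnth x r ->
  \forall n \near \oo, (cell n (tnth x q) < cell n (tnth x r))%N.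
Proof.
move=> xb qr; have d0 : 0 < (tnth x r - tnth x q) / 2 by rewrite divr_gt0// subr_gt0.
apply: filterS (mesh_nearS d0) => n [_ fs].
apply: (cell_strict (hs n) fs); [by have := xb q; rewrite in_itv|by have := xb r; rewrite in_itv|].
rewrite ltr_pdivrMr// ltr_pMr ?subr_gt0// ltr1n //.
Qed.

(** Distinct coordinates are eventually separated by the mesh. The index of
    the cell is monotone, so strict order of the cells implies strict order of
    the coordinates. *)
Lemma cells_ordered_near x : box x ->
  \forall n \near \oo, increasing (cells n x) = tuple_ordered x.
Proof.
move=> xb; have [xo|xo] := boolP (tuple_ordered x).
  have H (p : 'I_k * 'I_k) : \forall n \near \oo,
      (p.1 < p.2)%N -> (cell n (tnth x p.1) < cell n (tnth x p.2))%N.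
    have [p12|p12] := boolP (p.1 < p.2)%N; last by near=> n.
    have /forallP/(_ p.1)/forallP/(_ p.2)/implyP/(_ p12) x12 := xo.
    by apply: filterS (cell_near xb x12).
  have HH : \forall n \near \oo, forall p : 'I_k * 'I_k,
      (p.1 < p.2)%N -> (cell n (tnth x p.1) < cell n (tnth x p.2))%N.
    exact: filter_forall.
  apply: filterS HH => n Hn.
  by apply/increasingP => g r gr; rewrite !cellsE; exact: (Hn (g, r)).
near=> n; apply/negbTE; apply: contra xo => /increasingP H.
apply/forallP => r; apply/forallP => s; apply/implyP => /H; rewrite !cellsE => rs.
by rewrite ltNge; apply/negP => /(cell_mono n (tau n.+1)); rewrite leqNgt rs.
Unshelve. all: by end_near.
Qed.

Lemma cells_injective_near x : box x -> injective (tnth x) ->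
  \forall n \near \oo, injective (cells n x).
Proof.
move=> xb xi.
have H (p : 'I_k * 'I_k) : \forall n \near \oo,
    cell n (tnth x p.1) = cell n (tnth x p.2) -> p.1 = p.2.
  have [->|p12] := eqVneq p.1 p.2; first by near=> n.
  have : tnth x p.1 != tnth x p.2 by apply: contra_neq p12 => /xi.
  rewrite neq_lt => /orP[x12|x12].
    by apply: filterS (cell_near xb x12) => n + e; rewrite e ltnn.
  by apply: filterS (cell_near xb x12) => n + e; rewrite e ltnn.
have HH : \forall n \near \oo, forall p : 'I_k * 'I_k,
    cell n (tnth x p.1) = cell n (tnth x p.2) -> p.1 = p.2.
  exact: filter_forall.
apply: filterS HH => n Hn g r /(congr1 val)/=.
by rewrite !cellsE; exact: (Hn (g, r)).
Unshelve. all: by end_near.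
Qed.

Lemma cells_node_cvg (x : k.-tuple R) q : box x ->
  tau n.+1 (cells n x q) @[n --> \oo] --> tnth x q.
Proof.
move=> xb; apply/cvgrPdist_le => e e0; apply: filterS (mesh_nearS e0) => n [_ fs].
have xq : t <= tnth x q <= T by have := xb q; rewrite in_itv.
rewrite cellsE.
have /andP[h1 h2] := cell_bounds (hs n) xq.
rewrite ger0_norm ?subr_ge0//; apply: le_trans (fs _ (cell_lt n (tau n.+1) (tnth x q))).
by rewrite lerB.
Qed.

(** Extended by 0 outside the cube, so that all integrals are over the whole
    space. *)
Definition kernel_box : k.-tuple R -> R := kernel_K psi \_ box.

Lemma kernel_boxE x : box x -> kernel_box x =
  (tuple_ordered x)%:R * \prod_(l < k) psi l (tnth x l).
Proof.
move=> xb; rewrite /kernel_box patchE mem_set// /kernel_K -/(tuple_ordered x).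
by case: ifP; rewrite ?mul1r ?mul0r.
Qed.

Let box1 (x : k.-tuple R) := \prod_(q < k) ext (cst 1 : R -> R) (tnth x q).

Let box1E x : box1 x = (x \in box)%:R.
Proof. by rewrite /box1 prod_patch patchE; case: ifP => // _; rewrite big1. Qed.

Let box1_L2 : L2 (mu_ k) box1.
Proof.
by apply: (prod_L2 (u := fun=> ext (cst 1 : R -> R))) => q; apply: continuous_ext_L2 => // x; exact: cvg_cst.
Qed.

Let box1_integrable : (mu_ k).-integrable setT (EFin \o box1).
Proof.
have [_] := box1_L2; apply: eq_integrable => // x _ /=.
by rewrite box1E; case: (_ \in _); rewrite ?expr1n ?expr0n.
Qed.

Let psi_bound : exists2 C, 0 <= C & forall q x, t <= x <= T -> `|psi q x| <= C.
Proof.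
have H q : exists C, forall x, t <= x <= T -> `|psi q x| <= C.
  by have [C _ HC] := within_bounded (@cpsi q); exists C.
pose C q := projT1 (cid (H q)).
exists (\sum_q `|C q|); first exact: sumr_ge0.
move=> q x xtT; apply: (@le_trans _ _ `|C q|).
  by apply: le_trans (ler_norm _); rewrite /C; case: cid => c /= ->.
by rewrite (bigD1 q)//= lerDl sumr_ge0.
Qed.

Let prod_psi_bound C x : (forall q x, t <= x <= T -> `|psi q x| <= C) -> box x ->
  `|\prod_(l < k) psi l (tnth x l)| <= C ^+ k.
Proof.
move=> HC xb; rewrite normr_prod -[k in C ^+ k]card_ord -prodr_const.
by apply: ler_prod => q _; rewrite normr_ge0 HC//; have := xb q; rewrite in_itv.
Qed.

(** The kernel with the order of the coordinates replaced by that of their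
    cells, which makes it a finite sum of products of functions of one
    variable. *)
Definition kernel_step n (x : k.-tuple R) : R :=
  \sum_(l : {ffun 'I_k -> 'I_n.+1} | increasing l)
    \prod_(q < k) ext (fun y => psi q y * cell_ind n (tau n.+1) (l q) y) (tnth x q).

Lemma kernel_stepE n x : kernel_step n x =
  ((fun x => (increasing (cells n x))%:R * \prod_(l < k) psi l (tnth x l)) \_ box) x.
Proof.
rewrite /kernel_step.
under eq_bigr do under eq_bigr do rewrite extM.
under eq_bigr do rewrite big_split/=.
rewrite (cells_sum t T (tau n.+1) (@increasing k n.+1) (fun=> \prod_(q < k) ext (psi q) (tnth x q))).
rewrite !patchE; case: ifPn => // xb; congr (_ * _).
by rewrite (prod_patch t T) patchE xb.
Qed.

Lemma kernel_step_approximable n : phi_approximable t T phi (kernel_step n).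
Proof.
apply: phi_approximable_sum => // l _.
have [C C0 HC] := psi_bound.
apply: (@phi_approximable_prod R t T phi cphi hphi k
  (fun q y => psi q y * cell_ind n (tau n.+1) (l q) y) (fun=> C)).
  move=> q; apply: measurable_funM; first exact: within_measurable.
  by apply: measurable_funTS; exact: measurable_cell_ind.
move=> q x xtT; rewrite normrM -[C]mulr1 ler_pM ?HC//.
by rewrite /cell_ind; case: (_ == _); rewrite ?normr1 ?normr0.
Qed.

Let kernel_step_cvg x : kernel_step n x @[n --> \oo] --> kernel_box x.
Proof.
have [xb|xb] := boolP (x \in box); last first.
  rewrite /kernel_box patchE (negbTE xb).
  under eq_fun do rewrite kernel_stepE patchE (negbTE xb).
  exact: cvg_cst.
rewrite kernel_boxE; last exact: set_mem.
apply: cvg_near_cst; apply: filterS (cells_ordered_near (set_mem xb)) => n Hn.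
by rewrite kernel_stepE patchE xb Hn.
Qed.

Let step_bound n x C : 0 <= C -> (forall q x, t <= x <= T -> `|psi q x| <= C) ->
  `|kernel_step n x| <= C ^+ k * box1 x.
Proof.
move=> C0 HC; rewrite kernel_stepE patchE box1E; case: ifPn => xb.
  rewrite mulr1 normrM -[leRHS]mul1r ler_pM//; last exact: (prod_psi_bound HC (set_mem xb)).
  by case: (increasing _); rewrite ?normr1 ?normr0.
by rewrite normr0 mulr0.
Qed.

Let kernel_bound x C : 0 <= C -> (forall q x, t <= x <= T -> `|psi q x| <= C) ->
  `|kernel_box x| <= C ^+ k * box1 x.
Proof.
move=> C0 HC; rewrite box1E; case: (boolP (x \in box)) => xb.
  rewrite kernel_boxE; last exact: set_mem.
  rewrite mulr1 normrM -[leRHS]mul1r ler_pM//; last exact: (prod_psi_bound HC (set_mem xb)).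
  by case: (tuple_ordered _); rewrite ?normr1 ?normr0.
by rewrite /kernel_box patchE (negbTE xb) normr0 mulr0.
Qed.

Let mkernel : measurable_fun setT kernel_box.
Proof.
apply: (measurable_fun_cvg (h := kernel_step)) => [n|x _]; last exact: kernel_step_cvg.
by have [[]] := kernel_step_approximable n.
Qed.

Lemma kernel_box_L2 : L2 (mu_ k) kernel_box.
Proof.
have [C C0 HC] := psi_bound; split => //.
have [_ i1] := L2Z (C ^+ k) box1_L2.
apply: le_integrable i1 => //; first by apply/measurable_EFinP; exact: measurable_funX.
move=> x _; rewrite /= lee_fin !ger0_norm ?sqr_ge0//.
rewrite -real_normK ?num_real// lerXn2r ?nnegrE ?kernel_bound//.
by rewrite mulr_ge0 ?exprn_ge0// box1E.
Qed.

(** The step kernels are bounded and converge to the kernel at every point of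
    the cube, hence in mean square. *)
Lemma kernel_box_approximable : phi_approximable t T phi kernel_box.
Proof.
split; first exact: kernel_box_L2.
move=> e e0; have e4 : 0 < e / 4 by rewrite divr_gt0.
have [C C0 HC] := psi_bound.
have iG : (mu_ k).-integrable setT (EFin \o (fun x => (2 * C ^+ k) ^+ 2 * box1 x)).
  by have := integrableZl measurableT ((2 * C ^+ k) ^+ 2) box1_integrable; exact: eq_integrable.
have LK n : L2 (mu_ k) (kernel_step n) by have [] := kernel_step_approximable n.
have [|x|n x|_ _] := @Rdominated_convergence _ _ _ (mu_ k)
    (fun n x => (kernel_box x - kernel_step n x) * (kernel_box x - kernel_step n x))
    (cst 0) _ _ _ iG.
- move=> n; have LB := L2B kernel_box_L2 (LK n).
  by apply: measurable_funM; exact: L2_measurable LB.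
- rewrite -(mulr0 0) -(subrr (kernel_box x)); apply: cvgM; apply: cvgB => //; exact: cvg_cst.
- rewrite -expr2 normrX -[box1 x](_ : box1 x ^+ 2 = _); last first.
    by rewrite box1E; case: (_ \in _); rewrite ?expr1n ?expr0n.
  have b0 : 0 <= box1 x by rewrite box1E.
  rewrite -exprMn lerXn2r ?nnegrE ?mulr_ge0 ?exprn_ge0//.
  apply: le_trans (ler_normB _ _) _.
  by rewrite -mulrA mulr_natl mulr2n lerD ?kernel_bound ?step_bound.
rewrite Rintegral_cst// mul0r => /cvgr0_norm_le/(_ _ e4)/filter_ex[n Hn].
have [_ /(_ _ e4)[s Hs]] := kernel_step_approximable n.
exists s.
have E x : kernel_box x - phi_comb t T phi s x =
  (kernel_box x - kernel_step n x) + (kernel_step n x - phi_comb t T phi s x).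
  by rewrite addrA subrK.
have Ls : L2 (mu_ k) (phi_comb t T phi s) by apply: phi_comb_L2.
rewrite (eq_ip _ E E); apply: le_trans (ipD_le (L2B kernel_box_L2 (LK n)) (L2B (LK n) Ls)) _.
apply: (@le_trans _ _ (2 * (e / 4 + e / 4))); last by lra.
by rewrite ler_wpM2l// lerD//; exact: le_trans (ler_norm _) Hn.
Qed.

Lemma fourier_coefE j : fourier_coef t T psi phi j = coef t T phi kernel_box j.
Proof.
rewrite /fourier_coef Rintegral_mkcond; apply: eq_Rintegral => x _.
rewrite /tensor_phi prod_patch /kernel_box !patchE; case: ifP => //.
by rewrite mul0r.
Qed.

Definition node n (l : {ffun 'I_k -> 'I_n.+1}) : k.-tuple R := [tuple tau n.+1 (l q) | q < k].

Let node_box n l : box (@node n l).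
Proof.
move=> q; rewrite tnth_mktuple in_itv /=.
by apply: (partition_bounds (hs n)); exact: ltnW.
Qed.

(** The kernel at the nodes, which are ordered as their indices. *)
Definition kernel_node n (l : {ffun 'I_k -> 'I_n.+1}) : R :=
  (increasing l)%:R * \prod_(q < k) psi q (tau n.+1 (l q)).

Let integral_cell_prod n (l : {ffun 'I_k -> 'I_n.+1}) :
  (mu_ k).-integrable setT (EFin \o
    (fun x => \prod_(q < k) ext (cell_ind n (tau n.+1) (l q)) (tnth x q))) /\
  \int[mu_ k]_x (\prod_(q < k) ext (cell_ind n (tau n.+1) (l q)) (tnth x q)) =
    cell_volume (tau n.+1) l.
Proof.
pose v q := ext (cell_ind n (tau n.+1) (l q)).
have Lv q : L2 mu (v q).
  apply: (@bounded_ext_L2 _ t T _ 1).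
    by apply: measurable_funTS; exact: measurable_cell_ind.
  by move=> x _; rewrite /cell_ind; case: (_ == _); rewrite ?normr1 ?normr0.
have vv q x : v q x * v q x = v q x.
  rewrite /v patchE /cell_ind; case: ifP => _; last by rewrite mul0r.
  by case: (_ == _); rewrite ?mulr1 ?mulr0.
have sq (x : k.-tuple R) : (\prod_(q < k) v q (tnth x q)) * (\prod_(q < k) v q (tnth x q)) =
    \prod_(q < k) v q (tnth x q).
  by rewrite -big_split; apply: eq_bigr => q _; exact: vv.
split.
  have [_] := prod_L2 Lv; apply: eq_integrable => // x _ /=.
  by rewrite expr2 sq.
transitivity (sqnorm (mu_ k) (fun x => \prod_(q < k) v q (tnth x q))).
  by apply: eq_Rintegral => x _; rewrite sq.
rewrite (prod_ip Lv Lv); apply: eq_bigr => q _.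
rewrite ext_ip -(integral_cell_ind (hs n) (l q)); apply: eq_Rintegral => x _.
by rewrite /cell_ind; case: (_ == _); rewrite ?mulr1 ?mulr0.
Qed.

(** The sum is the integral of a step function, and dominated convergence
    applies although the kernel is discontinuous: where two coordinates agree
    the step functions vanish, and elsewhere the kernel is continuous. *)
Lemma riemann_distinct_le (Q : k.-tuple R -> R) M e : 0 <= M -> L2 (mu_ k) Q ->
  (forall x, box x -> `|Q x| <= M) ->
  (forall (x : k.-tuple R) (y : nat -> k.-tuple R), box x -> (forall n, box (y n)) ->
     (forall q, tnth (y n) q @[n --> \oo] --> tnth x q) -> Q (y n) @[n --> \oo] --> Q x) ->
  0 < e ->
  \forall n \near \oo, \sum_(l in L_set k n.+1) (Q (node l) - kernel_node l) ^+ 2 *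
      cell_volume (tau n.+1) l <=
    sqnorm (mu_ k) (fun x => kernel_box x - Q x) + e.
Proof.
move=> M0 LQ QM Qc e0.
have [C C0 HC] := psi_bound.
pose a n l := (Q (@node n l) - kernel_node l) ^+ 2.
pose f_ n x := \sum_(l in L_set k n.+1) a n l *
  \prod_(q < k) ext (cell_ind n (tau n.+1) (l q)) (tnth x q).
have fE n x : f_ n x = ((fun x => (cells n x \in L_set k n.+1)%:R * a n (cells n x)) \_ box) x.
  exact: (cells_sum t T (tau n.+1) (mem (L_set k n.+1)) (a n)).
have Cn n l : `|@kernel_node n l| <= C ^+ k.
  rewrite /kernel_node normrM -[leRHS]mul1r ler_pM//.
    by case: (increasing _); rewrite ?normr1 ?normr0.
  have := prod_psi_bound HC (node_box l).
  by under eq_bigr do rewrite tnth_mktuple.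
have aM n l : 0 <= a n l <= (M + C ^+ k) ^+ 2.
  rewrite /a sqr_ge0/= -[leLHS]real_normK ?num_real// lerXn2r ?nnegrE ?addr_ge0 ?exprn_ge0//.
  by apply: le_trans (ler_normB _ _) _; rewrite lerD ?Cn// QM.
have [iF EF] : (forall n, (mu_ k).-integrable setT (EFin \o f_ n)) /\
    (forall n, \int[mu_ k]_x f_ n x =
       \sum_(l in L_set k n.+1) a n l * cell_volume (tau n.+1) l).
  have H n : (mu_ k).-integrable setT (EFin \o f_ n) /\ \int[mu_ k]_x f_ n x =
       \sum_(l in L_set k n.+1) a n l * cell_volume (tau n.+1) l.
    have i1 l : (mu_ k).-integrable setT (EFin \o (fun x =>
      (if l \in L_set k n.+1 then a n l *
         \prod_(q < k) ext (cell_ind n (tau n.+1) (l q)) (tnth x q) else 0))).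
      case: (l \in _); last exact: integrable0.
      by have := integrableZl measurableT (a n l) (integral_cell_prod l).1; exact: eq_integrable.
    have [i2 i3] := Rint_sum_in (index_enum {ffun 'I_k -> 'I_n.+1}) measurableT i1.
    split; first by move: i2; apply: eq_integrable => // x _; rewrite /= /f_ [in RHS]big_mkcond.
    transitivity (\int[mu_ k]_x \sum_l (if l \in L_set k n.+1 then a n l *
         \prod_(q < k) ext (cell_ind n (tau n.+1) (l q)) (tnth x q) else 0)).
      by apply: eq_Rintegral => x _; rewrite /f_ big_mkcond.
    rewrite i3 [RHS]big_mkcond; apply: eq_bigr => l _; case: (l \in _).
      by rewrite RintegralZl//; [rewrite (integral_cell_prod l).2|exact: (integral_cell_prod l).1].
    by rewrite Rintegral_cst// mul0r.
  by split=> n; have [] := H n.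
pose f (x : k.-tuple R) := if `[<box x /\ injective (tnth x)>] then (Q x - kernel_box x) ^+ 2 else 0.
have fcv x : f_ n x @[n --> \oo] --> f x.
  rewrite /f; case: asboolP => [[xb xi]|xn].
    have H : \forall n \near \oo, (Q (node (cells n x)) - kernel_node (cells n x)) ^+ 2 = f_ n x.
      apply: filterS (cells_injective_near xb xi) => n /L_setP ci.
      by rewrite fE patchE mem_set// ci mul1r.
    have QK : Q (node (cells n x)) - kernel_node (cells n x) @[n --> \oo] --> Q x - kernel_box x.
      apply: cvgB.
        apply: Qc => // q; under eq_fun do rewrite tnth_mktuple.
        exact: cells_node_cvg.
      rewrite kernel_boxE//; apply: cvgM.
        by apply: cvg_near_cst; apply: filterS (cells_ordered_near xb) => n ->.
      apply: cvg_big; first exact: mul_continuous.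
      move=> q _.
      apply: (within_continuous_seq (@cpsi q)).
      - by have := xb q; rewrite in_itv.
      - by move=> n; apply: (partition_bounds (hs n)); exact: ltnW.
      - exact: cells_node_cvg.
    have QK2 : (Q (node (cells n x)) - kernel_node (cells n x)) ^+ 2 @[n --> \oo] -->
        (Q x - kernel_box x) ^+ 2.
      by rewrite expr2; under eq_fun do rewrite expr2; exact: cvgM.
    exact: cvg_trans (near_eq_cvg H) QK2.
  have -> : (fun n => f_ n x) = cst 0; last exact: cvg_cst.
  apply/funext => n; rewrite fE patchE; case: ifPn => // /set_mem xb.
  case: L_setP => [ci|]; last by rewrite mul0r.
  exfalso; apply: xn; split => // q r xqr; apply: ci; apply/val_inj.
  by rewrite /= !cellsE xqr.
have iG : (mu_ k).-integrable setT (EFin \o (fun x => (M + C ^+ k) ^+ 2 * box1 x)).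
  by have := integrableZl measurableT ((M + C ^+ k) ^+ 2) box1_integrable; exact: eq_integrable.
have fG n x : `|f_ n x| <= (M + C ^+ k) ^+ 2 * box1 x.
  rewrite fE patchE box1E; case: ifPn => xb; last by rewrite normr0 mulr0.
  have /andP[a0 aC] := aM n (cells n x).
  rewrite mulr1 normrM (ger0_norm a0) -[leRHS]mul1r ler_pM//.
  by case: (_ \in _); rewrite ?normr1 ?normr0.
have [mf if_ cvf] := @Rdominated_convergence _ _ _ (mu_ k) f_ f _
  (fun n => (measurable_EFinP _ _).1 (measurable_int _ (iF n))) fcv iG fG.
have fle : \int[mu_ k]_x f x <= sqnorm (mu_ k) (fun x => kernel_box x - Q x).
  have LKQ := L2B kernel_box_L2 LQ.
  apply: le_Rintegral => //; first exact: L2M_integrable.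
  move=> x _; rewrite /f -expr2 -[leRHS]sqrrN opprB; case: asboolP => // _.
  exact: sqr_ge0.
have := cvf => /cvgrPdist_le/(_ _ e0); apply: filterS => n; rewrite EF => H.
rewrite distrC in H; have := le_trans (ler_norm _) H.
by rewrite lerBlDl => /le_trans; apply; rewrite lerD2r.
Qed.

End kernel.

(** * Distinct sums and the iterated integral *)

Lemma lim_mean_square_cvg (R : realType) (d : measure_display) (Omega : measurableType d)
    (P : probability Omega R) (I : Type) (Phi : set_system I) {FF : Filter Phi}
    (X : I -> Omega -> R) (Y : Omega -> R) :
  (\forall n \near Phi, L2 P (X n)) -> L2 P Y ->
  sqnorm P (fun w => X n w - Y w) @[n --> Phi] --> (0 : R) ->
  lim_mean_square P X Phi Y.
Proof.
move=> LX LY XY; split; first exact/square_integrableP.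
have H : \forall n \near Phi, (sqnorm P (fun w => X n w - Y w))%:E =
    mean_square P (fun w => X n w - Y w).
  by apply: filterS LX => n Ln; rewrite L2_mean_square//; exact: L2B.
have H2 : (sqnorm P (fun w => X n w - Y w))%:E @[n --> Phi] --> 0%E.
  by apply: cvg_EFin => //; exact: nearW.
exact: cvg_trans (near_eq_cvg H) H2.
Qed.

#[export] Instance joint_infty_filter k : Filter (@joint_infty k).
Proof.
split; first by exists 0%N.
- move=> A B [a Ha] [b Hb]; exists (maxn a b) => p Hp; split.
    by apply: Ha => l; apply: leq_trans (Hp l); exact: leq_maxl.
  by apply: Hb => l; apply: leq_trans (Hp l); exact: leq_maxr.
- by move=> A B AB [a Ha]; exists a => p /Ha/AB.
Qed.

Section expansion.
Context (R : realType) (d : measure_display) (Omega : measurableType d)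
  (P : probability Omega R) (t T : R).
Hypotheses (t0 : 0 <= t) (tT : t < T).
Variables (F : R -> set_system Omega) (m : nat) (f : 'I_m -> R -> Omega -> R).
Hypotheses (hF : filtration T F) (hf : wiener_process P T F f).
Variables (k : nat) (i : 'I_k -> 'I_m.+1) (psi : 'I_k -> R -> R).
Hypothesis cpsi : forall l, {within `[t, T], continuous (psi l)}.
Variable phi : nat -> R -> R.
Hypothesis cphi : forall j, {within `[t, T], continuous (phi j)}.
Hypothesis hphi : complete_orthonormal t T phi.
Variable tau : nat -> nat -> R.
Hypothesis htau : partition_sequence t T tau.
Variable J : Omega -> R.
Hypothesis hJ : is_iterated_ito P F f t i psi T J.
Notation mu_ k := (lebesgue_tuple R k).
Notation K := (kernel_box t T psi).
Notation Q p := (partial_sum t T phi K p).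

Let tT' : t <= T := ltW tT.

Let hs n : is_partition t T n.+1 (tau n.+1). Proof. by have [h _] := htau; exact: h. Qed.

Definition phi_distinct_sum (j : 'I_k -> nat) n : Omega -> R :=
  distinct_sum f (tau n.+1) i
    (fun l : {ffun 'I_k -> 'I_n.+1} => \prod_(q < k) phi (j q) (tau n.+1 (l q))).

Lemma phi_distinct_sum_L2 j n : L2 P (phi_distinct_sum j n).
Proof. by have [] := distinct_sum_le hF hf t0 tT' (hs n) i
  (fun l => \prod_(q < k) phi (j q) (tau n.+1 (l q))). Qed.

(** Sorting writes the distinct sum as k! iterated sums, each of them a Cauchy
    sequence. *)
Lemma phi_distinct_sum_lim j : exists2 I, L2 P I &
  sqnorm P (fun w => phi_distinct_sum j n w - I w)
    @[n --> \oo] --> (0 : R).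
Proof.
apply: riesz_fischer; first exact: phi_distinct_sum_L2.
move=> e e0; pose c : R := #|{perm 'I_k}|%:R.
have c1 : 1 <= c by rewrite ler1n; apply/card_gt0P; exists 1%g.
have c0 : 0 < c by exact: lt_le_trans c1.
have e1_0 : 0 < e / (c * c) by rewrite divr_gt0// mulr_gt0.
pose g (u : 'S_k) (q : 'I_k) := phi (j (u q)).
have H (u : 'S_k) := iterated_sum_cauchy hF hf t0 tT' (i \o u) (psi := g u) e1_0 (fun q => @cphi _).
pose r u := s2val (cid2 (H u)).
have r0 u : 0 < r u by rewrite /r; case: cid2.
have Hr u n s n' s' v : fine_partition T t (r u) n s -> fine_partition T t (r u) n' s' ->
    t <= v <= T ->
    sqnorm P (fun w => iterated_sum f (i \o u) (g u) s n v w - iterated_sum f (i \o u) (g u) s' n' v w)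
    <= e / (c * c).
  by rewrite /r; case: cid2 => x x0 Hx /=; exact: Hx.
have [N _ HN] : \forall n \near \oo, forall u, fine_partition T t (r u) n.+1 (tau n.+1).
  by apply: filter_forall => u; exact: mesh_nearS.
exists N => a b Na Nb.
have E w : phi_distinct_sum j a w - phi_distinct_sum j b w =
    \sum_(u : 'S_k) (iterated_sum f (i \o u) (g u) (tau a.+1) a.+1 T w -
      iterated_sum f (i \o u) (g u) (tau b.+1) b.+1 T w).
  rewrite /phi_distinct_sum (distinct_sum_prod f (hs a) i (fun q => phi (j q))).
  rewrite (distinct_sum_prod f (hs b) i (fun q => phi (j q))).
  by rewrite -sumrB.
have TT : t <= T <= T by rewrite tT' lexx.
have LX (u : 'S_k) n : L2 P (iterated_sum f (i \o u) (g u) (tau n.+1) n.+1 T).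
  by have [] := iterated_sum_adapted hF hf t0 (i \o u) (g u) (hs n) TT.
rewrite (eq_ip _ E E); apply: le_trans (ip_sum_le (fun u => L2B (LX u a) (LX u b))) _.
rewrite -/c; apply: (@le_trans _ _ (c * \sum_(u : 'S_k) (e / (c * c)))).
  by rewrite ler_pM2l//; apply: ler_sum => u _; apply: Hr => //; exact: HN.
rewrite sumr_const -[_ *+ _]mulr_natr -[_%:R]/c; apply: le_of_eq.
by field; rewrite gt_eqF.
Qed.

Definition expansion_sum (p : 'I_k -> nat) (I : ('I_k -> nat) -> Omega -> R) (w : Omega) : R :=
  \sum_(j : {dffun forall l : 'I_k, 'I_(p l).+1})
    coef t T phi K (fun l => j l) * I (fun l => j l) w.

Lemma partial_sum_bounded (p : 'I_k -> nat) :
  exists2 M, 0 <= M & forall x, `|Q p x| <= M.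
Proof.
have ext_bound j : exists2 C, 0 <= C & forall y, `|(phi j \_ `[t, T]) y| <= C.
  have [C C0 HC] := within_bounded (@cphi j); exists C => // y.
  rewrite patchE; case: ifPn => [/set_mem/=|_]; last by rewrite normr0.
  by rewrite in_itv; exact: HC.
have tensor_bound (j : 'I_k -> nat) :
    exists2 M, 0 <= M & forall x : k.-tuple R, `|tensor_phi t T phi j x| <= M.
  rewrite /tensor_phi; elim: (index_enum _) => [|q s [M M0 HM]].
    by exists 1 => // x; rewrite big_nil normr1.
  have [C C0 HC] := ext_bound (j q); exists (C * M); first exact: mulr_ge0.
  by move=> x; rewrite big_cons normrM ler_pM.
rewrite /partial_sum; elim: (index_enum _) => [|j s [M M0 HM]].
  by exists 0 => // x; rewrite big_nil normr0.
have [C C0 HC] := tensor_bound (fun l => j l).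
pose c := coef t T phi K (fun l => j l).
exists (`|c| * C + M); first by rewrite addr_ge0// mulr_ge0.
move=> x; rewrite big_cons; apply: le_trans (ler_normD _ _) _.
by rewrite lerD// normrM ler_wpM2l.
Qed.

Lemma partial_sum_continuous (p : 'I_k -> nat) (x : k.-tuple R) (y : nat -> k.-tuple R) :
  box t T x -> (forall n, box t T (y n)) ->
  (forall q, tnth (y n) q @[n --> \oo] --> tnth x q) -> Q p (y n) @[n --> \oo] --> Q p x.
Proof.
move=> xb yb yx; apply: cvg_big; first exact: add_continuous.
move=> j _; apply: cvgMr; rewrite /tensor_phi.
have bE (z : k.-tuple R) q : box t T z -> t <= tnth z q <= T.
  by move=> /(_ q); rewrite in_itv.
rewrite prod_patch patchE mem_set//.
under eq_fun do rewrite prod_patch patchE mem_set//.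
apply: cvg_big; first exact: mul_continuous.
move=> q _; apply: within_continuous_seq => //; first exact: bE.
by move=> n; exact: bE.
Qed.

(** Compare both sides along a fine partition: the distinct sum of the partial
    sum is close to the truncated expansion, the iterated sum is close to J,
    and their difference is the distinct sum of the difference of weights. *)
Lemma partial_sum_ito_le (p : 'I_k -> nat) (I : ('I_k -> nat) -> Omega -> R) :
  (forall j, L2 P (I j)) ->
  (forall j, sqnorm P (fun w => phi_distinct_sum j n w - I j w) @[n --> \oo] --> (0 : R)) ->
  sqnorm P (fun w => expansion_sum p I w - J w) <=
  3 * (#|{perm 'I_k}|%:R * ito_const T ^+ k) *
  sqnorm (mu_ k) (fun x => K x - Q p x).
Proof.
move=> LI hI; set S := expansion_sum p I.
have T0 : 0 <= T by exact: le_trans tT'.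
pose c : R := #|{perm 'I_k}|%:R * ito_const T ^+ k.
have c0 : 0 <= c by rewrite mulr_ge0// exprn_ge0// ito_const_ge0.
pose D : R := sqnorm (mu_ k) (fun x => K x - Q p x).
rewrite -/c -/D; apply/ler_addgt0Pr => e e0.
pose e1 := e / (3 * (c + 2)).
have e1_0 : 0 < e1 by rewrite divr_gt0// mulr_gt0// ltr_wpDl.
pose dJ := {dffun forall l : 'I_k, 'I_(p l).+1}.
pose v (j : dJ) : 'I_k -> nat := fun l => j l.
pose C (j : dJ) := coef t T phi K (v j).
have [_ cv1] := mean_square_lin_cvg (P := P) (index_enum dJ) C (fun j => nearW _ (fun n => phi_distinct_sum_L2 (v j) n))
  (fun j => LI (v j)) (fun j => hI (v j)).
have [r r0 Hr] := iterated_sum_cvg hF hf t0 tT' i e1_0 cpsi.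
have QL : L2 (mu_ k) (Q p) by exact: partial_sum_L2.
have [M M0 QM] := partial_sum_bounded p.
have cv2 := riemann_distinct_le cphi hphi htau cpsi M0 QL (fun x _ => QM x)
  (@partial_sum_continuous p) e1_0.
have cv3 := mesh_nearS htau r0.
have := cv1 => /cvgr0_norm_le/(_ _ e1_0) cv1'.
have [n [[h1 h2] h3]] := filter_ex (filterI (filterI cv1' cv2) cv3).
pose a (l : {ffun 'I_k -> 'I_n.+1}) := Q p (node tau l) - kernel_node tau psi l.
have LX : L2 P (iterated_sum f i psi (tau n.+1) n.+1 T).
  have TT : t <= T <= T by rewrite tT' lexx.
  by have [] := iterated_sum_adapted hF hf t0 i psi (hs n) TT.
have LJ : L2 P J by exact: iterated_ito_L2 hJ.
have LS : L2 P S by apply: L2_sum => j _; apply: L2Z.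
pose Sn w := \sum_(j : dJ) C j * phi_distinct_sum (v j) n w.
have LSn : L2 P Sn by apply: L2_sum => j _; apply: L2Z; exact: phi_distinct_sum_L2.
have [La Lale] := distinct_sum_le hF hf t0 tT' (hs n) i a.
have Ea w : Sn w - iterated_sum f i psi (tau n.+1) n.+1 T w =
    distinct_sum f (tau n.+1) i a w.
  rewrite -(distinct_sum_increasing f (hs n)) /distinct_sum -sumrN.
  rewrite /Sn; under eq_bigr do rewrite /phi_distinct_sum /distinct_sum mulr_sumr.
  rewrite exchange_big -big_split; apply: eq_bigr => l _ /=.
  rewrite /a /kernel_node mulrBl; congr (_ - _); rewrite /partial_sum mulr_suml.
  apply: eq_bigr => j _; rewrite mulrA; congr (_ * _ * _).
  rewrite /tensor_phi; apply: eq_bigr => q _; rewrite patchE ifT tnth_mktuple//.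
  apply/mem_set; rewrite /= in_itv /=.
  by apply: (partition_bounds (hs n)); exact: ltnW.
have E w : S w - J w = (S w - Sn w) + (Sn w - iterated_sum f i psi (tau n.+1) n.+1 T w) +
    (iterated_sum f i psi (tau n.+1) n.+1 T w - J w) by ring.
rewrite (eq_ip _ E E); apply: le_trans (ipD3_le (L2B LS LSn) (L2B LSn LX) (L2B LX LJ)) _.
rewrite (eq_ip _ Ea Ea) (ipBC _ S) (ipBC _ (iterated_sum _ _ _ _ _ _)).
have b1 : sqnorm P (fun w => Sn w - S w) <= e1.
  exact: le_trans (ler_norm _) h1.
have b2 : sqnorm P (distinct_sum f (tau n.+1) i a) <= c * (D + e1).
  by apply: le_trans Lale _; rewrite mulrA ler_wpM2l.
have b3 := Hr n.+1 (tau n.+1) T J h3 _ hJ.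
rewrite lexx tT' in b3; have {}b3 := b3 erefl.
have -> : e = e1 * (3 * (c + 2)) by rewrite /e1 divfK// gt_eqF// mulr_gt0// ltr_wpDl.
lra.
Qed.

End expansion.

(** * The expansion *)

Theorem theorem1 (R : realType) (d : measure_display)
    (Omega : measurableType d) (P : probability Omega R)
    (hP : measure_is_complete P)
    (t T : R) (ht : 0 <= t) (htT : t < T)
    (F : R -> set_system Omega) (hF : filtration T F)
    (m : nat) (f : 'I_m -> R -> Omega -> R) (hf : wiener_process P T F f)
    (k : nat) (hk : (0 < k)%N) (i : 'I_k -> 'I_m.+1)
    (psi : 'I_k -> R -> R)
    (hpsi : forall l, {within `[t, T], continuous (psi l)})
    (phi : nat -> R -> R)
    (hphi_cont : forall j, {within `[t, T], continuous (phi j)})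
    (hphi : complete_orthonormal t T phi)
    (tau : nat -> nat -> R) (htau : partition_sequence t T tau)
    (zeta : 'I_m.+1 -> nat -> Omega -> R)
    (hzeta : forall r j,
      is_ito_integral P F (integrator f r) t T (fun s _ => phi j s) (zeta r j))
    (J : Omega -> R) (hJ : is_iterated_ito P F f t i psi T J) :
  [/\ forall (r : 'I_m) j B, measurable B ->
        P (zeta (lift ord0 r) j @^-1` B) = normal_prob 0 1 B,
      mutually_independent P (fun rj : 'I_m * nat =>
        preimage_set_system setT (zeta (lift ord0 rj.1) rj.2) measurable)
    & exists Y : ('I_k -> nat) -> Omega -> R,
        (forall j, lim_mean_square P
           (fun N omega => \sum_(l in G_set k N) \prod_(q < k)
              (phi (j q) (tau N (l q)) *
               (integrator f (i q) (tau N (l q).+1) omega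
                - integrator f (i q) (tau N (l q)) omega)))
           \oo (Y j)) /\
        lim_mean_square P
          (fun p omega =>
             \sum_(j : {dffun forall l : 'I_k, 'I_(p l).+1})
               fourier_coef t T psi phi (fun l => j l) *
               (\prod_(l < k) zeta (i l) (j l) omega
                - Y (fun l => j l) omega))
          (@joint_infty k) J].
Proof.
have tT' : t <= T by exact: ltW.
have ophi := phi_orthonormal hphi.
have hs n : is_partition t T n.+1 (tau n.+1) by have [h _] := htau; exact: h.
split.
- move=> r j B; exact: (zeta_normal hF hf ht tT' htau hphi_cont ophi hzeta).
- exact: (zeta_independent hF hf ht tT' htau hphi_cont ophi hzeta).
have HI (j : 'I_k -> nat) := phi_distinct_sum_lim ht htT hF hf i hphi_cont htau j.
(* The limit of the sums over G_set is the product of the zeta minus the limit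
   of the sums over distinct cells. *)
pose I j := s2val (cid2 (HI j)).
have LI j : L2 P (I j) by rewrite /I; case: cid2.
have hI j : sqnorm P (fun w => phi_distinct_sum f i phi tau j n w - I j w) @[n --> \oo] --> (0 : R).
  by rewrite /I; case: cid2.
have Lz (j : 'I_k -> nat) : L2 P (fun w => \prod_(q < k) zeta (i q) (j q) w).
  by have [] := zeta_prod_cvg hF hf ht tT' htau hphi_cont ophi hzeta i j.
exists (fun j w => \prod_(q < k) zeta (i q) (j q) w - I j w); split.
- move=> j; have [bz _ cz] := zeta_prod_cvg hF hf ht tT' htau hphi_cont ophi hzeta i j.
  pose X N w := \sum_(l in G_set k N) \prod_(q < k) (phi (j q) (tau N (l q)) *
       (integrator f (i q) (tau N (l q).+1) w - integrator f (i q) (tau N (l q)) w)).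
  have XE n w : X n.+1 w = \prod_(q < k) zeta_sum f tau (phi (j q)) (i q) n.+1 w -
      phi_distinct_sum f i phi tau j n w.
    exact: (@G_set_sum _ _ _ m f n.+1 (tau n.+1) k i (fun q => phi (j q)) w).
  have LD n := phi_distinct_sum_L2 ht htT hF hf i phi htau j n.
  have czS := cz; rewrite -cvg_shiftS /= in czS.
  have bzS : \forall n \near \oo, L2 P (fun w => \prod_(q < k) zeta_sum f tau (phi (j q)) (i q) n.+1 w).
    have [M _ HM] := bounded_moments_L2 bz; exists M => // n /= Mn.
    by apply: HM; exact: leqW.
  have LX : \forall N \near \oo, L2 P (X N).
    have [M _ HM] := bzS; exists M.+1 => // -[//|n] /= Mn.
    apply: (@L2_ext _ _ _ _ (fun w => \prod_(q < k) zeta_sum f tau (phi (j q)) (i q) n.+1 w -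
      phi_distinct_sum f i phi tau j n w)); first by move=> w; rewrite XE.
    by apply: L2B => //; exact: HM.
  apply: (lim_mean_square_cvg (X := X)) => //; first exact: L2B.
  rewrite -cvg_shiftS /=.
  apply: cvg0_le (cvg0_2D czS (hI j)); apply: filterS bzS => n Ln.
  rewrite ip_ge0/=.
  have E w : X n.+1 w - (\prod_(q < k) zeta (i q) (j q) w - I j w) =
    (\prod_(q < k) zeta_sum f tau (phi (j q)) (i q) n.+1 w - \prod_(q < k) zeta (i q) (j q) w)
    - (phi_distinct_sum f i phi tau j n w - I j w) by rewrite XE; ring.
  rewrite (eq_ip _ E E).
  apply: le_trans (ipD_le (L2B Ln (Lz j)) (L2N (L2B (LD n) (LI j)))) _.
  by rewrite ipN.
have LJ : L2 P J by exact: iterated_ito_L2 hJ.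
have EX (p : 'I_k -> nat) w : \sum_(j : {dffun forall l : 'I_k, 'I_(p l).+1})
      fourier_coef t T psi phi (fun l => j l) *
      (\prod_(l < k) zeta (i l) (j l) w -
       (\prod_(q < k) zeta (i q) (j q) w - I (fun l => j l) w)) =
    expansion_sum t T psi phi p I w.
  by apply: eq_bigr => j _; rewrite fourier_coefE opprB addrC subrK.
apply: lim_mean_square_cvg => //.
  apply: nearW => p; apply: (L2_ext (fun w => esym (EX p w))).
  by apply: L2_sum => j _; exact: L2Z.
under eq_fun do rewrite (eq_ip _ (fun w => congr1 (+%R^~ (- J w)) (EX _ w))
  (fun w => congr1 (+%R^~ (- J w)) (EX _ w))).
apply/cvgrPdist_le => e e0.
pose c : R := 3 * (#|{perm 'I_k}|%:R * ito_const T ^+ k).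
have c0 : 0 <= c.
  by rewrite !mulr_ge0// exprn_ge0// ito_const_ge0//; exact: le_trans tT'.
have e1_0 : 0 < e / (c + 1) by rewrite divr_gt0// ltr_wpDl.
have [n Hn] := partial_sum_cvg hphi_cont hphi (kernel_box_L2 hphi_cont hphi htau hpsi)
  (kernel_box_approximable hphi_cont hphi htau hpsi) e1_0.
exists n => p np; rewrite sub0r normrN ger0_norm ?ip_ge0//.
apply: le_trans (partial_sum_ito_le ht htT hF hf hpsi hphi_cont hphi htau hJ p LI hI) _.
apply: (@le_trans _ _ (c * (e / (c + 1)))); first by rewrite ler_wpM2l// Hn.
rewrite mulrA ler_pdivrMr ?ltr_wpDl//.
by rewrite mulrC ler_pM2l// lerDl.
Qed.
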